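(* Let $p$ be a prime, $q$ a prime power with $p\nmid q$, $d$ the multiplicative order of $q$ modulo $p$, and $\lambda_i=v_p(q^{dp^i}-1)$ for $i\ge0$. Let $G=\prod_{j=1}^{r}C_{p^j}^{k_j}$ with $k_j\ge0$, $k_r>0$, and $c_i=\sum_{j=1}^{r}\min(i,j)k_j$. Let $b_i=c_{\lambda_i}-\lambda_i-i$, and let $l$ be the smallest index $i\ge0$ minimizing $p^{-i}\left(b_i-\frac{1}{p-1}\right)$. Then for every $n\ge0$, $$v_p([z^n]F(G,q;z))\geq b_l\left\lfloor\frac{n}{dp^l}\right\rfloor-v_p\left(\left\lfloor\frac{n}{dp^l}\right\rfloor!\right).$$
   Context: $C_m$ is the cyclic group of order $m$; $v_p$ is the $p$-adic valuation on $\mathbb{Q}$ (with $v_p(0)=+\infty$); $[z^n]$ denotes the coefficient of $z^n$. With $(q;q)_n=\prod_{i=1}^n(1-q^i)$, define the power series $F(G,q;z)=\sum_{n\ge0}\frac{(-1)^n\#\operatorname{Hom}(G,GL_n(\mathbb{F}_q))}{q^{\binom n2}(q;q)_n}z^n\in\mathbb{Q}[[z]]$, where $\#\operatorname{Hom}$ counts group homomorphisms. *)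

(* Defs.v *)
From HB Require Import structures.
From mathcomp Require Import all_boot all_order all_algebra all_fingroup.
From mathcomp Require Import constructive_ereal.

Set Implicit Arguments.
Unset Strict Implicit.
Unset Printing Implicit Defensive.

Import Order.TTheory GRing.Theory Num.Theory.
Local Open Scope ring_scope.

Definition vp (p : nat) (x : rat) : \bar int :=
  if x == 0 then +oo%E
  else ((logn p `|numq x|)%:Z - (logn p `|denq x|)%:Z)%:E.

(* Index set of the cyclic factors: the pair (j, t) stands for the t-th of the
   k_(j+1) copies of C_(p^(j+1)), for j + 1 = 1, ..., r. *)
Definition factor_index (r : nat) (k : nat -> nat) : finType :=
  {j : 'I_r & 'I_(k j.+1)}.

(* The product of the C_(p^j)^(k j) for 1 <= j <= r. The group law of 'Z_m is
   addition; 'Z_m has m elements since m = p ^ j.+1 >= 2 when p is prime. *)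
Definition abelian_pgroup (p r : nat) (k : nat -> nat) : finGroupType :=
  {dffun forall i : factor_index r k, 'Z_(p ^ (tag i).+1)}.

(* Homomorphisms gT -> GL_n(F), as functions into 'M[F]_n with invertible
   values. The library's 'GL_n[F] is not used because 'GL_0[F] is the group of
   1 x 1 matrices, whereas here GL_0(F) has to be trivial. *)
Definition Hom_GL (gT : finGroupType) (F : finFieldType) (n : nat) :
    {set {ffun gT -> 'M[F]_n}} :=
  [set f : {ffun gT -> 'M[F]_n} |
     [forall x, f x \in unitmx] &&
     [forall x, forall y, f (x * y)%g == f x *m f y]].

Definition qpoch (q : rat) (n : nat) : rat := \prod_(1 <= i < n.+1) (1 - q ^+ i).

(* A power series in Q[[z]] is encoded as its coefficient sequence
   n |-> [z^n]. *)
Definition power_series : Type := nat -> rat.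

Definition coefz (n : nat) (f : power_series) : rat := f n.

Definition Fseries (gT : finGroupType) (F : finFieldType) : power_series :=
  fun n => let q : rat := #|F|%:R in
  (-1) ^+ n * #|Hom_GL gT F n|%:R / (q ^+ 'C(n, 2) * qpoch q n).

(* The order of q in the group of units modulo p; junk when p divides q. *)
Definition mult_order (p q : nat) : nat :=
  #[insubd (1%g : {unit 'F_p}) (q%:R : 'F_p)]%g.

Definition lambda (p q d i : nat) : nat := logn p (q ^ (d * p ^ i) - 1).

Definition c (r : nat) (k : nat -> nat) (i : nat) : nat :=
  (\sum_(1 <= j < r.+1) minn i j * k j)%N.

Definition b (p q d r : nat) (k : nat -> nat) (i : nat) : int :=
  (c r k (lambda p q d i))%:Z - (lambda p q d i)%:Z - i%:Z.

Definition slope (p q d r : nat) (k : nat -> nat) (i : nat) : rat :=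
  p%:R ^- i * ((b p q d r k i)%:~R - (p%:R - 1)^-1).

Definition minimizes (f : nat -> rat) (i : nat) : Prop :=
  forall j : nat, f i <= f j.

Definition least_minimizer (f : nat -> rat) (l : nat) : Prop :=
  minimizes f l /\ forall i : nat, minimizes f i -> (l <= i)%N.

(* Main.v *)
Require Import Defs.
From HB Require Import structures.
From mathcomp Require Import all_boot all_order all_algebra all_fingroup.
From mathcomp Require Import cyclic all_field.
From mathcomp Require Import constructive_ereal.
From mathcomp Require Import zify ring.
Import Order.TTheory GRing.Theory Num.Theory.
Local Open Scope ring_scope.

(** The coefficient of z^n in F(G, q; z) is #Hom(G, GL_n(F_q)) / #GL_n(F_q), so
   F counts F_q[G]-modules weighted by automorphisms. As F_q[G] is a product of
   fields, F is the product of the series f_{q^e}(z^e), e running over the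
   degrees of these fields, with f_Q(z) = sum_n z^n / #GL_n(F_Q); and
   the sum of the degrees e dividing M is #{g in G | g^(q^M) = g}.

   The ratio g(z) = f_Q(z) / f_Q(uz), u = 1/Q, is the Rogers-Ramanujan
   continued fraction g(z) = 1 + uz / g(uz). Write it as a product of factors
   (1 - u^j z^e)^(-c_{e,j}) and let C_e(u) = sum_j c_{e,j} u^j, in Z[u]. If zeta
   is a primitive N-th root of unity, the product of the transfer matrices of
   the continued fraction at u = zeta over one period has trace 1, so that
   prod_j g_zeta(zeta^j z) = g_1(z^N); hence C_e vanishes at the nontrivial e-th
   roots of unity and C_e(u) = (1 + u + ... + u^(e-1)) A_e(u) over Z. It follows
   that log f_Q(z) = sum_{e,m} A_e(u^m) / (m (1 - u^m)) z^(em), and that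
     log F = sum_{e,M} #{g | g^(q^M) = g} / (M (1 - q^-M)) A_e(q^-M) z^(eM).

   If d does not divide M, the coefficient is p-adically close to that of a
   product of powers of factors 1 - q^-j z^e, with p-integral coefficients. If
   M = d p^i M' with M' prime to p, it has valuation at least b_i. So F is
   a product of p-integral series and of series exp(c z^(eM)) with v_p(c) >= b_i
   or v_p(c) >= 1. The minimality of l bounds the coefficients of each of them,
   and the bound is inherited by products because b_l <= 0. *)

Set Implicit Arguments.
Unset Strict Implicit.
Unset Printing Implicit Defensive.

(** * Truncated power series and logarithmic derivatives *)

(** Logarithms need denominators, so series are polynomials modulo z^N and log P is replaced by z
    P'/P, which makes sense over Z[u].

    The obstacle is the denominator M(1 - q^-M). If d does not divide M, then 1 - q^-M is a p-adic
    unit but 1/M need not be p-integral, so the terms cannot be bounded one by one. They are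
    compared with A_e(u^M)(1 - u^M)^K at u = 1/q, for a suitable K; taken over all M, these terms
    belong to a product of integral powers of factors 1 - u^j z^e. If d divides M, the added term is
    divisible by a high power of p: this is the source of the exponentials with v_p(c) >= 1.

    The division of C_e by 1 + u + ... + u^(e-1) turns the denominator 1 - q^-(eM) into 1 - q^-M.
    Otherwise p could divide the denominator while #{g | g^(q^M) = g} is 1.

    Since v_p(j!) grows like j/(p - 1), the slope p^-i (b_i - 1/(p - 1)) is, up to the factor 1/d,
    the asymptotic valuation per degree of the coefficients of exp(c z^(d p^i)) with v_p(c) =
    b_i. *)

Section TruncatedSeries.
Variable R : comNzRingType.
Implicit Types (P Q l m S : {poly R}) (N : nat).

Definition eqmod N P Q := exists S, P - Q = S * 'X^N.

Lemma eqmod_refl N P : eqmod N P P.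
Proof. by exists 0; rewrite subrr mul0r. Qed.

(** Congruences are combined through explicit multipliers, which leaves a side condition that [ring]
    decides; most later congruences are obtained in this way. *)
Lemma eqmod_lin N P Q c P' Q' :
  eqmod N P Q -> P' - Q' = c * (P - Q) -> eqmod N P' Q'.
Proof. by move=> [S e] e'; exists (c * S); rewrite e' e mulrA. Qed.

Lemma eqmod_lin2 N P Q c P1 Q1 c1 P' Q' :
  eqmod N P Q -> eqmod N P1 Q1 ->
  P' - Q' = c * (P - Q) + c1 * (P1 - Q1) -> eqmod N P' Q'.
Proof.
move=> [S e] [S1 e1] e'; exists (c * S + c1 * S1).
by rewrite e' e e1 mulrDl !mulrA.
Qed.

Lemma eqmod_sym N P Q : eqmod N P Q -> eqmod N Q P.
Proof. by move=> h; apply: (eqmod_lin (c := -1) h); ring. Qed.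

Lemma eqmod_trans N Q P S : eqmod N P Q -> eqmod N Q S -> eqmod N P S.
Proof. by move=> h k; apply: (eqmod_lin2 (c := 1) (c1 := 1) h k); ring. Qed.

Lemma eqmodD N P Q P' Q' :
  eqmod N P Q -> eqmod N P' Q' -> eqmod N (P + P') (Q + Q').
Proof. by move=> h k; apply: (eqmod_lin2 (c := 1) (c1 := 1) h k); ring. Qed.

Lemma eqmodM N P Q P' Q' :
  eqmod N P Q -> eqmod N P' Q' -> eqmod N (P * P') (Q * Q').
Proof. by move=> h k; apply: (eqmod_lin2 (c := P') (c1 := Q) h k); ring. Qed.

Lemma eqmodP N P Q : eqmod N P Q <-> (forall i, (i < N)%N -> P`_i = Q`_i).
Proof.
split=> [[S e] i lt_iN|e].
  by apply/eqP; rewrite -subr_eq0 -coefB e coefMXn lt_iN.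
exists (drop_poly N (P - Q)); rewrite -[LHS](poly_take_drop N).
rewrite [take_poly _ _](_ : _ = 0) ?add0r //; apply/polyP=> i.
by rewrite coef_take_poly coef0 coefB; case: ifP => // /e ->; rewrite subrr.
Qed.

Definition theta P := 'X * P^`().

Lemma coef_theta P n : (theta P)`_n = P`_n *+ n.
Proof. by rewrite /theta coefXM; case: n => [|n] //=; rewrite coef_deriv. Qed.

Lemma theta_eqmod N P Q : eqmod N P Q -> eqmod N (theta P) (theta Q).
Proof. by rewrite !eqmodP => e i /e h; rewrite !coef_theta h. Qed.

Lemma thetaM P Q : theta (P * Q) = theta P * Q + P * theta Q.
Proof. by rewrite /theta derivM; ring. Qed.

Lemma theta1 : theta 1 = 0.
Proof. by rewrite /theta -polyC1 derivC mulr0. Qed.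

(* [l] is the logarithmic derivative [z P'(z) / P(z)] up to [O(z^N)]. *)
Definition LD N P l := P`_0 = 1 /\ eqmod N (theta P) (P * l).

Lemma LD1 N : LD N 1 0.
Proof.
split; first by rewrite coef1.
by rewrite mulr0 theta1; apply: eqmod_refl.
Qed.

Lemma LDM N P l Q m : LD N P l -> LD N Q m -> LD N (P * Q) (l + m).
Proof.
move=> [p0 hp] [q0 hq]; split; first by rewrite coef0M p0 q0 mulr1.
by apply: (eqmod_lin2 (c := Q) (c1 := P) hp hq); rewrite thetaM; ring.
Qed.

Lemma LD_prod N (I : Type) (r : seq I) (P : pred I) (F G : I -> {poly R}) :
  (forall i, P i -> LD N (F i) (G i)) ->
  LD N (\prod_(i <- r | P i) F i) (\sum_(i <- r | P i) G i).
Proof.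
by move=> h; elim/big_ind2: _ => //; [exact: LD1 | move=> *; exact: LDM].
Qed.

Lemma LD_eqmodr N P l m : LD N P l -> eqmod N l m -> LD N P m.
Proof.
by move=> [p0 hp] h; split=> //; apply: (eqmod_lin2 (c := 1) (c1 := P) hp h); ring.
Qed.

Lemma LD_eqmodl N P Q l :
  (0 < N)%N -> LD N P l -> eqmod N P Q -> LD N Q l.
Proof.
move=> N_gt0 [p0 hp] h; split; first by have /eqmodP <- := h.
apply: (eqmod_trans (eqmod_sym (theta_eqmod h))).
by apply: (eqmod_lin2 (c := 1) (c1 := l) hp h); ring.
Qed.

Lemma eqmod_inv N P : P`_0 = 1 -> exists2 Q : {poly R}, Q`_0 = 1 & eqmod N (P * Q) 1.
Proof.
move=> p0; pose y := drop_poly 1 (1 - P).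
have ey : 1 - P = y * 'X.
  rewrite -['X]expr1 -[LHS](poly_take_drop 1) [take_poly _ _](_ : _ = 0) ?add0r //.
  apply/polyP=> i; rewrite coef_take_poly coef0; case: i => [|i] //=.
  by rewrite coefB coef1 p0 subrr.
exists (\sum_(i < N.+1) (y * 'X) ^+ i).
  rewrite coef_sum big_ord_recl expr0 coef1 eqxx big1 ?addr0 // => i _.
  by rewrite exprS -mulrA coef0M coef0M coefX mul0r mulr0.
exists (- (y ^+ N.+1 * 'X)).
have -> : P = 1 - y * 'X by rewrite -ey; ring.
have := subrX1 (y * 'X) N.+1; set s := \sum_(i < _) _ => e.
have -> : (1 - y * 'X) * s - 1 = - ((y * 'X - 1) * s) - 1 by ring.
by rewrite -e exprMn (exprS 'X); ring.
Qed.

Lemma LDV N P l : (0 < N)%N -> LD N P l ->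
  exists2 Q, LD N Q (- l) & eqmod N (P * Q) 1.
Proof.
move=> N0 [p0 hp]; have [Q q0 hQ] := eqmod_inv N p0.
exists Q => //; split=> //.
have h1 := theta_eqmod hQ; rewrite thetaM theta1 in h1.
have h2 : eqmod N (theta P * Q + P * theta Q) (l + P * theta Q).
  apply: (eqmod_lin2 (c := Q) (c1 := l) hp hQ); ring.
have h3 : eqmod N (P * theta Q) (- l).
  by apply: (eqmod_lin2 (c := 1) (c1 := -1) h1 h2); ring.
have h4 : eqmod N (P * Q * theta Q) (theta Q).
  by apply: (eqmod_lin (c := theta Q) hQ); ring.
by apply: (eqmod_lin2 (c := -1) (c1 := Q) h4 h3); ring.
Qed.

Lemma LD_exists N P : P`_0 = 1 -> exists l, LD N P l.
Proof.
move=> p0; have [Q q0 hQ] := eqmod_inv N p0.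
exists (theta P * Q); split=> //.
by apply: (eqmod_lin (c := - theta P) hQ); ring.
Qed.

Lemma eqmodIl N P A B : P`_0 = 1 -> eqmod N (P * A) (P * B) -> eqmod N A B.
Proof.
move=> p0 h; have [Q q0 hQ] := eqmod_inv N p0.
by apply: (eqmod_lin2 (c := Q) (c1 := B - A) h hQ); ring.
Qed.

Lemma LD_uniqr N P Q l m : LD N P l -> LD N Q m -> eqmod N P Q -> eqmod N l m.
Proof.
move=> [p0 hp] [q0 hq] h; apply: (eqmodIl p0).
have := theta_eqmod h => h'.
have h1 : eqmod N (P * l) (Q * m).
  apply: eqmod_trans (eqmod_trans (eqmod_sym hp) h') hq.
by apply: (eqmod_lin2 (c := 1) (c1 := - m) h1 h); ring.
Qed.

Hypothesis torsion_free : forall (x : R) n, (0 < n)%N -> x *+ n = 0 -> x = 0.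

(** The quotient P / Q has logarithmic derivative 0, so n times its coefficient of z^n vanishes, and
    torsion-freeness makes the quotient 1. *)
Lemma LD_uniql N P Q l : LD N P l -> LD N Q l -> eqmod N P Q.
Proof.
case: N => [|N] hP hQ; first by exists (P - Q); rewrite expr0 mulr1.
have [Q' hQ' hQQ'] := LDV (ltn0Sn N) hQ.
have [pq0 h] := LDM hP hQ'; rewrite addrN mulr0 in h.
have h1 : eqmod N.+1 (P * Q') 1.
  apply/eqmodP=> -[|i] lt_iN; first by rewrite pq0 coef1.
  rewrite coef1 /=; apply: (@torsion_free _ i.+1) => //.
  by rewrite -coef_theta; have /eqmodP -> // := h; rewrite coef0.
by apply: (eqmod_lin2 (c := Q) (c1 := -P) h1 hQQ'); ring.
Qed.

End TruncatedSeries.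

Arguments eqmod_trans {R N} Q {P S}.

Section TruncatedMaps.
Variables (R R' : comNzRingType) (f : {rmorphism R -> R'}).

Lemma map_eqmod N (P Q : {poly R}) :
  eqmod N P Q -> eqmod N (map_poly f P) (map_poly f Q).
Proof.
by move=> [S e]; exists (map_poly f S); rewrite -rmorphB e rmorphM /= map_polyXn.
Qed.

Lemma map_LD N (P l : {poly R}) : LD N P l -> LD N (map_poly f P) (map_poly f l).
Proof.
move=> [p0 h]; split; first by rewrite coef_map /= p0 rmorph1.
rewrite -rmorphM /=; have := map_eqmod h.
by rewrite /theta rmorphM /= map_polyX deriv_map.
Qed.

End TruncatedMaps.

Section Substitutions.
Variable R : comNzRingType.
Implicit Types (P Q l m S : {poly R}) (N : nat).

Definition sc (u : R) P := P \Po (u *: 'X).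

Lemma coef_sc u P n : (sc u P)`_n = u ^+ n * P`_n.
Proof.
rewrite /sc comp_polyE coef_sum.
under eq_bigr => i _ do rewrite exprZn !coefZ coefXn.
case: (ltnP n (size P)) => hn; last first.
  rewrite (nth_default 0 hn) mulr0 big1 // => i _.
  by rewrite gtn_eqF ?mulr0 // (leq_trans (ltn_ord i)).
rewrite (bigD1 (Ordinal hn)) //= eqxx big1 ?addr0; first by rewrite mulr1 mulrC.
by move=> i; rewrite -val_eqE /= eq_sym => /negPf ->; rewrite !mulr0.
Qed.

Lemma scM u P Q : sc u (P * Q) = sc u P * sc u Q.
Proof. exact: comp_polyM. Qed.

Lemma scD u P Q : sc u (P + Q) = sc u P + sc u Q.
Proof. exact: comp_polyD. Qed.

Lemma scsc u v P : sc u (sc v P) = sc (u * v) P.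
Proof. by apply/polyP=> i; rewrite !coef_sc exprMn mulrA. Qed.

Lemma sc1 P : sc 1 P = P.
Proof. by apply/polyP=> i; rewrite coef_sc expr1n mul1r. Qed.

Lemma scZX u c : sc u (c *: 'X) = (u * c) *: 'X.
Proof. by rewrite /sc comp_polyZ comp_polyX scalerA mulrC. Qed.

Lemma eqmod_sc u N P Q : eqmod N P Q -> eqmod N (sc u P) (sc u Q).
Proof. by rewrite !eqmodP => h i /h e; rewrite !coef_sc e. Qed.

Lemma LD_sc u N P l : LD N P l -> LD N (sc u P) (sc u l).
Proof.
move=> [p0 h]; split; first by rewrite coef_sc p0 mul1r.
rewrite -scM; have := eqmod_sc u h; apply: eqmod_trans.
by apply/eqmodP=> i _; rewrite coef_theta !coef_sc coef_theta mulrnAr.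
Qed.

Lemma eqmod_compXn t N P Q : (0 < t)%N ->
  eqmod N P Q -> eqmod N (P \Po 'X^t) (Q \Po 'X^t).
Proof.
move=> t0; rewrite !eqmodP => h i lt_iN; rewrite !coef_comp_poly_Xn //.
by case: ifP => // _; apply: h; apply: leq_ltn_trans (leq_div _ _) lt_iN.
Qed.

Lemma LD_compXn N t P l : (0 < t)%N -> LD N P l ->
  LD N (P \Po 'X^t) ((l \Po 'X^t) *+ t).
Proof.
move=> t0 [p0 h]; split.
  by rewrite coef_comp_poly_Xn // dvdn0 div0n.
have -> : theta (P \Po 'X^t) = (theta P \Po 'X^t) *+ t.
  apply/polyP=> i; rewrite coefMn coef_theta !coef_comp_poly_Xn //.
  case: ifP => [/dvdnP[j ->]|_]; last by rewrite !mul0rn.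
  by rewrite mulnK // coef_theta mulrnA.
rewrite mulrnAr -comp_polyM -mulr_natl -[X in eqmod _ _ X]mulr_natl.
exact: eqmodM (eqmod_refl _ _) (eqmod_compXn t0 h).
Qed.

End Substitutions.

(** * Logarithmic derivatives of products of factors 1 - u^j z^e *)

Section DoubleSums.
Variable R : comNzRingType.
Implicit Types (a b : nat -> nat -> R) (N n : nat).

(** This is z d/dz of sum_{e,m} a(e,m) z^(em) / m, written without the denominator m. Only the
    coefficients below z^N are complete. *)
Definition dsum N a : {poly R} :=
  \sum_(1 <= e < N) \sum_(1 <= m < N) (a e m *+ e) *: 'X^(e * m).

Lemma coef_dsum N a n :
  (dsum N a)`_n =
  \sum_(1 <= e < N) \sum_(1 <= m < N) (a e m *+ e) * (n == e * m)%:R.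
Proof.
rewrite /dsum coef_sum; apply: eq_bigr => e _.
by rewrite coef_sum; apply: eq_bigr => m _; rewrite coefZ coefXn.
Qed.

Lemma coef_dsum_divisors N a n : (0 < n < N)%N ->
  (dsum N a)`_n = \sum_(1 <= e < N | (e %| n)%N) a e (n %/ e)%N *+ e.
Proof.
move=> /andP[n0 nN]; rewrite coef_dsum [RHS]big_mkcond; apply: eq_big_nat => e.
move=> /andP[e0 eN]; case: ifP => [/dvdnP[m em]|ndv]; last first.
  rewrite big1 // => m _; case: eqP => [em|_]; last by rewrite mulr0.
  by rewrite em dvdn_mulr in ndv.
have m0 : (0 < m)%N by rewrite em in n0; case: (m) n0.
have hm : m \in index_iota 1 N.
  by rewrite mem_index_iota m0 (leq_ltn_trans _ nN) // em leq_pmulr.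
rewrite (bigD1_seq m) ?iota_uniq //= big1 => [|i /negPf ne]; last first.
  by rewrite em mulnC eqn_pmul2l // eq_sym ne mulr0.
by rewrite em mulnC eqxx mulr1 addr0 mulKn.
Qed.

Lemma eq_dsum N a b :
  (forall e m, (0 < e < N)%N -> (0 < m < N)%N -> a e m = b e m) ->
  dsum N a = dsum N b.
Proof.
by move=> h; apply: eq_big_nat => e he; apply: eq_big_nat => m hm; rewrite h.
Qed.

Lemma dsumD N a b : dsum N (fun e m => a e m + b e m) = dsum N a + dsum N b.
Proof.
rewrite /dsum -big_split; apply: eq_bigr => e _ /=.
by rewrite -big_split; apply: eq_bigr => m _ /=; rewrite mulrnDl scalerDl.
Qed.

Lemma dsum0 N : dsum N (fun _ _ => 0) = 0.
Proof. by rewrite /dsum big1 // => e _; rewrite big1 // => m _; rewrite mul0rn scale0r. Qed.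

Lemma dsum_single N a k : (0 < k < N)%N ->
  dsum N (fun e m => if e == k then a e m else 0) =
  \sum_(1 <= m < N) (a k m *+ k) *: 'X^(k * m).
Proof.
move=> hk; rewrite /dsum (bigD1_seq k) ?iota_uniq ?mem_index_iota //= eqxx.
rewrite [X in _ + X]big1_seq ?addr0 // => e /andP[/negPf-> _].
by rewrite big1 // => m _; rewrite mul0rn scale0r.
Qed.

End DoubleSums.

Lemma map_dsum (R R' : comNzRingType) (f : {rmorphism R -> R'}) N a :
  map_poly f (dsum N a) = dsum N (fun e m => f (a e m)).
Proof.
apply/polyP=> n; rewrite coef_map /= !coef_dsum rmorph_sum /=.
apply: eq_bigr => e _; rewrite rmorph_sum /=; apply: eq_bigr => m _.
by rewrite rmorphM /= rmorphMn rmorph_nat.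
Qed.

Section GhostComponents.

(** Integrality is carried by the coefficient ring: [{poly int}] is Z[u], and the outer variable is
    z. *)
Definition LDable N (l : {poly {poly int}}) := exists P, LD N P l.

Lemma LDable_sum N (I : eqType) (r : seq I) (F : I -> {poly {poly int}}) :
  (forall i, i \in r -> LDable N (F i)) -> LDable N (\sum_(i <- r) F i).
Proof.
move=> h; rewrite big_seq; elim/big_ind: _ => //.
- by exists 1; apply: LD1.
- by move=> x y [P hP] [Q hQ]; exists (P * Q); apply: LDM.
Qed.

Lemma LDable_mulrz N l (c : int) : (0 < N)%N -> LDable N l -> LDable N (l *~ c).
Proof.
move=> N0 [P hP].
have pow Q m n : LD N Q m -> LDable N (m *+ n).
  elim: n => [|n IHn] hQ; first by exists 1; apply: LD1.
  by have [Q' hQ'] := IHn hQ; exists (Q * Q'); rewrite mulrS; apply: LDM.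
case: c => n; rewrite ?NegzE -?pmulrn; first exact: pow hP.
by have [Q hQ _] := LDV N0 hP; rewrite mulrNz -mulNrz -pmulrn; apply: pow hQ.
Qed.

(* The logarithmic derivative of [1 / (1 - u^j z^e)]. *)
Lemma LDable_geometric N e j : (0 < e)%N -> (0 < N)%N ->
  LDable N (\sum_(1 <= m < N) ('X^(j * m) *+ e) *: 'X^(e * m)).
Proof.
move=> e0 N0; pose y : {poly {poly int}} := 'X^j *: 'X^e.
have ym m : 'X^(j * m) *: 'X^(e * m) = y ^+ m.
  by rewrite /y exprZn -!exprM.
have yN M : (N <= M)%N -> eqmod N (y ^+ M) 0.
  move=> hM; apply/eqmodP=> i lt_iN; rewrite -ym coefZ coefXn coef0.
  rewrite ltn_eqF ?mulr0 //; apply: leq_trans lt_iN _.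
  by apply: leq_trans hM _; rewrite leq_pmull.
have -> : \sum_(1 <= m < N) ('X^(j * m) *+ e) *: 'X^(e * m) =
          - (- (\sum_(1 <= m < N) y ^+ m) *+ e).
  rewrite mulNrn opprK -sumrMnl; apply: eq_bigr => m _.
  by rewrite -ym -scalerMnl.
have hLD : LD N (1 - y) (- (\sum_(1 <= m < N) y ^+ m) *+ e).
  split.
    by rewrite coefB coef1 /y coefZ coefXn (ltn_eqF e0) mulr0 subr0.
  have -> : theta (1 - y) = - y *+ e.
    apply/polyP=> i; rewrite coef_theta coefMn coefN coefB coef1 /y coefZ coefXn.
    have [->|_] := eqVneq i e; first by rewrite gtn_eqF // sub0r.
    by case: i => [|i]; rewrite ?mulr0n mulr0 ?subr0 ?oppr0 ?mul0rn.
  rewrite mulrnAr mulrN; set s := \sum_(_ <= _ < _) _.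
  have es : (1 - y) * s = y - y ^+ N.
    have := subrX1 y N; rewrite -(big_mkord xpredT (fun i => y ^+ i)).
    rewrite big_ltn // expr0 -/s => h.
        have -> : (1 - y) * s = y - 1 - (y - 1) * (1 + s) by ring.
    by rewrite -h; ring.
  rewrite es; have [S hS] := yN N (leqnn N); exists (- S *+ e).
  move: hS; rewrite subr0 => hS; rewrite opprB mulrnDl mulNrn hS.
  by rewrite mulNrn mulNr -mulrnAl; ring.
by have [Q hQ _] := LDV N0 hLD; exists Q.
Qed.

Lemma LDable_level N e (C : {poly int}) : (0 < e)%N -> (0 < N)%N ->
  LDable N (\sum_(1 <= m < N) ((C \Po 'X^m) *+ e) *: 'X^(e * m)).
Proof.
move=> e0 N0.
have -> : \sum_(1 <= m < N) ((C \Po 'X^m) *+ e) *: 'X^(e * m) =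
   \sum_(j < size C)
      (\sum_(1 <= m < N) ('X^(j * m) *+ e) *: 'X^(e * m) : {poly {poly int}}) *~ C`_j.
  under eq_bigr => m _ do rewrite comp_polyE -sumrMnl scaler_suml.
  rewrite exchange_big; apply: eq_bigr => j _ /=.
  rewrite (big_morph (fun x => x *~ C`_j) (id1 := 0) (op1 := +%R)); first last.
  - by rewrite mul0rz.
  - by move=> x y; rewrite mulrzDl.
  apply: eq_bigr => m _; rewrite scalerMzl !pmulrn mulrzAC; congr ((_ *~ _) *: _).
  by rewrite -exprM mulnC -mulrzr -mul_polyC mulrC -[C`_j in LHS]intz rmorph_int.
apply: LDable_sum => j _; apply: LDable_mulrz => //; exact: LDable_geometric.
Qed.

(** The logarithmic derivative of prod_{e,j} (1 - u^j z^e)^(-c_{e,j}) with C_e = sum_j c_{e,j} u^j.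
    As for ghost components of Witt vectors, the substitutions u -> u^m are what ensures
    integrality. *)
Definition ghost N (C : nat -> {poly int}) : {poly {poly int}} :=
  dsum N (fun e m => C e \Po 'X^m).

Lemma LDable_ghost N C : (0 < N)%N -> LDable N (ghost N C).
Proof.
move=> N0; apply: LDable_sum => e; rewrite mem_index_iota => /andP[e0 _].
exact: LDable_level.
Qed.

Lemma polyint_torsion_free (x : {poly int}) n : (0 < n)%N -> x *+ n = 0 -> x = 0.
Proof.
move=> n0 h; apply/polyP=> i; move/(congr1 (fun p : {poly int} => p`_i)): h.
by rewrite coefMn !coef0 => /eqP; rewrite mulrn_eq0 gtn_eqF // => /eqP.
Qed.

(** One degree is repaired at a time: if the product found so far agrees with P below z^N and
    differs by d at z^N, the factors with e = N and C_N = d multiply it by 1 + d z^N + ... The order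
    of agreement N and the precision T are kept apart, since each new factor must be known up to
    z^T. *)
Lemma LD_ghost T (P : {poly {poly int}}) : (0 < T)%N -> P`_0 = 1 -> exists C, LD T P (ghost T C).
Proof.
move=> T0 p0.
suff main N : (N <= T)%N -> exists C P', eqmod N P P' /\ LD T P' (ghost T C).
  have [C [P' [h hC]]] := main T (leqnn T); exists C.
  by apply: LD_eqmodl T0 hC (eqmod_sym h).
elim: N => [|N IHN] lt_NT.
  exists (fun=> 0), 1; split; first by exists (P - 1); rewrite expr0 mulr1.
  apply: LD_eqmodr (LD1 _ _) _; rewrite /ghost.
  under [X in eqmod _ _ X]eq_bigr => e _ do
    (rewrite big1 => [|m _]; last by rewrite comp_poly0 mul0rn scale0r).
  by rewrite big1 //; apply: eqmod_refl.
have [N0|N0] := posnP N.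
  have [C [P' [_ [p'0 hC]]]] := IHN (ltnW lt_NT); exists C, P'; split=> //.
  by apply/eqmodP=> i; rewrite N0 ltnS leqn0 => /eqP->; rewrite p0 p'0.
have [C [P' [h hC]]] := IHN (ltnW lt_NT).
pose d := P`_N - P'`_N.
have [Q hQ] := LDable_level d N0 T0.
exists (fun e => if e == N then C e + d else C e), (P' * Q); split; last first.
  apply: LD_eqmodr (LDM hC hQ) _.
  rewrite -(@dsum_single _ T (fun e m => d \Po 'X^m)); last by rewrite N0 lt_NT.
  rewrite -dsumD; apply/eqmodP => i _; congr (polyseq _)`_i.
  apply: eq_dsum => e m _ _.
  by case: eqP; rewrite ?comp_polyD ?addr0.
(* Q = 1 + d z^N + O(z^(N+1)): its logarithmic derivative starts with N d z^N, and N can be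
   cancelled by torsion-freeness. *)
have {}hQ i : (i <= N)%N -> Q`_i = if i == 0%N then 1 else if i == N then d else 0.
  move: hQ => [q0 hQ]; case: i => [|i] // lt_iN /=.
  pose l' := \sum_(1 <= m < T) ((d \Po 'X^m) *+ N) *: 'X^(N * m.-1).
  have el : \sum_(1 <= m < T) ((d \Po 'X^m) *+ N) *: 'X^(N * m) = l' * 'X^N.
    rewrite mulr_suml; apply: eq_big_nat => m /andP[m0 _].
    by rewrite -scalerAl -exprD -mulnSr prednK.
  have l'0 : l'`_0 = d *+ N.
    rewrite coef_sum big_ltn; last exact: leq_ltn_trans N0 lt_NT.
    rewrite big1_seq => [|m /andP[_]]; last first.
      rewrite mem_index_iota => /andP[m1 _]; rewrite coefZ coefXn.
      have h0 : (0 < N * m.-1)%N by rewrite muln_gt0 N0; lia.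
      by rewrite (ltn_eqF h0) mulr0.
    by rewrite coefZ coefXn muln0 eqxx mulr1 addr0 expr1 comp_polyXr.
  have := hQ; rewrite el mulrA => /eqmodP/(_ i.+1 (leq_ltn_trans lt_iN lt_NT)).
  rewrite coef_theta coefMXn; have [lt|] := ltnP i.+1 N.
    by move/polyint_torsion_free => ->; rewrite // ltn_eqF.
  move=> le_Ni; have eNi : i.+1 = N by apply/eqP; rewrite eqn_leq lt_iN.
  rewrite eNi eqxx subnn coef0M q0 l'0 mul1r => e.
  apply/eqP; rewrite -subr_eq0; apply/eqP.
  by apply: (polyint_torsion_free N0); rewrite mulrnBl e subrr.
apply/eqmodP=> i; rewrite ltnS => le_iN; rewrite coefM.
have [p'0 _] := hC.
have [->|ne0] := eqVneq i 0%N.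
  by rewrite big_ord1 subnn p'0 hQ // mulr1.
rewrite big_ord_recr /= subnn hQ // mulr1.
rewrite -(prednK (n := i)) ?lt0n // big_ord_recl /= subn0 p'0 mul1r prednK ?lt0n //.
rewrite big1 ?addr0 => [|j _]; last first.
  have hj : (bump 0 j < i)%N by rewrite /bump /= add1n -ltn_predRL ltn_ord.
  have hs : (0 < i - bump 0 j)%N by rewrite subn_gt0.
  rewrite hQ; last by rewrite (leq_trans (leq_subr _ _)).
  rewrite gtn_eqF // ltn_eqF ?mulr0 //; apply: leq_trans _ le_iN.
  by move: hj hs; rewrite /bump /=; lia.
rewrite hQ // (negPf ne0); have [->|ne] := eqVneq i N.
  by rewrite /d subrK.
rewrite add0r; have /eqmodP -> // := h; by rewrite ltn_neqAle ne.
Qed.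

End GhostComponents.

(** * Rogers-Ramanujan continued fraction *)

Section ContinuedFraction.
Variable R : comNzRingType.
Implicit Types (g P : {poly R}) (u : R) (N T : nat).

(* [g] is, up to [O(z^N)], the solution of [g(z) = 1 + u z / g(u z)]. *)
Definition cfrac u N g :=
  g`_0 = 1 /\ eqmod N (g * sc u g) (sc u g + u *: 'X).

Lemma sc_ZXn u c N : sc u (c *: 'X^N) = (u ^+ N * c) *: 'X^N.
Proof.
apply/polyP=> i; rewrite coef_sc !coefZ coefXn; case: eqP => [->|_].
  by rewrite mulrA.
by rewrite !mulr0.
Qed.

Lemma cfrac_exists u N : exists g, cfrac u N g.
Proof.
elim: N => [|N [g [g0 [S h]]]].
  exists 1; split; first by rewrite coef1.
  by exists (1 * sc u 1 - (sc u 1 + u *: 'X)); rewrite expr0 mulr1.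
have [N0|N0] := posnP N.
  exists 1; split; first by rewrite coef1.
  have -> : sc u 1 = 1 by rewrite /sc -polyC1 comp_polyC.
  by exists (- u%:P); rewrite N0 expr1 -mul_polyC; ring.
pose c := - S`_0; have sg0 : (sc u g)`_0 = 1 by rewrite coef_sc g0 mul1r.
pose w : {poly R} := 'X^N.
exists (g + c *: w); split.
  by rewrite coefD coefZ coefXn g0 (ltn_eqF N0) mulr0 addr0.
have [A hA] : exists A : {poly R}, S + c%:P * sc u g + (u ^+ N * c)%:P * (g - 1) = A * 'X.
  set B := S + _ + _; exists (drop_poly 1 B).
  rewrite -['X]expr1 -[LHS](poly_take_drop 1) [take_poly _ _](_ : _ = 0) ?add0r //.
  apply/polyP=> i; rewrite coef_take_poly coef0; case: i => [|i] //=.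
  rewrite /B !coefD !coefCM coefB coef1 g0 sg0 subrr mulr0 addr0 mulr1.
  by rewrite /c addrN.
have hX : 'X^(N.+1) = 'X * w by rewrite exprS.
have [B hB] : exists B : {poly R}, w = B * 'X.
  by exists 'X^(N.-1); rewrite -exprSr prednK.
exists (A + (c * (u ^+ N * c))%:P * B).
rewrite scD sc_ZXn -/w hX.
have -> : (A + (c * (u ^+ N * c))%:P * B) * ('X * w) =
  (A * 'X) * w + (c * (u ^+ N * c))%:P * (B * 'X) * w by ring.
rewrite -hA -hB -!mul_polyC.
move: h; rewrite -/w -!mul_polyC => h.
rewrite [in LHS](_ : (g + _) * _ - _ = g * sc u g - (sc u g + u%:P * 'X) +
   (c%:P * sc u g + (u ^+ N * c)%:P * (g - 1)) * w
   + (c * (u ^+ N * c))%:P * w * w); last by rewrite !polyCM; ring.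
by rewrite h; ring.
Qed.

End ContinuedFraction.

Lemma map_cfrac (R R' : comNzRingType) (f : {rmorphism R -> R'}) u N g :
  cfrac u N g -> cfrac (f u) N (map_poly f g).
Proof.
move=> [g0 h]; split; first by rewrite coef_map /= g0 rmorph1.
have e : sc (f u) (map_poly f g) = map_poly f (sc u g).
  by apply/polyP=> i; rewrite coef_map /= !coef_sc coef_map rmorphM rmorphXn.
rewrite e; have -> : f u *: 'X = map_poly f (u *: 'X).
  by rewrite -!mul_polyC rmorphM /= map_polyX map_polyC.
by rewrite -rmorphM -rmorphD; apply: map_eqmod.
Qed.

Lemma mx2E (R : nzRingType) (A B : 'M[R]_2) i j :
  (A *m B) i j = A i 0 * B 0 j + A i 1 * B 1 j.
Proof.
rewrite mxE !big_ord_recl big_ord0 addr0.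
by congr (_ * _ + _ * _); congr (_ _ _); apply: val_inj.
Qed.

Lemma det_mx22 (R : comNzRingType) (A : 'M[R]_2) :
  \det A = A 0 0 * A 1 1 - A 0 1 * A 1 0.
Proof.
rewrite (expand_det_row A 0) !big_ord_recl big_ord0 addr0 /cofactor !det_mx11.
rewrite !mxE /= !addn0 expr0 mul1r add0n expr1 mulN1r mulrN.
by congr (_ * _ - _ * _); congr (A _ _); apply: val_inj.
Qed.

Section RootsOfUnity.
Variables (L : fieldType) (z : L) (N : nat).
Hypothesis z_prim : N.-primitive_root z.

(* The transfer matrix of the recursion [f(x) = f(zx) + zx f(z^2 x)],
   shifted by [x -> z^j x]. *)
Definition transfer j : 'M[{poly L}]_2 :=
  \matrix_(a, b) if a == 0 then (if b == 0 then 1 else z ^+ j.+1 *: 'X)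
                 else (if b == 0 then 1 else 0).

Definition transfers j k : 'M[{poly L}]_2 := \prod_(j <= i < j + k) transfer i.

Lemma transfersS j k : transfers j k.+1 = transfers j k *m transfer (j + k).
Proof. by rewrite /transfers addnS big_nat_recr ?leq_addr. Qed.

Lemma transfersSl j k : transfers j k.+1 = transfer j *m transfers j.+1 k.
Proof. by rewrite /transfers addnS big_ltn ?ltnS ?leq_addr // addSn. Qed.

Lemma transfer_entries j :
  [/\ transfer j 0 0 = 1, transfer j 0 1 = z ^+ j.+1 *: 'X,
      transfer j 1 0 = 1 & transfer j 1 1 = 0].
Proof. by rewrite !mxE. Qed.

(** A factor x is picked up only in passing from index 0 to index 1, and the only way out of 1 is
    back to 0 with weight 1; so the degree grows by at most one in two steps. *)
Lemma size_transfers_row0 j k :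
  (size (transfers j k 0%R 0%R) <= k./2.+1)%N /\
  (size (transfers j k 0%R 1%R) <= (k.+1)./2.+1)%N.
Proof.
elim: k => [|k [IH0 IH1]].
  rewrite /transfers addn0 big_geq // !mxE /= size_poly1 size_poly0; by [].
have [e00 e01 e10 e11] := transfer_entries (j + k).
rewrite transfersS !mx2E e00 e01 e10 e11 !mulr1 mulr0 addr0; split.
  apply: leq_trans (size_polyD _ _) _; rewrite geq_max IH1 andbT.
  by apply: leq_trans IH0 _; rewrite ltnS half_leq.
rewrite -scalerAr; apply: leq_trans (size_scale_leq _ _) _.
apply: leq_trans (size_polyMleq _ _) _.
by rewrite size_polyX addn2 /=.
Qed.

(** The entry (1, 1) must begin with the step from 1 to 0, which leaves the entry (0, 1) of a
    product of k - 1 factors. *)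
Lemma size_transfers_trace j k : (1 < k)%N -> (size (\tr (transfers j k)) <= k)%N.
Proof.
move=> k1; rewrite /mxtrace !big_ord_recl big_ord0 addr0.
have -> : lift ord0 ord0 = 1 :> 'I_2 by apply: val_inj.
apply: leq_trans (size_polyD _ _) _; rewrite geq_max; apply/andP; split.
  by apply: leq_trans (size_transfers_row0 j k).1 _; lia.
case: k k1 => // k k1; rewrite transfersSl mx2E.
have [_ _ -> ->] := transfer_entries j; rewrite mul1r mul0r addr0.
by apply: leq_trans (size_transfers_row0 _ k).2 _; lia.
Qed.

Lemma transfers_row_at0 i j k : (0 < k)%N ->
  (transfers j k i 0)`_0 = 1 /\ (transfers j k i 1)`_0 = 0.
Proof.
have [e00 e01 e10 e11] := transfer_entries j.
case: k => // k _; elim: k => [|k [IH0 IH1]].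
  rewrite transfersS /transfers addn0 big_geq // mul1mx.
  case: (i == 0) / eqP => [->|].
    by rewrite e00 e01 coef1 coefZ coefX mulr0.
  case: i => -[|[|i]] hi // ne; first by case: ne; apply: val_inj.
  have -> : Ordinal hi = 1 by apply: val_inj.
  by rewrite e10 e11 coef1 coef0.
have {e00 e01 e10 e11}[e00 e01 e10 e11] := transfer_entries (j + k.+1).
rewrite transfersS !mx2E e00 e01 e10 e11 !mulr1 mulr0 addr0 coefD IH0 IH1 addr0.
by rewrite coef0M IH0 coefZ coefX !mulr0.
Qed.

Lemma transfer_period j : transfer (j + N) = transfer j.
Proof.
by apply/matrixP=> a b; rewrite !mxE -addSn exprD (prim_expr_order z_prim) mulr1.
Qed.

Lemma sc_transfers j k :
  map_mx (sc z) (transfers j k) = transfers j.+1 k.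
Proof.
have sc1z : sc z 1 = 1 by rewrite /sc -polyC1 comp_polyC.
have sc0z : sc z 0 = 0 by rewrite /sc -polyC0 comp_polyC.
elim: k => [|k IHk].
  rewrite /transfers !addn0 !big_geq //; apply/matrixP=> a b; rewrite !mxE.
  by case: (a == b).
rewrite !transfersS -IHk addSn; apply/matrixP=> a b.
rewrite mxE !mx2E scD !scM !mxE /=.
by case: ifP => _; rewrite ?sc1z ?sc0z ?scZX // -exprS.
Qed.

(* The trace is invariant under [x -> z x], hence a polynomial in [x^N], and
   its degree is less than [N]. *)
Lemma trace_transfers : \tr (transfers 0 N) = 1.
Proof.
have N0 := prim_order_gt0 z_prim.
have inv : sc z (\tr (transfers 0 N)) = \tr (transfers 0 N).
  transitivity (\tr (transfers 1 N)).
    rewrite -sc_transfers /mxtrace !big_ord_recl !big_ord0 !addr0 scD.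
    by rewrite !mxE.
  rewrite -(prednK N0) transfersS transfersSl mxtrace_mulC.
  by rewrite add1n prednK // -[in transfer _](add0n N) transfer_period.
apply/polyP=> i; rewrite coef1; have [->|i0] := eqVneq i 0%N.
  rewrite /mxtrace !big_ord_recl big_ord0 addr0 coefD.
  have -> : lift ord0 ord0 = 1 :> 'I_2 by apply: val_inj.
  by rewrite (transfers_row_at0 _ _ N0).1 (transfers_row_at0 _ _ N0).2 addr0.
have [lt_iN|le_Ni] := ltnP i N.
  have := congr1 (fun p : {poly L} => p`_i) inv.
  rewrite /= coef_sc => /eqP; rewrite -subr_eq0 -[X in _ - X]mul1r -mulrBl mulf_eq0.
  rewrite subr_eq0 -(prim_order_dvd z_prim) gtnNdvd ?lt0n //= => /eqP //.
rewrite nth_default //; have [N1|] := ltnP 1 N.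
  exact: leq_trans (size_transfers_trace 0 N1) le_Ni.
move=> N1; have -> : N = 1%N by apply/eqP; rewrite eqn_leq N1.
rewrite transfersS /transfers addn0 big_geq // mul1mx.
rewrite /mxtrace !big_ord_recl big_ord0 addr0 !mxE /= addr0 size_poly1.
by rewrite lt0n.
Qed.

Lemma det_transfers : \det (transfers 0 N) = - 'X^N.
Proof.
have N0 := prim_order_gt0 z_prim.
have -> : \det (transfers 0 N) = \prod_(0 <= i < N) - (z ^+ i.+1 *: 'X).
  rewrite /transfers add0n (big_morph _ (@det_mulmx _ 2) (det1 _ _)).
  apply: eq_bigr => i _; have [e00 e01 e10 e11] := transfer_entries i.
  by rewrite det_mx22 e00 e01 e10 e11 mulr0 mulr1 sub0r.
(* Constant term of X^N - 1 = prod_i (X - z^i). *)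
have e0 : \prod_(0 <= i < N) - z ^+ i = -1.
  have h0 := congr1 (fun p => p.[0]) (factor_Xn_sub_1 z_prim).
  rewrite /= horner_prod hornerD hornerN hornerXn hornerC expr0n in h0.
  rewrite (gtn_eqF N0) sub0r in h0; rewrite -h0; apply: eq_bigr => i _.
  by rewrite hornerXsubC sub0r.
have -> : \prod_(0 <= i < N) - (z ^+ i.+1 *: 'X) =
  (\prod_(0 <= i < N) - z ^+ i.+1)%:P * 'X^N.
  rewrite rmorph_prod /= -[in 'X^N](subn0 N) -prodr_const_nat -big_split /=.
  by apply: eq_bigr => i _; rewrite -scaleNr mul_polyC.
suff -> : \prod_(0 <= i < N) - z ^+ i.+1 = -1 by rewrite polyCN mulN1r.
rewrite -e0 -(big_add1 _ _ 0 N.+1 xpredT (fun i => - z ^+ i)).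
rewrite big_nat_recr //= (prim_expr_order z_prim) [RHS]big_ltn // expr0.
by rewrite mulrC.
Qed.

Variables (T : nat) (g : {poly L}).
Hypothesis g_cfrac : cfrac z T g.

Definition cfrac_norm := \prod_(1 <= j < N.+1) sc (z ^+ j) g.

(** The continued fraction says that [transfer j] sends the column (g(z^(j+1) x), 1) to g(z^(j+1) x)
    times (g(z^j x), 1). After a full period, k = N, the column (g, 1) is an eigenvector with
    eigenvalue [cfrac_norm]. *)
Lemma transfers_eigenvector i k :
  eqmod T (transfers 0 k i 0 * sc (z ^+ k) g + transfers 0 k i 1)
    ((\prod_(1 <= j < k.+1) sc (z ^+ j) g) * (if i == 0 then g else 1)).
Proof.
elim: k => [|k IHk].
  rewrite /transfers big_geq // big_geq // mul1r expr0 sc1.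
  case: i => -[|[|i]] hi //=; rewrite !mxE /= ?mul1r ?mul0r ?addr0 ?add0r;
  exact: eqmod_refl.
have [_ /(eqmod_sc (z ^+ k))] := g_cfrac; rewrite scM scD scsc scZX -exprSr => h.
have [e00 e01 e10 e11] := transfer_entries (0 + k).
rewrite transfersS !mx2E e00 e01 e10 e11 big_nat_recr //= add0n.
move: IHk h; set u := _ *: 'X; set p := \prod_(_ <= _ < _) _.
set w := if _ then _ else _ => IHk h.
by apply: (eqmod_lin2 (c := sc (z ^+ k.+1) g) (c1 := - transfers 0 k i 0) IHk h); ring.
Qed.

(** Characteristic equation of the eigenvalue, for trace 1 and determinant -x^N. *)
Lemma cfrac_norm_eq : eqmod T (cfrac_norm * cfrac_norm) (cfrac_norm + 'X^N).
Proof.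
have h0 := transfers_eigenvector 0 N; have h1 := transfers_eigenvector 1 N.
have tr := trace_transfers; have := det_transfers; rewrite det_mx22.
rewrite /mxtrace !big_ord_recl big_ord0 addr0 in tr.
have e1 : lift ord0 ord0 = 1 :> 'I_2 by apply: val_inj.
rewrite e1 in tr; move: h0 h1 tr; rewrite /= (prim_expr_order z_prim) sc1.
rewrite -/cfrac_norm.
move: cfrac_norm (transfers 0 N 0 0) (transfers 0 N 0 1) (transfers 0 N 1 0)
  (transfers 0 N 1 1) => G a b c d h0 h1 tr dt.
apply: (eqmod_lin2 (c := - c) (c1 := - (G - a)) h0 h1).
have -> : G * G - (G + 'X^N) = G * G - 1 * G + (- 'X^N) by ring.
by rewrite mulr1 -tr -dt; ring.
Qed.

(** At u = 1 the continued fraction is the quadratic equation h^2 = h + x, so both sides solve Y^2 =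
    Y + x^N with Y(0) = 1. Their difference is killed by their sum minus 1, which has constant term
    1. *)
Lemma cfrac_norm1 h : cfrac 1 T h -> eqmod T cfrac_norm (h \Po 'X^N).
Proof.
have N0 := prim_order_gt0 z_prim.
move=> [h0 /(eqmod_compXn N0)]; rewrite sc1 scale1r comp_polyM comp_polyD comp_polyX.
set H := h \Po _ => hH; have hG := cfrac_norm_eq.
have H0 : H`_0 = 1 by rewrite coef_comp_poly_Xn // dvdn0 div0n.
have G0 : cfrac_norm`_0 = 1.
  rewrite /cfrac_norm; elim/big_rec: _ => [|i x _ IH]; first by rewrite coef1.
  by rewrite coef0M IH coef_sc mul1r mulr1 (proj1 g_cfrac).
apply: (@eqmodIl _ _ (cfrac_norm + H - 1)).
  by rewrite coefB coefD G0 H0 coef1 addrK.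
by apply: (eqmod_lin2 (c := 1) (c1 := -1) hG hH); ring.
Qed.

Lemma sum_prim_expr n : (N %| n)%N -> \sum_(1 <= j < N.+1) (z ^+ j) ^+ n = N%:R.
Proof.
move=> dv; rewrite big_nat (eq_bigr (fun=> 1)) => [|j _].
  by rewrite -big_nat sumr_const_nat subSS subn0.
have /eqP zn : z ^+ n == 1 by rewrite -(prim_order_dvd z_prim).
by rewrite exprAC zn expr1n.
Qed.

End RootsOfUnity.

(** * Specialisation of u, and vanishing of C_e at roots of unity *)

Section Evaluation.
Variable R : comNzRingType.

Definition ev (x : R) : {poly int} -> R := horner_eval x \o map_poly intr.

HB.instance Definition _ x := GRing.RMorphism.copy (ev x) (horner_eval x \o map_poly intr).

Lemma evE x p : ev x p = (map_poly intr p).[x].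
Proof. by []. Qed.

Lemma ev_compXn x p m : ev x (p \Po 'X^m) = ev (x ^+ m) p.
Proof. by rewrite !evE map_comp_poly map_polyXn horner_comp hornerXn. Qed.

Lemma evX x : ev x 'X = x.
Proof. by rewrite evE map_polyX hornerX. Qed.

Lemma evXn x n : ev x 'X^n = x ^+ n.
Proof. by rewrite evE map_polyXn hornerXn. Qed.

Lemma map_ev_ghost x T C :
  map_poly (ev x) (ghost T C) = dsum T (fun e m => ev (x ^+ m) (C e)).
Proof. by rewrite map_dsum; apply: eq_dsum => e m _ _; exact: ev_compXn. Qed.

End Evaluation.

Section Vanishing.
Import Pdiv.Ring Pdiv.RingMonic.
Variables (T : nat) (g : {poly {poly int}}) (C : nat -> {poly int}).
Hypotheses (T0 : (0 < T)%N) (g_cfrac : cfrac 'X T g) (g_LD : LD T g (ghost T C)).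

Lemma cfrac_ev (R : comNzRingType) (x : R) :
  cfrac x T (map_poly (ev x) g) /\
  LD T (map_poly (ev x) g) (dsum T (fun e m => ev (x ^+ m) (C e))).
Proof.
split; last by rewrite -map_ev_ghost; apply: map_LD.
by have := map_cfrac (ev x) g_cfrac; rewrite /= evX.
Qed.

(** Logarithmic derivatives of both sides of [cfrac_norm1]: the sum over the N dilations multiplies
    the coefficient of degree n by N, and so does the substitution of the N-th power of the
    variable. *)
Lemma ghost_root_of_unity (z : algC) N n : N.-primitive_root z ->
  (0 < n < T)%N -> (N %| n)%N ->
  (dsum T (fun e m => ev (z ^+ m) (C e)))`_n =
  (dsum T (fun e m => ev 1 (C e)))`_(n %/ N).
Proof.
move=> zP hn dv; have N0 := prim_order_gt0 zP.
have [gz lz] := cfrac_ev z; have [g1 l1] := cfrac_ev (1 : algC).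
have {}l1 : LD T (map_poly (ev 1) g) (dsum T (fun e m => ev (1 : algC) (C e))).
  congr LD: l1; apply: eq_dsum => e m _ _; by rewrite expr1n.
have hG : LD T (cfrac_norm z N (map_poly (ev z) g))
    (\sum_(1 <= j < N.+1) sc (z ^+ j) (dsum T (fun e m => ev (z ^+ m) (C e)))).
  by apply: LD_prod => j _; apply: LD_sc.
have /eqmodP h := LD_uniqr hG (LD_compXn N0 l1) (cfrac_norm1 zP gz g1).
have := h n (proj2 (andP hn)); rewrite coef_sum.
under eq_bigr => j _ do rewrite coef_sc.
rewrite -mulr_suml (sum_prim_expr zP) // coefMn coef_comp_poly_Xn // dv.
rewrite mulr_natl => /eqP; rewrite -subr_eq0 -mulrnBl mulrn_eq0 (gtn_eqF N0) /=.
by rewrite subr_eq0 => /eqP.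
Qed.

(** Let N > 1 be the order of x, and compare sum_{k | e} k C_k(x^(e/k)) with sum_{k | e/N} k C_k(1).
    The terms with N | e/k agree; for the other k < e, x^(e/k) is a nontrivial k-th root of unity
    and the induction hypothesis applies. Only e C_e(x) remains. *)
Lemma ghost_vanish e (x : algC) : (0 < e < T)%N -> x ^+ e = 1 -> x != 1 ->
  ev x (C e) = 0.
Proof.
elim/ltn_ind: e x => n IH x hn xn x1.
have /andP[n0 nT] := hn.
have [N xN dv] := prim_order_exists n0 xn.
have N1 : (1 < N)%N.
  have := prim_order_gt0 xN; case: N xN {dv} => [|[|N]] // xN _.
  by rewrite -[x]expr1 (prim_expr_order xN) eqxx in x1.
have := ghost_root_of_unity xN hn dv.
have N0 : (0 < N)%N by apply: ltnW.
have hn' : (0 < n %/ N < T)%N.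
  rewrite divn_gt0 // dvdn_leq //=; exact: leq_ltn_trans (leq_div _ _) nT.
rewrite !coef_dsum_divisors // [LHS]big_mkcond [RHS]big_mkcond /=.
rewrite [LHS](bigD1_seq n) ?iota_uniq ?mem_index_iota //=.
rewrite [RHS](bigD1_seq n) ?iota_uniq ?mem_index_iota //= dvdnn divnn n0 expr1.
have -> : (n %| n %/ N)%N = false.
  by rewrite gtnNdvd ?ltn_Pdiv // divn_gt0 // dvdn_leq.
rewrite add0r => /eqP.
rewrite -subr_eq0 -addrA -sumrB big_seq_cond big1 ?addr0 => [|e].
  by rewrite mulrn_eq0 gtn_eqF //= => /eqP.
rewrite mem_index_iota => /andP[/andP[e0 eT] en].
have [/dvdnP[m em]|nd] := boolP (e %| n)%N; last first.
  case: ifP => [h|_]; last by rewrite subr0.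
  by case/negP: nd; apply: dvdn_trans h (dvdn_div dv).
have m0 : (0 < m)%N by move: n0; rewrite em muln_gt0 => /andP[].
rewrite em mulnK //.
have -> : (e %| (m * e) %/ N)%N = (N %| m)%N.
  by rewrite dvdn_divRL -?em // em mulnC dvdn_pmul2r.
have [/dvdnP[k ->]|Nm] := boolP (N %| m)%N.
  by rewrite mulnC exprM (prim_expr_order xN) expr1n subrr.
rewrite subr0 IH ?mul0rn //.
- by rewrite ltn_neqAle en dvdn_leq // em dvdn_mull.
- by rewrite e0.
- by rewrite -exprM -em.
- by rewrite -(prim_order_dvd xN).
Qed.

(** The polynomial A_e. The divisor is monic, so the division takes place in Z[u]. *)
Definition ghost_quotient e : {poly int} := rdivp (C e) (\sum_(i < e) 'X^i).

(** The remainder has degree less than e - 1 and vanishes at the e - 1 nontrivial e-th roots of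
    unity. *)
Lemma ghost_factor e : (0 < e < T)%N ->
  C e = ghost_quotient e * (\sum_(i < e) 'X^i).
Proof.
move=> he; have /andP[e0 eT] := he; rewrite /ghost_quotient.
set D : {poly int} := \sum_(i < e) 'X^i.
have sD : size D = e /\ D \is monic.
  have eD : D = \poly_(i < e) 1.
    by rewrite poly_def; apply: eq_bigr => i _; rewrite scale1r.
  have s : size D = e by rewrite eD size_poly_eq // oner_eq0.
  by split=> //; rewrite monicE lead_coefE s eD coef_poly ltn_predL e0.
have [sD1 mD] := sD.
have dE := rdivp_eq mD (C e).
have sr : (size (rmodp (C e) D) < e)%N.
  by rewrite -[X in (_ < X)%N]sD1 ltn_rmodp -size_poly_gt0 sD1.
suff r0 : rmodp (C e) D = 0 by rewrite [LHS]dE r0 addr0.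
have [z zP] := C_prim_root_exists e0.
pose f : {poly int} -> {poly algC} := map_poly intr.
have rr i : (0 < i < e)%N -> root (f (rmodp (C e) D)) (z ^+ i).
  move=> /andP[i0 ie]; rewrite rootE.
  have ze : (z ^+ i) ^+ e = 1 by rewrite exprAC (prim_expr_order zP) expr1n.
  have z1 : z ^+ i != 1 by rewrite -(prim_order_dvd zP) gtnNdvd.
  have D0 : ev (z ^+ i) D = 0.
    apply: (mulfI (_ : z ^+ i - 1 != 0)); first by rewrite subr_eq0.
    rewrite mulr0 rmorph_sum /=.
    under eq_bigr => j _ do rewrite evXn.
    by rewrite -subrX1 ze subrr.
  have := ghost_vanish he ze z1; rewrite {1}dE rmorphD rmorphM /= D0 mulr0 add0r.
  by rewrite evE => /eqP.
have inj : injective (intr : int -> algC) by exact: intr_inj.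
have f0 : f (rmodp (C e) D) = 0.
  apply/eqP; apply: contraTT sr => nz; rewrite -leqNgt.
  rewrite -(size_map_inj_poly inj (rmorph0 _)) -/f.
  have := max_poly_roots nz (rs := [seq z ^+ i | i <- index_iota 1 e]).
  rewrite size_map size_iota subn1 prednK //; apply.
    by apply/allP=> _ /mapP[i hi ->]; rewrite mem_index_iota in hi; exact: rr.
  rewrite map_inj_in_uniq ?iota_uniq // => i j; rewrite !mem_index_iota.
  move=> /andP[_ hi] /andP[_ hj] /eqP.
  by rewrite (eq_prim_root_expr zP) !modn_small // => /eqP.
by apply: (map_inj_poly inj (rmorph0 _)); rewrite -/(f _) f0 rmorph0.
Qed.

End Vanishing.

(** * The series f_Q, whose coefficients are the inverse orders of GL_n(F_Q) *)

Definition gam (Q : rat) n : rat := \prod_(i < n) (Q ^+ n - Q ^+ i).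

Definition fser (Q : rat) N : {poly rat} := \poly_(n < N) (gam Q n)^-1.

Lemma gamS Q n : gam Q n.+1 = Q ^+ n * (Q ^+ n.+1 - 1) * gam Q n.
Proof.
rewrite /gam big_ord_recl expr0 [Q ^+ n * _]mulrC -mulrA; congr (_ * _).
under eq_bigr => i _ do rewrite /= /bump /= add1n !exprS -mulrBr.
by rewrite big_split /= prodr_const card_ord.
Qed.

Lemma gam0 Q : gam Q 0 = 1.
Proof. by rewrite /gam big_ord0. Qed.

Lemma gam_neq0 Q n : 1 < Q -> gam Q n != 0.
Proof.
move=> Q1; apply/prodf_neq0 => i _; rewrite subr_eq0.
by rewrite gt_eqF // ltr_eXn2l.
Qed.

Section LogDerivativeOfFser.
Variables (Q : rat) (N : nat).
Hypotheses (Q1 : 1 < Q) (N0 : (0 < N)%N).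
Let v := Q^-1.

Let Q0 : Q != 0. Proof. by rewrite gt_eqF // (lt_trans ltr01). Qed.

Lemma fser0 : (fser Q N)`_0 = 1.
Proof. by rewrite coef_poly N0 gam0 invr1. Qed.

Lemma expV_lt1 m : (0 < m)%N -> v ^+ m < 1.
Proof.
move=> m0; rewrite exprn_ilt1 ?gtn_eqF // ?invr_ge0 ?(ltW (lt_trans ltr01 Q1)) //.
by rewrite invf_lt1 // (lt_trans ltr01).
Qed.

Lemma expV_neq1 m : (0 < m)%N -> 1 - v ^+ m != 0.
Proof. by move=> m0; rewrite subr_eq0 gt_eqF // expV_lt1. Qed.

Lemma fser_rec :
  eqmod N (fser Q N) (sc v (fser Q N) + v *: 'X * sc (v ^+ 2) (fser Q N)).
Proof.
apply/eqmodP=> n lt_nN; rewrite coefD -scalerAl coefZ coefXM !coef_sc !coef_poly.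
case: n lt_nN => [|n] lt_nN; first by rewrite N0 gam0 mulr0 mul1r addr0.
rewrite /= (ltnW lt_nN) lt_nN gamS /v.
have g0 := gam_neq0 n Q1; have q1 : Q ^+ n.+1 - 1 != 0.
  by rewrite subr_eq0 gt_eqF // exprn_egt1.
have qn : Q ^+ n != 0 by rewrite expf_neq0.
rewrite -exprM mulnC exprM !exprVn; move: g0 q1 qn; rewrite exprS.
move: (gam Q n) (Q ^+ n) => x y x0 h y0.
by field; rewrite x0 y0 Q0 h.
Qed.

(** By [fser_rec], the difference D = f - g f(vz) satisfies g(vz) D(z) = -vz D(vz), which expresses
    each coefficient of D through lower ones; hence D = 0. *)
Lemma fser_cfrac g : cfrac v N g -> eqmod N (fser Q N) (g * sc v (fser Q N)).
Proof.
move=> [g0 hg]; set f := fser Q N.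
pose D := f - g * sc v f.
suff D0 : eqmod N D 0 by apply: (eqmod_lin (c := 1) D0); rewrite /D; ring.
have hD : eqmod N (sc v g * D) (- (v *: 'X) * sc v D).
  have hf := fser_rec; rewrite -/f in hf.
  have -> : sc v D = sc v f - sc v g * sc (v ^+ 2) f.
    by rewrite expr2 -scsc -scM [LHS]comp_polyB.
  by apply: (eqmod_lin2 (c := sc v g) (c1 := - sc v f) hf hg); rewrite /D; ring.
apply/eqmodP=> n; rewrite coef0; elim/ltn_ind: n => n IH lt_nN.
have := (eqmodP _ _ _).1 hD n lt_nN; rewrite mulNr coefN -scalerAl coefZ coefXM.
rewrite coefM big_ord_recl coef_sc g0 !mul1r subn0 big1 ?addr0; last first.
  move=> i _; rewrite IH ?mulr0 //; last first.
    by rewrite (leq_ltn_trans _ lt_nN) // leq_subr.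
  by rewrite /= /bump /= add1n; have := ltn_ord i; lia.
move=> ->; case: n IH lt_nN => [|n] IH lt_nN /=; first by rewrite mulr0 oppr0.
by rewrite coef_sc IH ?(ltnW lt_nN) // !mulr0 oppr0.
Qed.

End LogDerivativeOfFser.

(** The A_e come from the continued fraction over Z[u] and serve every Q at once, as needed for all
    Q = q^k. Since log g = log f(z) - log f(vz), the coefficient of z^(em) is divided by 1 - v^(em);
    the factor 1 + v^m + ... + v^((e-1)m) of C_e(v^m) reduces this to 1 - v^m. *)
Lemma fser_LD N : (0 < N)%N -> exists A : nat -> {poly int}, forall Q, 1 < Q ->
  LD N (fser Q N) (dsum N (fun e m => ev (Q^-1 ^+ m) (A e) / (1 - Q^-1 ^+ m))).
Proof.
move=> N0; have [g g_cf] := cfrac_exists ('X : {poly int}) N.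
have [C gC] := LD_ghost N0 g_cf.1.
exists (ghost_quotient C) => Q Q1.
have [gv lv] := cfrac_ev g_cf gC Q^-1.
have [l hl] := LD_exists N (fser0 Q N0).
apply: (LD_eqmodr hl).
have h := LD_uniqr hl (LDM lv (LD_sc Q^-1 hl)) (fser_cfrac Q1 N0 gv).
have l0 : l`_0 = 0.
  have := (eqmodP _ _ _).1 hl.2 0%N N0.
  by rewrite coef0M coef_theta fser0 // mulr0n mul1r.
apply/eqmodP=> n lt_nN; have [->|n0] := posnP n.
  rewrite l0 coef_dsum big1_seq // => e; rewrite mem_index_iota => /and3P[_ e0 _].
  rewrite big1_seq // => m; rewrite mem_index_iota => /and3P[_ m0 _].
  by rewrite ltn_eqF ?muln_gt0 ?e0 // mulr0.
have := (eqmodP _ _ _).1 h n lt_nN; rewrite coefD coef_sc.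
have hn : (0 < n < N)%N by rewrite n0.
rewrite !coef_dsum_divisors // => e.
have {}e : l`_n * (1 - Q^-1 ^+ n) =
  \sum_(1 <= e < N | (e %| n)%N) ev (Q^-1 ^+ (n %/ e)) (C e) *+ e.
  by rewrite mulrBr mulr1 {1}e mulrC addrK.
apply: (mulIf (expV_neq1 Q1 n0)); rewrite e mulr_suml.
rewrite big_seq_cond [RHS]big_seq_cond; apply: eq_bigr => k.
rewrite mem_index_iota => /andP[hk /dvdnP[m em]].
have k0 : (0 < k)%N by case/andP: hk.
have m0 : (0 < m)%N by move: n0; rewrite em muln_gt0 => /andP[].
rewrite mulrnAl; congr (_ *+ _).
rewrite {1}(ghost_factor g_cf gC hk) rmorphM /= rmorph_sum /= em mulnK //.
have -> : \sum_(i < k) ev (Q^-1 ^+ m) 'X^i = \sum_(i < k) (Q^-1 ^+ m) ^+ i.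
  by apply: eq_bigr => i _; exact: evXn.
rewrite -!mulrA; congr (_ * _).
have h1 := expV_neq1 Q1 m0.
apply: (mulfI h1); rewrite mulrA divff // mul1r exprM.
have := subrX1 (Q^-1 ^+ m) k; set s := \sum_(_ < _) _ => hs.
by rewrite -opprB mulNr -hs opprB.
Qed.

(** * Valuations of factorials and of q^M - 1 *)

Lemma dvdn_mult_order (p q M : nat) : prime p -> ~~ (p %| q)%N ->
  (p %| q ^ M - 1)%N = (mult_order p q %| M)%N.
Proof.
move=> pp pq; rewrite /mult_order.
have qn0 : (q%:R : 'F_p) \is a GRing.unit by rewrite unitfE -(dvdn_pcharf (pchar_Fp pp)).
set u := insubd _ _.
have uE : \val u = q%:R by rewrite /u insubdK.
rewrite order_dvdn -val_eqE /= FinRing.val_unitX uE -natrX.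
have q0 : (0 < q ^ M)%N by rewrite expn_gt0; case: q pq {qn0 u uE} => //; rewrite dvdn0.
by rewrite -subr_eq0 -(natrB _ q0) -(dvdn_pcharf (pchar_Fp pp)).
Qed.

Lemma mult_order_gt0 p q : (0 < mult_order p q)%N.
Proof. exact: order_gt0. Qed.

Lemma mult_order_dvd_pred (p q : nat) : prime p -> ~~ (p %| q)%N ->
  (mult_order p q %| p.-1)%N.
Proof.
move=> pp pq; rewrite -dvdn_mult_order // -eqn_mod_dvd; last first.
  by rewrite expn_gt0; case: q pq => //; rewrite dvdn0.
rewrite -(totient_prime pp); apply/eqP; apply: Euler_exp_totient.
by rewrite coprime_sym prime_coprime.
Qed.

Lemma ndvd_mult_order (p q : nat) : prime p -> ~~ (p %| q)%N ->
  ~~ (p %| mult_order p q)%N.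
Proof.
move=> pp pq; have h := mult_order_dvd_pred pp pq.
rewrite gtnNdvd ?mult_order_gt0 //.
have p1 := prime_gt1 pp.
by rewrite (leq_ltn_trans (dvdn_leq _ h)) ?ltn_predL //; lia.
Qed.

Section Factorials.
Variable p : nat.
Hypothesis pp : prime p.

Lemma logn_factS n : logn p n`! = (n %/ p + logn p (n %/ p)`!)%N.
Proof.
have p1 := prime_gt1 pp; have p0 := prime_gt0 pp.
have ext m M : (m <= M)%N ->
  (\sum_(1 <= k < m.+1) m %/ p ^ k = \sum_(1 <= k < M.+1) m %/ p ^ k)%N.
  move=> hm; rewrite [RHS](big_cat_nat _ (n := m.+1)) //= [X in (_ + X)%N]big1_seq ?addn0 //.
  move=> k; rewrite mem_index_iota => /and3P[_ hk _]; apply: divn_small.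
  by apply: ltn_trans hk _; apply: ltn_expl.
rewrite !logn_fact // (ext n n.+1) // big_ltn // expn1; congr (_ + _)%N.
rewrite (ext _ n) ?leq_div // big_add1 /=; apply: eq_bigr => k _.
by rewrite expnS divnMA.
Qed.

Lemma logn_fact_le n : (logn p n`! <= n)%N.
Proof.
elim/ltn_ind: n => n IH; rewrite logn_factS.
have [->|n0] := posnP n; first by rewrite div0n fact0 logn1.
have h : (n %/ p < n)%N by rewrite ltn_Pdiv // prime_gt1.
have := IH _ h; have : (n %/ p * 2 <= n)%N.
  by apply: leq_trans (leq_divM n p); rewrite leq_mul2l prime_gt1 // orbT.
lia.
Qed.

Lemma logn_factD m n : (logn p m`! + logn p n`! <= logn p (m + n)`!)%N.
Proof.
rewrite -lognM ?fact_gt0 //; apply: dvdn_leq_log; first exact: fact_gt0.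
have := bin_fact (leq_addl m n); rewrite addnK => <-.
by rewrite [(m`! * _)%N]mulnC dvdn_mull.
Qed.

Lemma logn_fact_mono m n : (m <= n)%N -> (logn p m`! <= logn p n`!)%N.
Proof.
by move=> h; have := logn_factD m (n - m); rewrite subnKC //; apply: leq_trans (leq_addr _ _).
Qed.

(** This is (p^e - 1)/(p - 1) = v_p((p^e)!). It accounts for the term 1/(p - 1) of [slope] in
    integer estimates. *)
Definition repunit e := (\sum_(i < e) p ^ i)%N.

Lemma repunit_eq e : (p.-1 * repunit e = p ^ e - 1)%N.
Proof. by rewrite subn1 predn_exp. Qed.

Lemma leq_repunit e : (e <= repunit e)%N.
Proof.
rewrite /repunit -[X in (X <= _)%N]card_ord -sum1_card; apply: leq_sum => i _.
by rewrite expn_gt0 prime_gt0.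
Qed.

Lemma leq_repunit2 e : (2 * e.-1 <= repunit e)%N.
Proof.
rewrite /repunit; case: e => [|[|e]] //.
rewrite big_ord_recl big_ord_recl expn0 /= /bump /=.
set s := (\sum_(i < e) _)%N; have hs : (e * 2 <= s)%N.
  rewrite -[X in (X * _)%N]card_ord -sum_nat_const; apply: leq_sum => i _.
  apply: leq_trans (prime_gt1 pp) _.
  by rewrite -{1}[p]expn1 leq_exp2l // prime_gt1.
by have := prime_gt1 pp; rewrite ?addn0 expn1; lia.
Qed.

Lemma logn_fact_pM e j : logn p (p ^ e * j)`! = (repunit e * j + logn p j`!)%N.
Proof.
elim: e => [|e IHe]; first by rewrite expn0 mul1n /repunit big_ord0 mul0n.
rewrite logn_factS expnS -mulnA mulKn ?prime_gt0 // IHe /repunit big_ord_recr /=.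
by lia.
Qed.

End Factorials.

Section Lambda.
Variables (p q : nat).
Hypotheses (pp : prime p) (pq : ~~ (p %| q)%N).
Let d := mult_order p q.
Let p0 := prime_gt0 pp.

Lemma q_gt0 : (0 < q)%N.
Proof. by case: q pq => //; rewrite dvdn0. Qed.

Let x i := (q ^ (d * p ^ i))%N.

Lemma x_gt0 i : (0 < x i)%N.
Proof. by rewrite expn_gt0 q_gt0. Qed.

Lemma dvd_x i : (p %| x i - 1)%N.
Proof. by rewrite dvdn_mult_order // dvdn_mulr. Qed.

Lemma logn_geometric y n : (0 < n)%N -> (1 < y)%N ->
  logn p (y ^ n - 1) = (logn p (y - 1) + logn p (\sum_(i < n) y ^ i))%N.
Proof.
move=> n0 y1; rewrite !subn1 predn_exp lognM //; first by rewrite -subn1 subn_gt0.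
by case: n n0 => // n _; rewrite big_ord_recl expn0.
Qed.

Lemma geometric_mod y n : (0 < y)%N -> (p %| y - 1)%N ->
  (\sum_(i < n) y ^ i = n %[mod p])%N.
Proof.
move=> y0 hy; have y1 : (y = 1 %[mod p])%N by apply/eqP; rewrite eqn_mod_dvd.
elim: n => [|n IH]; first by rewrite big_ord0.
rewrite big_ord_recr /= -modnDm IH -modnXm y1 modnXm exp1n modnDm addn1 //.
Qed.

Hypothesis q1 : (1 < q)%N.

Lemma x_gt1 i : (1 < x i)%N.
Proof.
rewrite -(expn0 q) ltn_exp2l // muln_gt0 mult_order_gt0 expn_gt0 p0 //.
Qed.

Lemma lambda_gt0 i : (0 < lambda p q d i)%N.
Proof. by rewrite /lambda logn_gt0 mem_primes pp dvd_x subn_gt0 x_gt1. Qed.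

(** As y = q^(d p^i) is 1 modulo p, the cofactor 1 + y + ... + y^(M-1) is congruent to M, hence
    prime to p. *)
Lemma lambda_mulr i M : ~~ (p %| M)%N ->
  logn p (q ^ (d * p ^ i * M) - 1) = lambda p q d i.
Proof.
move=> pM; have M0 : (0 < M)%N by case: M pM => //; rewrite dvdn0.
rewrite expnM -/(x i) logn_geometric ?x_gt1 // /lambda -/(x i).
rewrite [X in (_ + X)%N](_ : _ = 0)%N ?addn0 //.
apply/eqP; rewrite -leqn0 leqNgt logn_gt0 mem_primes !negb_and.
by rewrite /dvdn geometric_mod ?x_gt0 ?dvd_x // [X in [|| _, _ | X]]pM !orbT.
Qed.

Lemma xS i : x i.+1 = (x i ^ p)%N.
Proof. by rewrite /x expnSr mulnA expnM. Qed.

Lemma lambdaS_geq i : (lambda p q d i < lambda p q d i.+1)%N.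
Proof.
rewrite /lambda -/(x i) -/(x i.+1) xS logn_geometric ?x_gt1 //.
rewrite -{1}[logn _ _]addn0 ltn_add2l logn_gt0 mem_primes pp /=.
rewrite /dvdn geometric_mod ?x_gt0 ?dvd_x // modnn eqxx andbT.
by case: p p0 => // n _; rewrite big_ord_recl expn0.
Qed.

Lemma lambda_geq i : (i < lambda p q d i)%N.
Proof.
elim: i => [|i IH]; first exact: lambda_gt0.
exact: leq_ltn_trans IH (lambdaS_geq i).
Qed.

Lemma geometric_mod2 y n : (y = 1 + (y - 1))%N -> (p %| y - 1)%N ->
  (\sum_(i < n) y ^ i = n + 'C(n, 2) * (y - 1) %[mod p ^ 2])%N.
Proof.
move=> ey hy; set z := (y - 1)%N in ey hy *.
have yi i : (y ^ i = 1 + i * z %[mod p ^ 2])%N.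
  elim: i => [|i IH]; first by rewrite expn0.
  rewrite expnS -modnMmr IH modnMmr ey.
  have -> : ((1 + z) * (1 + i * z) = i * (z * z) + (1 + i.+1 * z))%N by lia.
  rewrite -modnDml.
  have /eqP -> : (i * (z * z) %% p ^ 2 == 0)%N.
    by rewrite -/(dvdn _ _) dvdn_mull // expnS expn1 dvdn_mul.
  by rewrite add0n.
elim: n => [|n IH]; first by rewrite big_ord0 bin0n.
rewrite big_ord_recr /= -modnDm IH yi modnDm binS bin1; congr (_ %% _)%N; lia.
Qed.

(** With y = q^(d p^i), the cofactor 1 + y + ... + y^(p-1) is p + binom(p, 2)(y - 1) modulo p^2, and
    the second term vanishes if p is odd or p^2 divides y - 1. For p = 2 and lambda_i = 1 the
    valuation can jump by more, as for q = 3. *)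
Lemma lambdaS i : odd p \/ (1 < lambda p q d i)%N ->
  lambda p q d i.+1 = (lambda p q d i).+1.
Proof.
move=> h; rewrite /lambda -/(x i) -/(x i.+1) xS logn_geometric ?x_gt1 //.
rewrite -[RHS]addn1; congr (_ + _)%N.
have hx : (x i = 1 + (x i - 1))%N by rewrite subnKC ?x_gt0.
have S := geometric_mod2 p hx (dvd_x i).
have {S}S : (\sum_(j < p) x i ^ j = p %[mod p ^ 2])%N.
  rewrite S -modnDmr; have /eqP -> : ('C(p, 2) * (x i - 1) %% p ^ 2 == 0)%N.
    rewrite -/(dvdn _ _); case: h => [op|h].
      have pC : (p %| 'C(p, 2))%N.
        apply: prime_dvd_bin => //; move: (prime_gt1 pp) op.
        by case: (p) => [|[|[|]]].
      by rewrite expnS expn1 dvdn_mul // dvd_x.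
    rewrite dvdn_mull // pfactor_dvdn // ?subn_gt0 ?x_gt1 //.
  by rewrite addn0.
have S0 : (0 < \sum_(j < p) x i ^ j)%N.
  by case: p p0 => // n _; rewrite big_ord_recl expn0.
apply/eqP; rewrite eqn_leq; apply/andP; split; last first.
  rewrite logn_gt0 mem_primes pp S0 /=.
  by rewrite /dvdn geometric_mod ?x_gt0 ?dvd_x // modnn.
rewrite leqNgt -pfactor_dvdn // /dvdn S -/(dvdn _ _) gtnNdvd //.
by rewrite -{1}[p]expn1 ltn_exp2l // prime_gt1.
Qed.

End Lambda.

(** * The minimizing index *)

Section Slopes.
Variables (p q r : nat) (k : nat -> nat) (l : nat).
Hypotheses (pp : prime p) (pq : ~~ (p %| q)%N) (q1 : (1 < q)%N).
Hypotheses (r0 : (0 < r)%N) (kr0 : (0 < k r)%N).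
Let d := mult_order p q.
Hypothesis l_min : least_minimizer (slope p q d r k) l.
Let lam := lambda p q d.
Let B := b p q d r k.

(** The slope multiplied by (p - 1) p^i, so that slopes are compared by integer inequalities. *)
Definition beta i : int := p.-1%:Z * B i - 1.

Let p1 := prime_gt1 pp.

Lemma slopeE i : slope p q d r k i = (beta i)%:~R / (p.-1 * p ^ i)%:R.
Proof.
have h1 : p%:R - 1 != 0 :> rat by rewrite subr_eq0 pnatr_eq1 gtn_eqF.
have h2 : p%:R ^+ i != 0 :> rat by rewrite expf_neq0 // pnatr_eq0 gtn_eqF // ltnW.
have e1 : p.-1%:R = p%:R - 1 :> rat by rewrite -subn1 natrB // ltnW.
rewrite /slope /beta -/(B i); move: (B i) => z.
rewrite natrM natrX intrD intrM rmorphN1 -pmulrn e1.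
move: (p%:R ^+ i) (z%:~R : rat) h1 h2 => X Y h1 h2.
by field; rewrite h1 h2.
Qed.

Lemma le_slope i j :
  (slope p q d r k i <= slope p q d r k j) =
  (beta i * (p ^ j)%:Z <= beta j * (p ^ i)%:Z).
Proof.
have pos n : 0 < (p.-1 * p ^ n)%:R :> rat.
  by rewrite ltr0n muln_gt0 expn_gt0 (ltnW p1) andbT -ltnS prednK // ltnW.
rewrite !slopeE ler_pdivrMr // mulrAC ler_pdivlMr //.
have p'0 : 0 < p.-1%:Z :> int by rewrite ltz_nat -ltnS prednK // ltnW.
rewrite -[RHS](ler_pM2l p'0) -[RHS](ler_int rat) !intrM -!pmulrn !natrM.
by congr (_ <= _); rewrite mulrCA.
Qed.

Lemma c_mono i j : (i <= j)%N -> (c r k i <= c r k j)%N.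
Proof.
move=> h; apply: leq_sum => t _; rewrite leq_mul2r; apply/orP; right.
by rewrite leq_min geq_minr andbT (leq_trans (geq_minl _ _)).
Qed.

Lemma c1_gt0 : (0 < c r k 1)%N.
Proof.
rewrite /c big_nat_recr //= (minn_idPl _) // mul1n.
by apply: leq_trans kr0 _; rewrite leq_addl.
Qed.

Lemma b_step i : odd p \/ (1 < lam i)%N -> B i - 2 <= B i.+1.
Proof.
move=> h; rewrite /B /b -/(lam i) -/(lam i.+1).
have e : lam i.+1 = (lam i).+1 by apply: lambdaS.
have := c_mono (leqnSn (lam i)); rewrite e -[(lam i).+1]addn1; lia.
Qed.

Lemma b_steps i e : odd p \/ (1 < lam i)%N -> B i - (2 * e)%:Z <= B (i + e)%N.
Proof.
move=> h; elim: e => [|e IH]; first by rewrite muln0 subr0 addn0.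
have h' : odd p \/ (1 < lam (i + e))%N.
  case: h => h; [by left | right]; case: (e) => [|e']; first by rewrite addn0.
  by apply: leq_ltn_trans (lambda_geq pp pq q1 _); rewrite addnS.
have := b_step h'; rewrite addnS; lia.
Qed.

(** As lambda_i > i, the exceptional case of [lambdaS] can only occur at i = 0 with lambda_0 = 1,
    and there b_0 = c_1 - 1 >= 0. *)
Lemma b_step_or i : (odd p \/ (1 < lam i)%N) \/ 0 <= B i.
Proof.
case: (posnP i) => [->|i0]; last first.
  by left; right; apply: leq_ltn_trans (lambda_geq pp pq q1 _).
case: (ltnP 1 (lam 0)) => h; first by left; right.
right; have l1 : lam 0 = 1%N by apply/eqP; rewrite eqn_leq h lambda_gt0.
by rewrite /B /b -/(lam 0) l1; have := c1_gt0; lia.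
Qed.

(** The c_i are bounded by sum_j j k_j, so b_i is negative for large i and the minimal slope is
    negative; b_l > 0 would make it nonnegative. *)
Lemma b_le0 : B l <= 0.
Proof.
rewrite leNgt; apply/negP => bl.
pose M := (\sum_(1 <= j < r.+1) j * k j)%N.
have := l_min.1 M.+1; rewrite le_slope => h.
have cM i : (c r k i <= M)%N.
  by apply: leq_sum => j _; rewrite leq_mul2r geq_minr orbT.
have bM : B M.+1 < 0 by rewrite /B /b; have := cM (lambda p q d M.+1); lia.
have e1 : 0 <= beta l * (p ^ M.+1)%:Z.
  by rewrite mulr_ge0 // /beta; nia.
have e2 : beta M.+1 * (p ^ l)%:Z < 0.
  by rewrite nmulr_rlt0 ?ltz_nat ?expn_gt0 ?(ltnW p1) // /beta; nia.
by have := le_lt_trans (le_trans e1 h) e2; rewrite ltxx.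
Qed.

Lemma beta_ge e : beta l * (p ^ e)%:Z <= beta (l + e)%N.
Proof.
have := l_min.1 (l + e)%N; rewrite le_slope expnD PoszM mulrA.
rewrite -[beta l * _ * _]mulrA [(p ^ l)%:Z * _]mulrC mulrA ler_pM2r //.
by rewrite ltz_nat expn_gt0 (ltnW p1).
Qed.

Lemma beta_lt i : (i < l)%N -> beta l < beta i * (p ^ (l - i))%:Z.
Proof.
move=> il; have [hmin hleast] := l_min.
have : ~~ (slope p q d r k i <= slope p q d r k l).
  apply/negP=> h; have := hleast i (fun j => le_trans h (hmin j)).
  by rewrite leqNgt il.
rewrite le_slope -ltNge => ne.
have e : (p ^ l = p ^ (l - i) * p ^ i)%N by rewrite -expnD subnK // ltnW.
have pi0 : 0 < (p ^ i)%:Z :> int by rewrite ltz_nat expn_gt0 (ltnW p1).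
by rewrite e PoszM mulrA ltr_pM2r in ne.
Qed.

(** A step lowers b by at most 2, while a smaller slope at l = i + e requires a loss exponential in
    e if b_i < 0. With R = (p^e - 1)/(p - 1) the two facts give -2e < ((p - 1) b_i - 1) R; but R >=
    e and (p - 1) b_i - 1 <= -p <= -2. *)
Lemma b_ge0_before i : (i < l)%N -> 0 <= B i.
Proof.
move=> il; case: (b_step_or i) => // h; rewrite leNgt; apply/negP => bi.
have hs := b_steps (l - i) h; rewrite subnKC ?(ltnW il) // in hs.
have hb := beta_lt il; set e := (l - i)%N in hs hb.
have e0 : (0 < e)%N by rewrite subn_gt0.
have re := repunit_eq p e; have le := leq_repunit pp e.
have pe : (0 < p ^ e)%N by rewrite expn_gt0 ltnW.
rewrite /beta in hb.
have h1 : (p.-1%:Z * B i - 1) * (p ^ e)%:Z = 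
   (p.-1%:Z * B i - 1) * (p.-1%:Z * (repunit p e)%:Z) + (p.-1%:Z * B i - 1).
  have -> : p.-1%:Z * (repunit p e)%:Z = (p ^ e)%:Z - 1 :> int by lia.
  by ring.
have p10 : 0 < p.-1%:Z :> int by rewrite ltz_nat -ltnS prednK // ltnW.
have h2 : - (2 * e)%:Z * p.-1%:Z < (p.-1%:Z * B i - 1) * (repunit p e)%:Z * p.-1%:Z.
  have : p.-1%:Z * (B i - (2 * e)%:Z) <= p.-1%:Z * B l by rewrite ler_pM2l.
  move: hb; rewrite h1.
  have -> : (p.-1%:Z * B i - 1) * (p.-1%:Z * (repunit p e)%:Z) =
            (p.-1%:Z * B i - 1) * (repunit p e)%:Z * p.-1%:Z by ring.
  move: (_ * _ * p.-1%:Z) => X; rewrite mulrBr; lia.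
rewrite ltr_pM2r // in h2.
have h3 : p.-1%:Z * B i - 1 <= - 2 by nia.
nia.
Qed.

(** For b_i = 0, a smaller slope at l = i + e requires b_l < -(p^e - 1)/(p - 1). If e > 1, a descent
    from b_(i+1) >= 0 in e - 1 steps of at most 2 does not reach that far. *)
Lemma b_eq0_before i : (i < l)%N -> B i = 0 -> l = i.+1 /\ B l <= - 1.
Proof.
move=> il bi; have hb := beta_lt il; rewrite /beta bi mulr0 sub0r mulN1r in hb.
have p10 : 0 < p.-1%:Z :> int by rewrite ltz_nat -ltnS prednK // ltnW.
have pE : p = p.-1.+1 by rewrite prednK // ltnW.
have e0 : (0 < l - i)%N by rewrite subn_gt0.
have [le1|] := leqP (l - i) 1.
  have e1 : (l - i)%N = 1%N by apply/eqP; rewrite eqn_leq le1.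
  split; first by lia.
  rewrite e1 expn1 in hb; nia.
move=> gt1; exfalso; have il' : (i.+1 < l)%N by lia.
have bi1 := b_ge0_before il'.
have h : odd p \/ (1 < lam i.+1)%N.
  by right; apply: leq_ltn_trans (lambda_geq pp pq q1 _).
have hs := b_steps (l - i.+1) h; rewrite subnKC // in hs.
have re := repunit_eq p (l - i); have le := leq_repunit2 pp (l - i).
have pe : (0 < p ^ (l - i))%N by rewrite expn_gt0 ltnW.
have h1 : (p ^ (l - i))%:Z = p.-1%:Z * (repunit p (l - i))%:Z + 1 by lia.
have h2 : p.-1%:Z * B l < p.-1%:Z * - (repunit p (l - i))%:Z by lia.
rewrite ltr_pM2l // in h2.
lia.
Qed.

Definition wbd n : int := B l * n%:Z - (logn p n`!)%:Z.

Lemma wbd_le0 n : wbd n <= 0.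
Proof.
by rewrite /wbd subr_le0 (le_trans (mulr_le0_ge0 b_le0 _)).
Qed.

Lemma wbd_anti m n : (m <= n)%N -> wbd n <= wbd m.
Proof.
move=> h; rewrite /wbd lerB //; last by rewrite lez_nat logn_fact_mono.
by rewrite ler_wnM2l ?b_le0 // lez_nat.
Qed.

Lemma wbd_superadd m n : wbd (m + n)%N <= wbd m + wbd n.
Proof.
by rewrite /wbd PoszD mulrDr; have := logn_factD p m n; lia.
Qed.

(** The right side bounds the coefficient of z^(d p^i j) in exp(c z^(d p^i)) when v_p(c) >= b_i. For
    i >= l the inequality is the minimality of l, once v_p((p^f j)!) is expanded for f = i - l. For
    i < l, either b_i >= 1 and the right side is nonnegative, or b_i = 0 and l = i + 1, where
    v_p(j!) = floor(j/p) + v_p(floor(j/p)!) is used. *)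
Lemma wbd_leq i j : wbd ((p ^ i * j) %/ p ^ l)%N <= B i * j%:Z - (logn p j`!)%:Z.
Proof.
have p0 : (0 < p)%N by apply: ltnW.
have [le_li|lt_il] := leqP l i.
  have e : i = (l + (i - l))%N by rewrite subnKC.
  have := beta_ge (i - l); rewrite -e; set f := (i - l)%N in e * => hb.
  rewrite {1}e expnD -mulnA mulKn ?expn_gt0 ?p0 // /wbd logn_fact_pM //.
  have re := repunit_eq p f.
  have pe : (0 < p ^ f)%N by rewrite expn_gt0 p0.
  have p10 : 0 < p.-1%:Z :> int by rewrite ltz_nat -ltnS prednK.
  have h1 : (p ^ f)%:Z = p.-1%:Z * (repunit p f)%:Z + 1 by lia.
  have h2 : B l * (p ^ f)%:Z - (repunit p f)%:Z <= B i.
    rewrite -(ler_pM2l p10) mulrBr mulrA; move: hb; rewrite /beta mulrBl mul1r.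
    by move: (p.-1%:Z * B l * _) (p.-1%:Z * B i) => X Y; rewrite h1; lia.
  have h3 : (B l * (p ^ f)%:Z - (repunit p f)%:Z) * j%:Z <= B i * j%:Z.
    by rewrite ler_wpM2r.
  rewrite PoszM PoszD PoszM; move: h3; rewrite mulrBl mulrA; lia.
have bi := b_ge0_before lt_il.
have [b0|bn0] := eqVneq (B i) 0; last first.
  apply: le_trans (wbd_le0 _) _; have := logn_fact_le pp j.
  have : 1 <= B i by lia.
  move=> h1 h2; rewrite subr_ge0 (le_trans (_ : _ <= j%:Z)) ?lez_nat //.
  by rewrite -[X in X <= _]mul1r ler_wpM2r.
have [el bl] := b_eq0_before lt_il b0.
rewrite el expnSr divnMl ?expn_gt0 ?p0 // b0 mul0r sub0r /wbd (logn_factS pp j).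
have : B l * (j %/ p)%N%:Z <= -1 * (j %/ p)%N%:Z by rewrite ler_wpM2r.
by rewrite PoszD mulN1r; lia.
Qed.

End Slopes.

(** * p-adic estimates for exponentials *)

Section Valuation.
Variable p : nat.
Hypothesis pp : prime p.
Implicit Types (x y : rat) (t u : int).

Let pr : p%:R != 0 :> rat. Proof. by rewrite pnatr_eq0 gtn_eqF // prime_gt0. Qed.

(* [x] lies in [p^t Z_(p)]. *)
Definition vge t x :=
  exists a : int, exists2 s : nat, ~~ (p %| s)%N & x * s%:R = p%:R ^ t * a%:~R.

Lemma vge0r t : vge t 0.
Proof. by exists 0, 1%N; rewrite ?mul0r ?mulr0 // dvdn1 gtn_eqF // prime_gt1. Qed.

Lemma vge_int (z : int) : vge 0 z%:~R.
Proof.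
by exists z, 1%N; rewrite ?expr0z ?mulr1 ?mul1r // dvdn1 gtn_eqF // prime_gt1.
Qed.

Lemma vgeM t u x y : vge t x -> vge u y -> vge (t + u) (x * y).
Proof.
move=> [a [s ps xs]] [b [r pr' yr]]; exists (a * b), (s * r)%N.
  by rewrite Euclid_dvdM // negb_or ps.
by rewrite natrM mulrACA xs yr expfzDr // intrM mulrACA.
Qed.

Lemma vge_weak t u x : u <= t -> vge t x -> vge u x.
Proof.
move=> le_ut [a [s ps xs]]; exists ((p ^ `|t - u|)%N%:Z * a), s => //.
rewrite xs intrM mulrA; congr (_ * _).
rewrite -pmulrn natrX -[p%:R ^+ _]/(p%:R ^ (`|t - u|%N : int)) -expfzDr //.
by congr (_ ^ _); rewrite gez0_abs ?subr_ge0 //; lia.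
Qed.

Lemma vgeD t x y : vge t x -> vge t y -> vge t (x + y).
Proof.
move=> [a [s ps xs]] [b [r pr' yr]].
exists (a * r%:Z + b * s%:Z), (s * r)%N; first by rewrite Euclid_dvdM // negb_or ps.
rewrite natrM mulrDl mulrA xs mulrCA yr intrD !intrM -!pmulrn; ring.
Qed.

Lemma vgeN t x : vge t x -> vge t (- x).
Proof.
by move=> h; rewrite -mulN1r -[t]add0r; apply: vgeM => //; exact: (vge_int (-1)).
Qed.

Lemma vge_sum t (I : Type) (r : seq I) (P : pred I) (F : I -> rat) :
  (forall i, P i -> vge t (F i)) -> vge t (\sum_(i <- r | P i) F i).
Proof. by move=> h; elim/big_ind: _ => //; [exact: vge0r | exact: vgeD]. Qed.

Lemma vgeX t x n : vge t x -> vge (t * n%:Z) (x ^+ n).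
Proof.
move=> h; elim: n => [|n IHn]; first by rewrite mulr0 expr0; exact: (vge_int 1).
by rewrite exprS intS mulrDr mulr1; apply: vgeM.
Qed.

Lemma vge_nat n : vge (logn p n)%:Z n%:R.
Proof.
have [->|n0] := posnP n; first exact: vge0r.
have /(pfactor_coprime pp)[m pm em] := n0.
exists m%:Z, 1%N; first by rewrite dvdn1 gtn_eqF // prime_gt1.
by rewrite mulr1 {1}em natrM natrX -pmulrn mulrC.
Qed.

Lemma vge_natV n : (0 < n)%N -> vge (- (logn p n)%:Z) n%:R^-1.
Proof.
move=> n0; have /(pfactor_coprime pp)[m pm em] := n0.
exists 1, m; first by rewrite -prime_coprime.
have m0 : m%:R != 0 :> rat.
  rewrite pnatr_eq0; apply: contraL n0 => /eqP m0; by rewrite em m0.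
rewrite {1}em natrM natrX mulr1 -invr_expz invfM.
by rewrite mulrAC mulVf // mul1r.
Qed.

Lemma vge_unitV n : ~~ (p %| n)%N -> vge 0 n%:R^-1.
Proof.
move=> pn; have n0 : (0 < n)%N by case: n pn => //; rewrite dvdn0.
have := vge_natV n0; suff -> : logn p n = 0%N by rewrite oppr0.
by apply/eqP; rewrite -leqn0 leqNgt logn_gt0 mem_primes pp n0.
Qed.

Lemma vge_vp t x : vge t x -> (t%:E <= vp p x)%E.
Proof.
move=> [a [s ps xs]]; rewrite /vp; case: eqVneq => [//|x0]; first by rewrite leey.
have s0 : (0 < s)%N by case: s ps {xs} => //; rewrite dvdn0.
have ls : logn p s = 0%N.
  by apply/eqP; rewrite -leqn0 leqNgt logn_gt0 mem_primes pp s0.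
have dx : (0 < `|denq x|)%N by rewrite absz_gt0 denq_neq0.
have nx : (0 < `|numq x|)%N by rewrite absz_gt0 numq_eq0.
have a0 : (0 < `|a|)%N.
  rewrite absz_gt0; apply: contraNneq x0 => a0; move: xs; rewrite a0 mulr0 => /eqP.
  by rewrite mulf_eq0 pnatr_eq0 (gtn_eqF s0) orbF.
have key (u v : nat) : x * s%:R * (p ^ u)%:R = (p ^ v)%:R * a%:~R ->
  (logn p `|numq x| + u = logn p `|denq x| + v + logn p `|a|)%N.
  move=> e; have {e} : (`|numq x| * s * p ^ u = `|denq x| * p ^ v * `|a|)%N.
    apply/eqP; rewrite -(eqr_nat rat); apply/eqP; rewrite !natrM.
    have e' : numq x * s%:Z * (p ^ u)%:Z = denq x * (p ^ v)%:Z * a.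
      apply/eqP; rewrite -(eqr_int rat); apply/eqP.
      rewrite !intrM -!pmulrn; move: e; rewrite -{1}[x]divq_num_den => e.
      have d0 : (denq x)%:~R != 0 :> rat by rewrite intr_eq0 denq_neq0.
      apply: (mulfI (invr_neq0 d0)); rewrite !mulrA mulVf // mul1r -e.
      by rewrite [_^-1 * _]mulrC.
    by have := congr1 absz e'; rewrite !abszM !absz_nat
      => /(congr1 (fun n => n%:R : rat)); rewrite !natrM.
  move/(congr1 (logn p)); rewrite !lognM ?muln_gt0 ?expn_gt0 ?(prime_gt0 pp) ?nx ?dx //.
  by rewrite !pfactorK // ls addn0.
rewrite lee_fin; case: t xs => [n|n] xs.
  have := key 0%N n; rewrite expn0 mulr1 xs natrX => /(_ erefl); lia.
have := key n.+1 0%N; rewrite expn0 mul1r xs NegzE natrX.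
have -> : p%:R ^ (- n.+1%:Z) * a%:~R * p%:R ^+ n.+1 = a%:~R :> rat.
  by rewrite mulrAC -[p%:R ^+ _]/(p%:R ^ (n.+1%:Z)) -expfzDr // addNr expr0z mul1r.
by move=> /(_ erefl); lia.
Qed.

Lemma vge_ev v (A : {poly int}) : vge 0 v -> vge 0 (ev v A).
Proof.
move=> hv; rewrite evE horner_coef; apply: vge_sum => i _.
rewrite -[0]addr0; apply: vgeM; last by have := vgeX i hv; rewrite mul0r.
rewrite coef_map_id0 //; exact: vge_int.
Qed.

End Valuation.

Section Good.
Variables (p : nat) (W : nat -> int).
Hypothesis pp : prime p.
Hypothesis W_le0 : forall n, W n <= 0.
Hypothesis W_add : forall m n, W (m + n)%N <= W m + W n.

Definition good N (P : {poly rat}) := forall n, (n < N)%N -> vge p (W n) P`_n.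

Lemma good_int N (P : {poly rat}) : (forall n, (n < N)%N -> vge p 0 P`_n) -> good N P.
Proof. by move=> h n hn; apply: (vge_weak pp (W_le0 n)); apply: h. Qed.

Lemma good1 N : good N 1.
Proof.
by apply: good_int => n _; rewrite coef1; case: eqP => _; [exact: (vge_int pp 1) | exact: vge0r].
Qed.

Lemma goodM N P Q : good N P -> good N Q -> good N (P * Q).
Proof.
move=> hP hQ n hn; rewrite coefM; apply: vge_sum => // i _.
have lin : (i <= n)%N by rewrite -ltnS ltn_ord.
apply: (@vge_weak _ pp (W i + W (n - i)%N)).
  by have := W_add i (n - i); rewrite subnKC.
by apply: vgeM => //; [apply: hP | apply: hQ]; rewrite (leq_ltn_trans _ hn) ?leq_subr.
Qed.

Definition expmono (c : rat) s N : {poly rat} :=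
  \poly_(n < N) (if (s %| n)%N then c ^+ (n %/ s) / (n %/ s)`!%:R else 0).

Lemma LD_expmono c s N : (0 < s)%N -> (0 < N)%N ->
  LD N (expmono c s N) ((c *+ s) *: 'X^s).
Proof.
move=> s0 N0; split.
  by rewrite coef_poly N0 dvdn0 div0n expr0 fact0 divr1.
apply/eqmodP=> n hn; rewrite coef_theta -scalerAr coefZ coefMXn !coef_poly hn.
have [lt_ns|le_sn] /= := ltnP n s.
  rewrite mulr0; case: ifP => [/dvdnP[j ej]|]; last by rewrite mul0rn.
  move: lt_ns; rewrite ej -{2}[s]mul1n ltn_pmul2r // ltnS leqn0 => /eqP ->.
  by rewrite mul0n mulr0n.
rewrite (leq_ltn_trans (leq_subr _ _) hn) (dvdn_subl le_sn (dvdnn s)).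
case: ifP => [/dvdnP[[|j] ej]|_]; last by rewrite mul0rn mulr0.
  by rewrite ej mul0n leqNgt s0 in le_sn.
rewrite ej mulSn addKn -mulSn !mulnK // factS natrM exprS.
have j0 : j.+1%:R != 0 :> rat by rewrite pnatr_eq0.
have f0 : j`!%:R != 0 :> rat by rewrite pnatr_eq0 gtn_eqF // fact_gt0.
rewrite -[_ *+ (_ * _)]mulr_natr -[c *+ s]mulr_natr natrM.
by move: (j.+1%:R) (j`!%:R) j0 f0 => x y x0 y0; field; rewrite x0 y0.
Qed.

Lemma good_expmono c s N t : vge p t c ->
  (forall j, W (s * j)%N <= t * j%:Z - (logn p j`!)%:Z) -> (0 < s)%N ->
  good N (expmono c s N).
Proof.
move=> hc hW s0 n hn; rewrite coef_poly hn.
case: ifP => [/dvdnP[j ->]|_]; last exact: vge0r.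
rewrite mulnK // mulnC; apply: (vge_weak pp (hW j)); apply: vgeM => //.
  exact: vgeX.
by apply: vge_natV => //; apply: fact_gt0.
Qed.

(** Here c^j / j! is p-integral, because v_p(j!) <= j. *)
Lemma good_expmono1 c s N : vge p 1 c -> (0 < s)%N -> good N (expmono c s N).
Proof.
move=> hc s0; apply: (good_expmono hc) => // j.
by have := logn_fact_le pp j; have := W_le0 (s * j); lia.
Qed.

End Good.

Section WeightedGood.
Variables (p q N : nat) (W : nat -> int) (A : nat -> {poly int}) (wt : nat -> rat).
Hypotheses (pp : prime p) (pq : ~~ (p %| q)%N) (q1 : (1 < q)%N) (N0 : (0 < N)%N).
Hypothesis W_le0 : forall n, W n <= 0.
Hypothesis W_add : forall m n, W (m + n)%N <= W m + W n.
Let v : rat := q%:R^-1.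

(** [wt M] will be #{g in G | g^(q^M) = g}, and t will be b_i for M = d p^i M'. The last inequality
    is what [good_expmono] asks of exp(c z^(eM)). *)
Hypothesis wt_spec : forall M, (0 < M < N)%N ->
  ~~ (p %| q ^ M - 1)%N /\ wt M = 1 \/
  (p %| q ^ M - 1)%N /\
  exists2 t, vge p t (wt M / (M * (q ^ M - 1))%:R) &
    forall e j, (0 < e)%N -> W (e * M * j)%N <= t * j%:Z - (logn p j`!)%:Z.

(** Two requirements: K + 1 is a multiple of totient(p^N), so that y^K inverts a p-adic unit y
    modulo p^N, and K >= N, so that p^N divides y^K if p divides y. *)
Let K := (totient (p ^ N) * N.+1).-1.

Let tot_gt0 : (0 < totient (p ^ N))%N.
Proof. by rewrite totient_gt0 expn_gt0 prime_gt0. Qed.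

Let K1 : K.+1 = (totient (p ^ N) * N.+1)%N.
Proof. by rewrite prednK // muln_gt0 tot_gt0. Qed.

Let leq_NK : (N <= K)%N.
Proof. by rewrite -ltnS K1 leq_pmull. Qed.

Let qn0 : q%:R != 0 :> rat. Proof. by rewrite pnatr_eq0 gtn_eqF // ltnW. Qed.

Let qM1 M : (0 < M)%N -> (0 < q ^ M - 1)%N.
Proof. by move=> M0; rewrite subn_gt0 -(expn0 q) ltn_exp2l. Qed.

Let vE M : 1 - v ^+ M = (q ^ M - 1)%:R * v ^+ M.
Proof.
rewrite natrB ?expn_gt0 ?(ltnW q1) // natrX mulrBl mul1r -exprMn divff //.
by rewrite expr1n.
Qed.

Let vV M : (v ^+ M)^-1 = (q ^ M)%:R.
Proof. by rewrite /v -exprVn invrK natrX. Qed.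

Let vge_v : vge p 0 v. Proof. exact: vge_unitV. Qed.

Let vge_vX M : vge p 0 (v ^+ M).
Proof. by have := vgeX pp M vge_v; rewrite mul0r. Qed.

Let vge_qX M : vge p 0 (v ^+ M)^-1.
Proof. by rewrite vV; exact: (vge_int pp (q ^ M)%N). Qed.

Let logn_ltN M : (0 < M < N)%N -> 1 <= N%:Z + - (logn p M)%:Z.
Proof.
move=> /andP[M0 MN]; have := ltn_logl p M0; lia.
Qed.

(* [(1 - v^M)^(K+1)] is close to [1] when [1 - v^M] is a [p]-adic unit, as
   [K + 1] is a multiple of [totient (p^N)]; so [(1 - v^M)^K] stands in for
   [1 / (1 - v^M)] as a polynomial in [v^M]. *)
Lemma vge_inverse_unit M : (0 < M < N)%N -> ~~ (p %| q ^ M - 1)%N ->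
  vge p N ((1 - v ^+ M)^-1 - (1 - v ^+ M) ^+ K).
Proof.
move=> /andP[M0 _] pM; set y := 1 - v ^+ M.
have y0 : y != 0.
  by rewrite /y vE mulf_neq0 ?pnatr_eq0 ?expf_neq0 ?invr_neq0 // gtn_eqF ?qM1.
have geyV : vge p 0 y^-1.
  rewrite /y vE invfM -[0]addr0; apply: vgeM => //; exact: vge_unitV.
have -> : y^-1 - y ^+ K = y^-1 * (1 - y ^+ K.+1).
  by rewrite mulrBr mulr1 exprS mulKf.
rewrite -[N%:Z]add0r; apply: vgeM => //.
rewrite /y vE exprMn -natrX -exprM.
set a := ((q ^ M - 1) ^ K.+1)%N; set c := (q ^ (M * K.+1))%N.
have ca : (c = a %[mod p ^ N])%N.
  have one z : ~~ (p %| z)%N -> (z ^ K.+1 = 1 %[mod p ^ N])%N.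
    move=> pz; rewrite K1 expnM -modnXm Euler_exp_totient ?modnXm ?exp1n //.
    by rewrite coprimeXr // coprime_sym prime_coprime.
  by rewrite /c expnM !one // Euclid_dvdX // negb_and pq.
have -> : 1 - a%:R * v ^+ (M * K.+1) = (c%:Z - a%:Z)%:~R * v ^+ (M * K.+1).
  rewrite intrD rmorphN /= -!pmulrn mulrBl; congr (_ - _).
  by rewrite /c natrX -exprMn divff ?expr1n.
rewrite -[N%:Z]addr0; apply: vgeM => //.
have /dvdzP[z ->] : ((p ^ N)%N%:Z %| c%:Z - a%:Z)%Z.
  by rewrite -eqz_mod_dvd !modz_nat ca.
rewrite intrM mulrC -[N%:Z]addr0; apply: vgeM => //; last exact: vge_int.
by have := vge_nat pp (p ^ N); rewrite pfactorK.
Qed.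

(** F is split as R1 R2. The terms of R1 are P_e(v^M) = A_e(v^M)(1 - v^M)^K for all M, so that R1
    comes from Z[u] and is p-integral; R2 collects the differences [rr] as a finite product of
    exponentials. *)
Lemma weighted_good F :
  LD N F (dsum N (fun e M => ev (v ^+ M) (A e) / (1 - v ^+ M) * wt M)) ->
  good p W N F.
Proof.
move=> hF.
pose P e : {poly int} := A e * (1 - 'X) ^+ K.
have [R1 hR1] := LDable_ghost P N0.
have h1 := map_LD (ev v) hR1; rewrite map_ev_ghost in h1.
have evP M e : ev (v ^+ M) (P e) = ev (v ^+ M) (A e) * (1 - v ^+ M) ^+ K.
  by rewrite /P rmorphM rmorphXn rmorphB rmorph1 /= evX.
pose rr e M : rat := ev (v ^+ M) (A e) / (1 - v ^+ M) * wt M - ev (v ^+ M) (P e).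
have split e M : (0 < e)%N -> (0 < M < N)%N -> exists c : rat * rat,
    c.1 + c.2 = rr e M / M%:R /\
    forall L, good p W L (expmono c.1 (e * M) L * expmono c.2 (e * M) L).
  move=> e0 hM; have /andP[M0 MN] := hM; have s0 : (0 < e * M)%N by rewrite muln_gt0 e0.
  have gA : vge p 0 (ev (v ^+ M) (A e)) by apply: vge_ev.
  have gMV := vge_natV pp M0.
  case: (wt_spec hM) => [[pM w1]|[pM [t ht hW]]].
    (* As N - v_p(M) >= 1, the approximation modulo p^N survives the division by M. *)
    exists (rr e M / M%:R, 0); split; first by rewrite /= addr0.
    move=> L; apply: goodM => //; apply: good_expmono1 => //; last exact: vge0r.
    rewrite /= /rr evP w1 mulr1 -mulrBr.
    apply: (vge_weak pp (logn_ltN hM)); apply: vgeM => //.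
    by rewrite -[N%:Z]add0r; apply: vgeM => //; apply: vge_inverse_unit.
  (* The term of F and that of R1 are treated separately, using 1 - v^M = (q^M - 1) v^M: the first
     has valuation at least t, the second at least K - v_p(M) >= 1. *)
  exists (ev (v ^+ M) (A e) * (v ^+ M)^-1 * (wt M / (M * (q ^ M - 1))%:R),
    - (ev (v ^+ M) (P e) / M%:R)); split.
    rewrite /= /rr mulrBl; congr (_ - _); rewrite vE natrM.
    have a0 : (q ^ M - 1)%:R != 0 :> rat by rewrite pnatr_eq0 gtn_eqF // qM1.
    have b0 : M%:R != 0 :> rat by rewrite pnatr_eq0 gtn_eqF.
    have c0 : v ^+ M != 0 by rewrite expf_neq0 // invr_neq0.
    move: ((q ^ M - 1)%:R : rat) (M%:R : rat) (v ^+ M) (ev _ _) a0 b0 c0.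
    by move=> x y z u x0 y0 z0; field; rewrite x0 y0 z0.
  move=> L; apply: goodM => //.
    apply: (@good_expmono _ _ pp _ _ _ t) => //; last first.
      by move=> j; apply: hW.
    by rewrite -[t]add0r; apply: vgeM => //; rewrite -[0]addr0; apply: vgeM.
  apply: good_expmono1 => //=; apply: vgeN => //; rewrite evP.
  apply: (@vge_weak _ pp (K%:Z + - (logn p M)%:Z)).
    by apply: le_trans (logn_ltN hM) _; rewrite lerD2r lez_nat.
  apply: vgeM => //; rewrite -[K%:Z]add0r; apply: vgeM => //.
  rewrite -[K%:Z]mul1r; apply: vgeX => //; rewrite vE -[1]addr0; apply: vgeM => //.
  apply: (vge_weak pp _ (vge_nat pp _)).
  by rewrite lez_nat logn_gt0 mem_primes pp qM1.
pose ok l := exists2 P : {poly rat}, LD N P l & good p W N P.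
have ok0 : ok 0 by exists 1; [exact: LD1 | exact: good1].
have okD l m : ok l -> ok m -> ok (l + m).
  by move=> [X hX gX] [Y hY gY]; exists (X * Y); [exact: LDM | exact: goodM].
have [R2 h2 g2] : ok (dsum N rr).
  rewrite /dsum big_nat; apply: (big_ind ok) => // e /andP[e0 _].
  rewrite big_nat; apply: (big_ind ok) => // M hM.
  have [c [hc gc]] := split e M e0 hM.
  have s0 : (0 < e * M)%N by rewrite muln_gt0 e0; case/andP: hM.
  exists (expmono c.1 (e * M) N * expmono c.2 (e * M) N); last exact: gc.
  have := LDM (LD_expmono c.1 s0 N0) (LD_expmono c.2 s0 N0).
  rewrite -scalerDl -mulrnDl hc.
  rewrite (_ : (rr e M / M%:R) *+ (e * M) = rr e M *+ e) //.
  rewrite mulnC mulrnA -[_ *+ M]mulr_natr divfK //.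
  by rewrite pnatr_eq0 gtn_eqF //; case/andP: hM.
have h : LD N (map_poly (ev v) R1 * R2)
    (dsum N (fun e M => ev (v ^+ M) (A e) / (1 - v ^+ M) * wt M)).
  have := LDM h1 h2; rewrite -dsumD; congr LD.
  by apply: eq_dsum => e M _ _; rewrite /rr addrC subrK.
have /eqmodP e : eqmod N F (map_poly (ev v) R1 * R2).
  apply: LD_uniql hF h => x n n0 /eqP.
  by rewrite mulrn_eq0 gtn_eqF //= => /eqP.
suff g : good p W N (map_poly (ev v) R1 * R2) by move=> n hn; rewrite e //; apply: g.
apply: goodM => //.
by apply: good_int => // n _; rewrite coef_map; apply: vge_ev.
Qed.

End WeightedGood.

(** * Modules over finite fields *)

Section ModuleCount.
Variables (K : finFieldType) (V : finZmodType) (act : K -> V -> V).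
Hypothesis actDl : forall x y v, act (x + y) v = act x v + act y v.
Hypothesis actDr : forall x v w, act x (v + w) = act x v + act x w.
Hypothesis actM : forall x y v, act (x * y) v = act x (act y v).
Hypothesis act1 : forall v, act 1 v = v.

(** Linear algebra over a bare action rather than a module instance: the same space F^n will carry a
    different action of K for each morphism f. *)
Definition lincomb m (u : {ffun 'I_m -> V}) (y : {ffun 'I_m -> K}) : V :=
  \sum_i act (y i) (u i).

Definition indep m (u : {ffun 'I_m -> V}) :=
  [forall y, (lincomb u y == 0) ==> (y == 0)].

Lemma act0l v : act 0 v = 0.
Proof. by apply: (addIr (act 0 v)); rewrite -actDl !add0r. Qed.

Lemma act0r x : act x 0 = 0.
Proof. by apply: (addIr (act x 0)); rewrite -actDr !add0r. Qed.

Lemma actNl x v : act (- x) v = - act x v.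
Proof. by apply: (addIr (act x v)); rewrite -actDl !addNr act0l. Qed.

Lemma act_sumr x (I : Type) (s : seq I) (P : pred I) (f : I -> V) :
  act x (\sum_(i <- s | P i) f i) = \sum_(i <- s | P i) act x (f i).
Proof. exact: (big_morph (act x) (actDr x) (act0r x)). Qed.

Lemma lincombD m (u : {ffun 'I_m -> V}) y y' :
  lincomb u (y + y') = lincomb u y + lincomb u y'.
Proof. by rewrite -big_split; apply: eq_bigr => i _ /=; rewrite ffunE actDl. Qed.

Lemma lincombN m (u : {ffun 'I_m -> V}) y : lincomb u (- y) = - lincomb u y.
Proof. by rewrite -sumrN; apply: eq_bigr => i _ /=; rewrite ffunE actNl. Qed.

Lemma lincombZ m (u : {ffun 'I_m -> V}) x (y : {ffun 'I_m -> K}) :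
  lincomb u [ffun i => x * y i] = act x (lincomb u y).
Proof. by rewrite act_sumr; apply: eq_bigr => i _; rewrite ffunE actM. Qed.

Lemma indep_inj m (u : {ffun 'I_m -> V}) : reflect (injective (lincomb u)) (indep u).
Proof.
apply: (iffP forallP) => [h y y' e|h y].
  apply/eqP; rewrite -subr_eq0; apply: (implyP (h _)).
  by rewrite lincombD lincombN e subrr.
apply/implyP => /eqP e; apply/eqP; apply: h; rewrite e /lincomb big1 // => i _.
by rewrite ffunE act0l.
Qed.

Definition lspan m (u : {ffun 'I_m -> V}) := [set lincomb u y | y in predT].

Lemma card_lspan m (u : {ffun 'I_m -> V}) : indep u -> #|lspan u| = (#|K| ^ m)%N.
Proof.
by move/indep_inj => h; rewrite card_imset // card_ffun card_ord.
Qed.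

Definition fcons m (T : Type) (v : T) (u : {ffun 'I_m -> T}) : {ffun 'I_m.+1 -> T} :=
  [ffun i => if unlift ord0 i is Some j then u j else v].

Lemma fcons0 m T (v : T) (u : {ffun 'I_m -> T}) : fcons v u ord0 = v.
Proof. by rewrite ffunE unlift_none. Qed.

Lemma fconsS m T (v : T) (u : {ffun 'I_m -> T}) j : fcons v u (lift ord0 j) = u j.
Proof. by rewrite ffunE liftK. Qed.

Lemma fcons_eta m T (u : {ffun 'I_m.+1 -> T}) :
  u = fcons (u ord0) [ffun j => u (lift ord0 j)].
Proof.
by apply/ffunP=> i; rewrite ffunE; case: unliftP => [j ->|->]; rewrite ?ffunE.
Qed.

Lemma lincomb_fcons m (v : V) (u : {ffun 'I_m -> V}) y :
  lincomb (fcons v u) y = act (y ord0) v + lincomb u [ffun j => y (lift ord0 j)].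
Proof.
rewrite /lincomb big_ord_recl fcons0; congr (_ + _).
by apply: eq_bigr => i _; rewrite fconsS ffunE.
Qed.

Lemma indep_fcons m v (u : {ffun 'I_m -> V}) :
  indep (fcons v u) = indep u && (v \notin lspan u).
Proof.
apply/forallP/andP => [h|[/forallP h hv] y].
  split; [apply/forallP => y; apply/implyP => /eqP e | apply/imsetP => -[y _ e]].
    have /implyP := h (fcons 0 y); rewrite lincomb_fcons fcons0 act0l add0r.
    have -> : [ffun j => fcons 0 y (lift ord0 j)] = y.
      by apply/ffunP=> j; rewrite ffunE fconsS.
    rewrite e eqxx => /(_ isT)/eqP/ffunP e'; apply/eqP/ffunP => j.
    by have := e' (lift ord0 j); rewrite fconsS !ffunE.
  have /implyP := h (fcons (-1) y); rewrite lincomb_fcons fcons0 actNl act1.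
  have -> : [ffun j => fcons (-1) y (lift ord0 j)] = y.
    by apply/ffunP=> j; rewrite ffunE fconsS.
  rewrite e addNr eqxx => /(_ isT)/eqP/ffunP/(_ ord0).
  by rewrite fcons0 ffunE => /eqP; rewrite oppr_eq0 oner_eq0.
apply/implyP; rewrite lincomb_fcons => /eqP e.
have y0 : y ord0 = 0.
  apply/eqP; apply: contraNT hv => y0; apply/imsetP.
  exists [ffun i => - (y ord0)^-1 * [ffun j => y (lift ord0 j)] i] => //.
  rewrite lincombZ; move/eqP: e; rewrite addrC addr_eq0 => /eqP ->.
  by rewrite -actNl -actM mulrNN mulVf // act1.
move: e; rewrite y0 act0l add0r => e.
have /implyP := h [ffun j => y (lift ord0 j)]; rewrite e eqxx => /(_ isT)/eqP/ffunP e'.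
apply/eqP/ffunP => i; rewrite ffunE; case: (unliftP ord0 i) => [j|] -> //.
by have := e' j; rewrite !ffunE.
Qed.

Definition indeps m := [set u : {ffun 'I_m -> V} | indep u].

Lemma card_indeps m : #|indeps m| = (\prod_(t < m) (#|V| - #|K| ^ t))%N.
Proof.
elim: m => [|m IHm].
  rewrite big_ord0; have -> : indeps 0 = setT; last by rewrite cardsT card_ffun card_ord expn0.
  apply/setP=> u; rewrite !inE; apply/forallP => y; apply/implyP => _.
  by apply/eqP/ffunP => -[].
pose S := [set x : V * {ffun 'I_m -> V} | (x.2 \in indeps m) && (x.1 \notin lspan x.2)].
have -> : indeps m.+1 = [set fcons x.1 x.2 | x in S].
  apply/setP=> u; apply/idP/imsetP => [|[[v u'] hS ->]]; last first.
    by move: hS; rewrite !inE /= indep_fcons.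
  rewrite inE (fcons_eta u) indep_fcons => hu.
  by exists (u ord0, [ffun j => u (lift ord0 j)]) => //; rewrite !inE.
rewrite card_imset; last first.
  move=> [v u] [v' u'] /= /ffunP e; congr (_, _).
    by have := e ord0; rewrite !fcons0.
  by apply/ffunP => j; have := e (lift ord0 j); rewrite !fconsS.
rewrite -sum1_card (eq_bigl (fun x => (x.2 \in indeps m) && (x.1 \notin lspan x.2))); last first.
  by move=> x; rewrite inE.
rewrite -(pair_big_dep predT (fun v u => (u \in indeps m) && (v \notin lspan u))
  (fun _ _ => 1%N)) /=.
rewrite (exchange_big_dep (fun u => u \in indeps m)) /=; last by move=> v u _ /andP[].
rewrite big_ord_recr /= -IHm -sum_nat_const; apply: eq_bigr => u hu.
rewrite (eq_bigl (fun v => v \in ~: lspan u)) => [|v]; last by rewrite hu inE.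
by rewrite sum1_card cardsCs setCK card_lspan // -[indep u]in_set.
Qed.

(** Otherwise no independent family spans V, so that independent families can be prolonged until
    |K|^m exceeds |V|. *)
Lemma card_eq_expn : exists m, #|V| = (#|K| ^ m)%N.
Proof.
have K1 : (1 < #|K|)%N by apply: finNzRing_gt1.
have [[m /eqP h]|no] := altP (@existsP _ (fun m : 'I_#|V|.+1 => #|V| == (#|K| ^ m)%N)).
  by exists m.
have main m : (m <= #|V|.+1)%N -> (0 < #|indeps m|)%N.
  elim: m => [|m IHm] lt_m; first by rewrite card_indeps big_ord0.
  have {}IHm := IHm (ltnW lt_m).
  rewrite card_indeps big_ord_recr /= -card_indeps muln_gt0 IHm subn_gt0.
  have /card_gt0P[u] := IHm; rewrite inE => /card_lspan e.
  have := max_card (mem (lspan u)); rewrite e leq_eqVlt => /orP[|//].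
  have := no; rewrite negb_exists => /forallP/(_ (Ordinal lt_m)) /=.
  by rewrite eq_sym => /negPf ->.
have /card_gt0P[u] := main _ (leqnn _); rewrite inE => /card_lspan e.
have := max_card (mem (lspan u)); rewrite e leqNgt; case/negP.
by apply: ltn_trans (ltnSn _) (ltn_expl _ K1).
Qed.

Lemma indep_basis m : #|V| = (#|K| ^ m)%N -> exists u : {ffun 'I_m -> V}, indep u.
Proof.
move=> e; have : (0 < #|indeps m|)%N.
  rewrite card_indeps prodn_gt0 // => t; rewrite e subn_gt0 ltn_exp2l //.
  exact: finNzRing_gt1.
by case/card_gt0P => u; rewrite inE; exists u.
Qed.

Lemma indep_bij m (u : {ffun 'I_m -> V}) : #|V| = (#|K| ^ m)%N -> indep u ->
  bijective (lincomb u).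
Proof.
move=> e /indep_inj h; apply: inj_card_bij h _.
by rewrite e card_ffun card_ord.
Qed.

End ModuleCount.

(** * Morphisms from a semisimple algebra to matrices *)

Section BlockDiagonal.
Variable F : fieldType.

Definition bdiag a b (X : 'M[F]_a) (Y : 'M[F]_b) : 'M_(a + b) := block_mx X 0 0 Y.

Lemma bdiagM a b (X X' : 'M_a) (Y Y' : 'M_b) :
  bdiag X Y *m bdiag X' Y' = bdiag (X *m X') (Y *m Y').
Proof. by rewrite /bdiag mulmx_block !mul0mx !mulmx0 !addr0 !add0r. Qed.

Lemma bdiagD a b (X X' : 'M_a) (Y Y' : 'M_b) :
  bdiag X Y + bdiag X' Y' = bdiag (X + X') (Y + Y').
Proof. by rewrite /bdiag add_block_mx !addr0. Qed.

Lemma bdiag_scalar a b c : bdiag (c%:M : 'M_a) (c%:M : 'M_b) = c%:M.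
Proof. by rewrite /bdiag -scalar_mx_block. Qed.

Lemma bdiag_unit a b (X : 'M_a) (Y : 'M_b) :
  (bdiag X Y \in unitmx) = (X \in unitmx) && (Y \in unitmx).
Proof. by rewrite !unitmxE /bdiag det_ublock unitrM. Qed.

Lemma bdiag_inj a b (X X' : 'M_a) (Y Y' : 'M_b) :
  bdiag X Y = bdiag X' Y' -> X = X' /\ Y = Y'.
Proof. by move=> /eq_block_mx[]. Qed.

Lemma commute_bdiag a b (M : 'M_(a + b)) :
  M *m bdiag 1%:M 0 = bdiag 1%:M 0 *m M -> M = bdiag (ulsubmx M) (drsubmx M).
Proof.
rewrite -{1 2 3}(submxK M) /bdiag !mulmx_block.
rewrite !mulmx0 !mul0mx !mulmx1 !mul1mx !addr0 => /eq_block_mx[_ h1 h2 _].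
by rewrite h2 -h1.
Qed.

Lemma rank_bdiag10 a b : \rank (bdiag (1%:M : 'M_a) (0 : 'M_b)) = a.
Proof.
by rewrite /bdiag -pid_mx_block rank_pid_mx // leq_addr.
Qed.

(** The rows of B are bases of the row spaces of E and of 1 - E, on which E acts from the right as 1
    and as 0. *)
Lemma idempotent_frame a b (E : 'M[F]_(a + b)) : E *m E = E -> \rank E = a ->
  exists2 B, B \in unitmx & B *m E = bdiag 1%:M 0 *m B.
Proof.
move=> EE rE; have EE' : E *m (1%:M - E) = 0 by rewrite mulmxBr mulmx1 EE subrr.
have EE'' : (1%:M - E) *m E = 0 by rewrite mulmxBl mul1mx EE subrr.
have rE' : \rank (1%:M - E) = b.
  apply/eqP; rewrite eqn_leq -(leq_add2l a) -{1}rE mulmx0_rank_max //=.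
  rewrite -(leq_add2l a) -{2}rE -[X in (X <= _)%N](mxrank1 F).
  by rewrite -{1}[1%:M](subrKC E) mxrank_add.
have [U hU] : exists U : 'M_(a, a + b), (U :=: E)%MS.
  by move: (row_base E) (eq_row_base E); rewrite rE => U hU; exists U.
have [U' hU'] : exists U' : 'M_(b, a + b), (U' :=: 1%:M - E)%MS.
  by move: (row_base _) (eq_row_base (1%:M - E)); rewrite rE' => U' hU'; exists U'.
have /submxP[X eU] : (U <= E)%MS by rewrite hU.
have /submxP[X' eU'] : (U' <= 1%:M - E)%MS by rewrite hU'.
exists (col_mx U U'); last first.
  rewrite mul_col_mx /bdiag mul_block_col !mul0mx mul1mx !addr0.
  by rewrite {1}eU -mulmxA EE -eU eU' -mulmxA EE'' mulmx0.
rewrite -row_full_unit -sub1mx -(subrKC E 1%:M) addmx_sub //.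
  by rewrite -hU -addsmxE addsmxSl.
by rewrite -hU' -addsmxE addsmxSr.
Qed.

Lemma unconjmxK n (B X : 'M[F]_n) : B \in unitmx ->
  invmx B *m (B *m X *m invmx B) *m B = X.
Proof. by move=> uB; rewrite !mulmxA mulVmx // mul1mx mulmxKV. Qed.

End BlockDiagonal.

Section AlgebraHoms.
Variables (F : finFieldType) (A : finComNzRingType) (iota : {rmorphism F -> A}).
Implicit Types (e x y : A) (c : F).

(* The [F]-linear multiplicative maps [A -> M_n(F)] for which the idempotent
   [e] acts as the identity, i.e. the [F]-algebra morphisms [eA -> M_n(F)]. *)
Definition homs e n : {set {ffun A -> 'M[F]_n}} :=
  [set f : {ffun A -> 'M[F]_n} |
   [&& [forall x, forall y, f (x + y) == f x + f y],
       [forall x, forall y, f (x * y) == f x *m f y] &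
       [forall c, f (iota c * e) == c%:M]]].

Lemma homsP e n (f : {ffun A -> 'M[F]_n}) :
  reflect [/\ forall x y, f (x + y) = f x + f y,
              forall x y, f (x * y) = f x *m f y &
              forall c, f (iota c * e) = c%:M] (f \in homs e n).
Proof.
rewrite inE; apply: (iffP and3P) => [[/forallP h1 /forallP h2 /forallP h3]|[h1 h2 h3]].
  split=> [x y|x y|c]; last exact/eqP.
    by have /forallP/(_ y)/eqP := h1 x.
  by have /forallP/(_ y)/eqP := h2 x.
split; apply/forallP => x; last by rewrite h3.
  by apply/forallP => y; rewrite h1.
by apply/forallP => y; rewrite h2.
Qed.

Section OneHom.
Variables (e : A) (n : nat) (f : {ffun A -> 'M[F]_n}).
Hypothesis hf : f \in homs e n.

Lemma homD x y : f (x + y) = f x + f y. Proof. by case/homsP: hf. Qed.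
Lemma homM x y : f (x * y) = f x *m f y. Proof. by case/homsP: hf. Qed.
Lemma homC c : f (iota c * e) = c%:M. Proof. by case/homsP: hf. Qed.
Lemma home : f e = 1%:M. Proof. by rewrite -homC rmorph1 mul1r. Qed.
Lemma hom0 : f 0 = 0. Proof. by apply: (addIr (f 0)); rewrite -homD !add0r. Qed.
Lemma homMe x : f (x * e) = f x. Proof. by rewrite homM home mulmx1. Qed.
Lemma homeM x : f (e * x) = f x. Proof. by rewrite homM home mul1mx. Qed.
Lemma homZ c x : f (iota c * x) = c *: f x.
Proof. by rewrite -homMe mulrAC homM homC mul_scalar_mx. Qed.
Lemma homCom x y : f x *m f y = f y *m f x. Proof. by rewrite -!homM mulrC. Qed.
Lemma hom_sum (I : Type) (r : seq I) (P : pred I) (g : I -> A) :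
  f (\sum_(i <- r | P i) g i) = \sum_(i <- r | P i) f (g i).
Proof. exact: (big_morph f homD hom0). Qed.
End OneHom.

Definition gl n := [set B : 'M[F]_n | B \in unitmx].

Lemma hom_conj e n (f : {ffun A -> 'M[F]_n}) B : f \in homs e n -> B \in unitmx ->
  [ffun x => B *m f x *m invmx B] \in homs e n.
Proof.
move=> hf uB; apply/homsP; split=> [x y|x y|c]; rewrite !ffunE.
- by rewrite (homD hf) mulmxDr mulmxDl.
- by rewrite (homM hf) !mulmxA mulmxKV.
- by rewrite (homC hf) scalar_mxC -mulmxA mulmxV // mulmx1.
Qed.

Section Split.
Variables (e e1 e2 : A) (a b : nat).
Hypotheses (ee : e = e1 + e2) (e11 : e1 * e1 = e1) (e12 : e1 * e2 = 0).

Definition homs_rank := [set f in homs e (a + b) | \rank (f e1) == a].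

Let E : 'M[F]_(a + b) := bdiag 1%:M 0.

Lemma glue_hom f1 f2 : f1 \in homs e1 a -> f2 \in homs e2 b ->
  [ffun x => bdiag (f1 x) (f2 x)] \in homs e (a + b) /\
  bdiag (f1 e1) (f2 e1) = E.
Proof.
move=> h1 h2.
have f12 x : f1 (x * e2) = 0 by rewrite -(homMe h1) -mulrA [e2 * _]mulrC e12 mulr0 (hom0 h1).
have f21 x : f2 (x * e1) = 0 by rewrite -(homMe h2) -mulrA e12 mulr0 (hom0 h2).
split; last by rewrite (home h1) -[e1]mul1r f21.
apply/homsP; split=> [x y|x y|c]; rewrite !ffunE.
- by rewrite (homD h1) (homD h2) bdiagD.
- by rewrite (homM h1) (homM h2) bdiagM.
rewrite ee mulrDr (homD h1) (homD h2) f12 f21 (homC h1) (homC h2) addr0 add0r.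
by rewrite bdiag_scalar.
Qed.

Lemma unglue_hom g : g \in homs e (a + b) -> g e1 = E ->
  [/\ forall x, g x = bdiag (ulsubmx (g x)) (drsubmx (g x)),
      [ffun x => ulsubmx (g x)] \in homs e1 a &
      [ffun x => drsubmx (g x)] \in homs e2 b].
Proof.
move=> hg ge.
have gb x : g x = bdiag (ulsubmx (g x)) (drsubmx (g x)).
  by apply: commute_bdiag; rewrite -/E -ge (homCom hg).
have ge2 : g e2 = bdiag 0 1%:M.
  apply: (addrI (g e1)); rewrite -(homD hg) -ee (home hg) ge /E bdiagD addr0 add0r.
  by rewrite bdiag_scalar.
split=> //; apply/homsP; split=> [x y|x y|c]; rewrite !ffunE.
- by rewrite (homD hg); apply/matrixP => i j; rewrite !mxE.
- by rewrite (homM hg) {1}(gb x) {1}(gb y) bdiagM /bdiag block_mxKul.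
- by rewrite (homZ hg) ge /E /bdiag scale_block_mx block_mxKul scalemx1.
- by rewrite (homD hg); apply/matrixP => i j; rewrite !mxE.
- by rewrite (homM hg) {1}(gb x) {1}(gb y) bdiagM /bdiag block_mxKdr.
- by rewrite (homZ hg) ge2 /bdiag scale_block_mx block_mxKdr scalemx1.
Qed.

(** This is the product rule behind the factorisation of F: numbers of morphisms divided by |GL_n|
    multiply. Every f with f(e1) of rank a is B^-1 diag(f1, f2) B, and once a [frame] is fixed for
    f, the choice of B amounts to an element of GL_a x GL_b, the centraliser of E = diag(1, 0) in
    GL_(a+b). *)
Lemma card_homs_rank :
  (#|homs_rank| * (#|gl a| * #|gl b|) = #|homs e1 a| * #|homs e2 b| * #|gl (a + b)|)%N.
Proof.
(* A chosen matrix conjugating f(e1) to E; the default value does not occur on [homs_rank]. *)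
pose frame (f : {ffun A -> 'M[F]_(a + b)}) : 'M[F]_(a + b) :=
  odflt 1%:M [pick B in unitmx | B *m f e1 == E *m B].
have frameP f : f \in homs_rank -> frame f \in unitmx /\ frame f *m f e1 = E *m frame f.
  rewrite inE => /andP[hf /eqP rf].
  have idem : f e1 *m f e1 = f e1 by rewrite -(homM hf) e11.
  rewrite /frame; case: pickP => [B /andP[uB /eqP hB] //|no].
  have [B uB hB] := idempotent_frame idem rf.
  by have := no B; rewrite uB hB eqxx.
pose Psi (z : {ffun A -> 'M[F]_(a + b)} * ('M[F]_a * 'M[F]_b)) :=
  let B := bdiag z.2.1 z.2.2 *m frame z.1 in
  (([ffun x => ulsubmx (B *m z.1 x *m invmx B)],
   [ffun x => drsubmx (B *m z.1 x *m invmx B)]), B).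
have PsiP z : z \in setX homs_rank (setX (gl a) (gl b)) ->
  let B := (Psi z).2 in
  [/\ B \in unitmx, (Psi z).1.1 \in homs e1 a, (Psi z).1.2 \in homs e2 b &
    forall x, z.1 x = invmx B *m bdiag ((Psi z).1.1 x) ((Psi z).1.2 x) *m B].
  case: z => f [C D]; rewrite !in_setX ![_ \in gl _]inE /= => /and3P[hf uC uD].
  have [uf ff] := frameP f hf.
  set B := _ *m frame f.
  have uB : B \in unitmx by rewrite unitmx_mul bdiag_unit uC uD.
  have hf' : f \in homs e (a + b) by move: hf; rewrite inE => /andP[].
  have hg := hom_conj hf' uB; set g := [ffun _ => _] in hg.
  have ge : g e1 = E.
    have EB : B *m f e1 = E *m B.
      rewrite /B -mulmxA ff !mulmxA; congr (_ *m _).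
      by rewrite /E !bdiagM mulmx1 mul1mx mulmx0 mul0mx.
    by rewrite ffunE EB mulmxK.
  have [gb h1 h2] := unglue_hom hg ge.
  split=> // [||x].
  - rewrite (_ : [ffun x => _] = [ffun x => ulsubmx (g x)]) //.
    by apply/ffunP => x; rewrite !ffunE.
  - rewrite (_ : [ffun x => _] = [ffun x => drsubmx (g x)]) //.
    by apply/ffunP => x; rewrite !ffunE.
  rewrite !ffunE; have := gb x; rewrite !ffunE => <-.
  by rewrite unconjmxK.
have inj : {in setX homs_rank (setX (gl a) (gl b)) &, injective Psi}.
  move=> z z' hz hz' eq; have [_ _ _ h] := PsiP z hz; have [_ _ _ h'] := PsiP z' hz'.
  have e1' : z.1 = z'.1 by apply/ffunP => x; rewrite h h' eq.
  have := congr1 snd eq; rewrite /= e1'.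
  have hf : z'.1 \in homs_rank by move: hz'; rewrite (surjective_pairing z') => /setXP[].
  have [uf _] := frameP _ hf.
  move/(congr1 (fun M => M *m invmx (frame z'.1))); rewrite !mulmxK // => /bdiag_inj[c1 c2].
  by case: z z' e1' c1 c2 {eq hz hz' h h' hf uf} => [f [C D]] [f' [C' D']] /= -> -> ->.
have im : Psi @: setX homs_rank (setX (gl a) (gl b)) =
          setX (setX (homs e1 a) (homs e2 b)) (gl (a + b)).
  apply/setP=> -[[f1 f2] B]; apply/imsetP/idP => [[z hz ->]|].
    by have [uB h1 h2 _] := PsiP z hz; rewrite !in_setX h1 h2 inE.
  rewrite !in_setX [_ \in gl _]inE /= => /andP[/andP[h1 h2] uB].
  have [hg ge] := glue_hom h1 h2.
  pose f := [ffun x => invmx B *m bdiag (f1 x) (f2 x) *m B].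
  have hf : f \in homs e (a + b).
    have uB' : invmx B \in unitmx by rewrite unitmx_inv.
    have := hom_conj hg uB'; rewrite (_ : [ffun x => _] = f) //.
    by apply/ffunP => x; rewrite !ffunE invmxK.
  have fe1 : f e1 = invmx B *m E *m B by rewrite ffunE ge.
  have hf' : f \in homs_rank.
    rewrite inE hf fe1 mxrankMfree ?row_free_unit //.
    rewrite eqmxMfull ?row_full_unit ?unitmx_inv //.
    by rewrite rank_bdiag10 eqxx.
  have [uf ff] := frameP f hf'.
  set M := B *m invmx (frame f).
  have uM : M \in unitmx by rewrite unitmx_mul uB unitmx_inv.
  have Mb : M = bdiag (ulsubmx M) (drsubmx M).
    apply: commute_bdiag; rewrite -/E.
    have h3 : invmx (frame f) *m E = f e1 *m invmx (frame f).
      apply: (canRL (mulmxK uf)); rewrite -mulmxA -ff mulmxA mulVmx // mul1mx //.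
    by rewrite /M -mulmxA h3 fe1 !mulmxA mulmxV // mul1mx.
  have BM : B = M *m frame f by rewrite /M mulmxKV.
  exists (f, (ulsubmx M, drsubmx M)).
    by rewrite !in_setX hf' !inE -bdiag_unit -Mb.
  have g0 x : B *m f x *m invmx B = bdiag (f1 x) (f2 x).
    by rewrite ffunE !mulmxA mulmxV // mul1mx mulmxK.
  rewrite /Psi /= -Mb -BM; congr (_, _, _); apply/ffunP => x; rewrite ffunE g0 /bdiag.
    by rewrite block_mxKul.
  by rewrite block_mxKdr.
have := card_in_imset inj; by rewrite im !cardsX => <-.
Qed.

End Split.

End AlgebraHoms.

(** * The field cut out by a primitive idempotent *)

Section CornerField.
Variable A : finComNzRingType.

Record primitive_idempotent (e : A) (P : nat) : Prop := PrimitiveIdempotent {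
  prim_idem : e * e = e;
  prim_neq0 : e != 0;
  prim_min : forall x : A, x * x = x -> x * e = x -> x = 0 \/ x = e;
  prim_period : (1 < P)%N;
  prim_exp : forall x : A, x ^+ P = x }.

Section Corner.
Variables (e : A) (P : nat) (h : primitive_idempotent e P).

(** The ring eA. The proof is a parameter of the type so that the field structure, which depends on
    it, can be attached. *)
Definition corner of primitive_idempotent e P := {x : A | x * e == x}.
Notation K := (corner h).

HB.instance Definition _ := Finite.copy K {x : A | x * e == x}.

Definition cval (x : K) : A := sval x.

Lemma cproj_subproof x : x * e * e == x * e.
Proof. by rewrite -mulrA (prim_idem h). Qed.

Definition cproj x : K := exist _ (x * e) (cproj_subproof x).

Lemma cval_inj : injective cval. Proof. exact: val_inj. Qed.
Lemma cvalP x : cval x * e = cval x. Proof. exact/eqP/(svalP x). Qed.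
Lemma cprojE x : cval (cproj x) = x * e. Proof. by []. Qed.
Lemma cvalK x : cproj (cval x) = x. Proof. by apply: cval_inj; rewrite cprojE cvalP. Qed.

Let add x y := cproj (cval x + cval y).
Let opp x := cproj (- cval x).
Let mul x y := cproj (cval x * cval y).

Let cvalD x y : cval (add x y) = cval x + cval y.
Proof. by rewrite cprojE mulrDl !cvalP. Qed.
Let cvalN x : cval (opp x) = - cval x.
Proof. by rewrite cprojE mulNr cvalP. Qed.
Let cvalM x y : cval (mul x y) = cval x * cval y.
Proof. by rewrite cprojE -mulrA cvalP. Qed.
Let cval0 : cval (cproj 0) = 0.
Proof. by rewrite cprojE mul0r. Qed.
Let cval1 : cval (cproj 1) = e.
Proof. by rewrite cprojE mul1r. Qed.

Let addA : associative add. Proof. by move=> x y z; apply: cval_inj; rewrite !cvalD addrA. Qed.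
Let addC : commutative add. Proof. by move=> x y; apply: cval_inj; rewrite !cvalD addrC. Qed.
Let add0 : left_id (cproj 0) add.
Proof. by move=> x; apply: cval_inj; rewrite cvalD cval0 add0r. Qed.
Let addN : left_inverse (cproj 0) opp add.
Proof. by move=> x; apply: cval_inj; rewrite cvalD cvalN cval0 addNr. Qed.

HB.instance Definition _ := GRing.isZmodule.Build K addA addC add0 addN.

Let mulA : associative mul. Proof. by move=> x y z; apply: cval_inj; rewrite !cvalM mulrA. Qed.
Let mulC : commutative mul. Proof. by move=> x y; apply: cval_inj; rewrite !cvalM mulrC. Qed.
Let mul1 : left_id (cproj 1) mul.
Proof. by move=> x; apply: cval_inj; rewrite cvalM cval1 mulrC cvalP. Qed.
Let mulD : left_distributive mul +%R.
Proof. by move=> x y z; apply: cval_inj; rewrite !(cvalM, cvalD) mulrDl. Qed.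
Let one_neq0 : cproj 1 != 0.
Proof.
apply/eqP => /(congr1 cval); rewrite cval1 cval0; exact/eqP/(prim_neq0 h).
Qed.

HB.instance Definition _ := GRing.Zmodule_isComNzRing.Build K mulA mulC mul1 mulD one_neq0.

(** Since x^P = x, the power x^(P-1) is an idempotent of eA, nonzero for x != 0, hence equal to e.
    With the exponent 2P - 3, [inv x] times x is the square of this idempotent. *)
Let inv (x : K) : K := if x == 0 then 0 else cproj (cval x ^+ (P.-2.+1 + P.-2)).

Let mulV (x : K) : x != 0 -> mul (inv x) x = 1.
Proof.
move=> x0; apply: cval_inj; rewrite cvalM cval1 /inv (negPf x0) cprojE.
rewrite -mulrA [e * _]mulrC cvalP -exprSr.
have P2 : P = P.-2.+2 by have := prim_period h; case: (P) => [|[]].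
set a := cval x; set n := P.-2.+1.
have an : a * a ^+ n = a by rewrite -exprS /n -P2 (prim_exp h).
have en : a ^+ n = a ^+ P.-2 * a by exact: exprSr.
have idem : a ^+ n * a ^+ n = a ^+ n.
  by rewrite {1}en -mulrA an -en.
have -> : (n + P.-2).+1 = (n + n)%N by rewrite addnS.
rewrite exprD idem.
have ane : a ^+ n * e = a ^+ n by rewrite en -mulrA cvalP.
case: (prim_min h idem ane) => // a0.
case/eqP: x0; apply: cval_inj; rewrite -/a -an a0 mulr0; exact/esym/cval0.
Qed.

Let inv0 : inv 0 = 0.
Proof. by rewrite /inv eqxx. Qed.

HB.instance Definition _ := GRing.ComNzRing_isField.Build K mulV inv0.

Lemma cval_add x y : cval (x + y) = cval x + cval y. Proof. exact: cvalD. Qed.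
Lemma cval_mul x y : cval (x * y) = cval x * cval y. Proof. exact: cvalM. Qed.
Lemma cval_zero : cval 0 = 0. Proof. exact: cval0. Qed.
Lemma cval_one : cval 1 = e. Proof. exact: cval1. Qed.

End Corner.
End CornerField.

HB.saturate finfun_of.

Lemma card_gl (F : finFieldType) n :
  #|gl F n| = (\prod_(t < n) (#|F| ^ n - #|F| ^ t))%N.
Proof.
pose act (c : F) (v : 'rV[F]_n) := c *: v.
have actDl : forall x y v, act (x + y) v = act x v + act y v by move=> *; exact: scalerDl.
have actDr : forall x v w, act x (v + w) = act x v + act x w by move=> *; exact: scalerDr.
have actM : forall x y v, act (x * y) v = act x (act y v) by move=> *; rewrite /act scalerA.
have act1 : forall v, act 1 v = v by move=> *; exact: scale1r.
have := card_indeps actDl actDr actM act1 n; rewrite card_mx mul1n => <-.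
pose rows (B : 'M[F]_n) := [ffun i => row i B].
have rinj : injective rows.
  by move=> B C /ffunP e; apply/row_matrixP => i; have := e i; rewrite !ffunE.
have lincE B y : lincomb act (rows B) y = (\row_i y i) *m B.
  by rewrite mulmx_sum_row; apply: eq_bigr => i _; rewrite !ffunE mxE.
rewrite -(card_imset _ rinj); apply: eq_card => u; apply/imsetP/idP => [[B]|].
  rewrite !inE => uB ->; apply/forallP => y; apply/implyP.
  rewrite lincE => /eqP e; apply/eqP/ffunP => i.
  have : (\row_i y i) *m B *m invmx B = 0 by rewrite e mul0mx.
  by rewrite mulmxK // => /rowP/(_ i); rewrite !mxE ffunE.
rewrite inE => /forallP hu; exists (\matrix_i u i); last first.
  by apply/ffunP => i; rewrite ffunE rowK.
rewrite inE -row_free_unit; apply: inj_row_free => v hv.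
have /implyP := hu [ffun i => v 0 i].
have -> : u = rows (\matrix_i u i) by apply/ffunP => i; rewrite ffunE rowK.
rewrite lincE (_ : \row_i _ = v) ?hv ?eqxx; last by apply/rowP => i; rewrite mxE ffunE.
by move=> /(_ isT)/eqP/ffunP e; apply/rowP => i; have := e i; rewrite !ffunE mxE.
Qed.

Section Leaf.
Variables (F : finFieldType) (A : finComNzRingType) (iota : {rmorphism F -> A}).
Variables (e : A) (P : nat) (h : primitive_idempotent e P).
Local Notation K := (corner h).

Lemma cproj_add x y : cproj h (x + y) = cproj h x + cproj h y.
Proof. by apply: cval_inj; rewrite cval_add !cprojE mulrDl. Qed.

Lemma cproj_mul x y : cproj h (x * y) = cproj h x * cproj h y.
Proof.
by apply: cval_inj; rewrite cval_mul !cprojE mulrACA (prim_idem h).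
Qed.

Lemma cproj_one : cproj h 1 = 1.
Proof. by apply: cval_inj; rewrite [RHS]cval_one cprojE mul1r. Qed.

Lemma cproj_e : cproj h e = 1.
Proof. by apply: cval_inj; rewrite [RHS]cval_one cprojE (prim_idem h). Qed.

Section CoordinateSpace.
Variable m : nat.

Definition scal (x : K) (y : {ffun 'I_m -> K}) : {ffun 'I_m -> K} := [ffun i => x * y i].
Definition actF (c : F) (y : {ffun 'I_m -> K}) := scal (cproj h (iota c)) y.

Lemma scalD x y z : scal x (y + z) = scal x y + scal x z.
Proof. by apply/ffunP => i; rewrite !ffunE mulrDr. Qed.
Lemma scalDl x y z : scal (x + y) z = scal x z + scal y z.
Proof. by apply/ffunP => i; rewrite !ffunE mulrDl. Qed.
Lemma scalM x y z : scal (x * y) z = scal x (scal y z).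
Proof. by apply/ffunP => i; rewrite !ffunE mulrA. Qed.
Lemma scalC x y z : scal x (scal y z) = scal y (scal x z).
Proof. by rewrite -!scalM mulrC. Qed.
Lemma scal1 z : scal 1 z = z.
Proof. by apply/ffunP => i; rewrite !ffunE mul1r. Qed.

Lemma actFDl c c' y : actF (c + c') y = actF c y + actF c' y.
Proof. by rewrite /actF rmorphD cproj_add scalDl. Qed.
Lemma actFDr c y y' : actF c (y + y') = actF c y + actF c y'.
Proof. exact: scalD. Qed.
Lemma actFM c c' y : actF (c * c') y = actF c (actF c' y).
Proof. by rewrite /actF rmorphM cproj_mul scalM. Qed.
Lemma actF1 y : actF 1 y = y.
Proof. by rewrite /actF rmorph1 cproj_one scal1. Qed.

End CoordinateSpace.

Lemma card_corner : exists2 k, (0 < k)%N & #|{: K}| = (#|F| ^ k)%N.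
Proof.
have [k] := @card_eq_expn F {ffun 'I_1 -> K} (@actF 1) (@actFDl 1) (@actFDr 1)
  (@actFM 1) (@actF1 1).
rewrite card_ffun card_ord expn1 => e'; exists k => //.
by have := finNzRing_gt1 K; rewrite e'; case: (k).
Qed.

Section HomAction.
Variables (n : nat) (f : {ffun A -> 'M[F]_n}).
Hypothesis hf : f \in homs iota e n.

Definition homact (x : K) (v : 'rV[F]_n) := v *m f (cval x).

Lemma homactDl x y v : homact (x + y) v = homact x v + homact y v.
Proof. by rewrite /homact cval_add (homD hf) mulmxDr. Qed.
Lemma homactDr x v w : homact x (v + w) = homact x v + homact x w.
Proof. exact: mulmxDl. Qed.
Lemma homactM x y v : homact (x * y) v = homact x (homact y v).
Proof. by rewrite /homact cval_mul mulrC (homM hf) mulmxA. Qed.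
Lemma homact1 v : homact 1 v = v.
Proof. by rewrite /homact cval_one (home hf) mulmx1. Qed.

Lemma homs_card : exists m, (#|F| ^ n = #|{: K}| ^ m)%N.
Proof.
have [m] := card_eq_expn homactDl homactDr homactM homact1.
by rewrite card_mx mul1n; exists m.
Qed.

End HomAction.

(** Double count of the pairs (f, u) with u a K-basis of F^n, on which K = eA acts through f. They
    correspond to the invertible matrices B, which transport the K-structure and the standard basis
    of K^m to F^n. The product on the left is |GL_m(K)|. *)
Lemma card_homs_leaf n m : (#|F| ^ n = #|{: K}| ^ m)%N ->
  (#|homs iota e n| * \prod_(t < m) (#|{: K}| ^ m - #|{: K}| ^ t) = #|gl F n|)%N.
Proof.
move=> enm; pose V := {ffun 'I_m -> K}.
have cV : #|{: V}| = (#|F| ^ n)%N by rewrite card_ffun card_ord enm.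
(* An F-basis of K^m identifies it with F^n; below, [kap] is the coordinate map and [R x] the matrix
   of multiplication by x. *)
have [w hw] := @indep_basis F V (@actF m) (@actFDl m) (@actFDr m) (@actFM m) (@actF1 m) n cV.
have [g gK Kg] := indep_bij (V := V) (act := @actF m) (@actFDl m) cV hw.
set lc := lincomb _ w in gK Kg.
have lcD y z : lc (y + z) = lc y + lc z by apply: lincombD => *; exact: actFDl.
have lcZ c (y : {ffun 'I_n -> F}) : lc [ffun i => c * y i] = actF c (lc y).
  by apply: lincombZ => *; rewrite ?actFDr ?actFM.
pose kap (y : V) : 'rV[F]_n := \row_i g y i.
have kapD (y z : V) : kap (y + z) = kap y + kap z.
  have eg : g (y + z) = g y + g z by apply: (can_inj gK); rewrite lcD !Kg.
  by apply/rowP => i; rewrite !mxE eg ffunE.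
have kapZ c (y : V) : kap (actF c y) = c *: kap y.
  have eg : g (actF c y) = [ffun i => c * g y i] by apply: (can_inj gK); rewrite lcZ !Kg.
  by apply/rowP => i; rewrite !mxE eg ffunE.
have kap_lc x : kap (lc x) = \row_i x i by rewrite /kap gK.
have lc_kap y : lc [ffun i => kap y 0 i] = y.
  by rewrite -[RHS]Kg; congr lc; apply/ffunP => i; rewrite ffunE mxE.
have kap_inj y z : kap y = kap z -> y = z by move=> eq; rewrite -(lc_kap y) eq lc_kap.
pose mxof (T : V -> 'rV[F]_n) : 'M[F]_n := \matrix_i T (w i).
have mxofP T : (forall y z, T (y + z) = T y + T z) ->
    (forall c y, T (actF c y) = c *: T y) -> forall y, kap y *m mxof T = T y.
  move=> TD TZ y; have T0 : T 0 = 0 by apply: (addIr (T 0)); rewrite -TD !add0r.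
  rewrite -[in RHS](lc_kap y) /lc /lincomb (big_morph T TD T0) mulmx_sum_row.
  by apply: eq_bigr => i _; rewrite TZ rowK ffunE.
pose R (x : K) : 'M[F]_n := mxof (fun y => kap (scal x y)).
have RP x y : kap y *m R x = kap (scal x y).
  rewrite mxofP // => [y' z'|c y']; first by rewrite scalD kapD.
  by rewrite /actF scalC kapZ.
have mx_ext (M M' : 'M[F]_n) : (forall y, kap y *m M = kap y *m M') -> M = M'.
  move=> eq; apply/row_matrixP => i; rewrite !rowE.
  have -> : delta_mx 0 i = kap (lc [ffun j => (j == i)%:R]).
    by rewrite kap_lc; apply/rowP => j; rewrite !mxE ffunE eqxx.
  exact: eq.
have RD x y : R (x + y) = R x + R y.
  by apply: mx_ext => z; rewrite mulmxDr !RP scalDl kapD.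
have RM x y : R (x * y) = R x *m R y.
  by apply: mx_ext => z; rewrite mulmxA !RP mulrC scalM.
have RC c : R (cproj h (iota c)) = c%:M.
  by apply: mx_ext => z; rewrite RP -/(actF c z) kapZ mul_mx_scalar.
pose dlt (t : 'I_m) : V := [ffun i => (i == t)%:R].
pose fB (B : 'M[F]_n) := [ffun x : A => invmx B *m R (cproj h x) *m B].
pose uB (B : 'M[F]_n) := [ffun t => kap (dlt t) *m B].
have scal_dlt (y : V) : \sum_t scal (y t) (dlt t) = y.
  apply/ffunP => i; rewrite sum_ffunE (bigD1 i) //= !ffunE eqxx mulr1 big1 ?addr0 //.
  by move=> t ne; rewrite !ffunE eq_sym (negPf ne) mulr0.
have kap0 : kap 0 = 0 by apply: (addIr (kap 0)); rewrite -kapD !add0r.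
have fB_hom B : B \in unitmx -> fB B \in homs iota e n.
  move=> UB; apply/homsP; split=> [x y|x y|c]; rewrite !ffunE.
  - by rewrite cproj_add RD mulmxDr mulmxDl.
  - by rewrite cproj_mul RM !mulmxA mulmxK.
  - rewrite cproj_mul cproj_e mulr1 RC scalar_mxC -mulmxA mulVmx ?mulmx1 //.
have lincB B y : B \in unitmx -> lincomb (homact (fB B)) (uB B) y = kap y *m B.
  move=> UB; rewrite -{2}(scal_dlt y) (big_morph kap kapD kap0) mulmx_suml.
  apply: eq_bigr => t _; rewrite /homact !ffunE cvalK.
  by rewrite !mulmxA mulmxK // RP.
pose X := [set z : {ffun A -> 'M[F]_n} * {ffun 'I_m -> 'rV[F]_n} |
   (z.1 \in homs iota e n) && (z.2 \in indeps (homact z.1) m)].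
have cX : #|X| = (#|homs iota e n| * \prod_(t < m) (#|{: K}| ^ m - #|{: K}| ^ t))%N.
  rewrite -sum1_card (eq_bigl (fun z =>
    (z.1 \in homs iota e n) && (z.2 \in indeps (homact z.1) m))); last first.
    by move=> z; rewrite inE.
  rewrite -(pair_big_dep (fun f => f \in homs iota e n)
    (fun f u => u \in indeps (homact f) m) (fun _ _ => 1%N)) /=.
  rewrite -sum_nat_const; apply: eq_bigr => f hf; rewrite sum1_card.
  have := card_indeps (homactDl hf) (homactDr f) (homactM hf) (homact1 hf) m.
  by rewrite card_mx mul1n enm.
rewrite -cX; pose Psi B := (fB B, uB B).
have inj : {in gl F n &, injective Psi}.
  move=> B B'; rewrite !inE => UB UB' [ef eu].
  by apply: mx_ext => y; rewrite -!lincB // ef eu.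
rewrite -(card_in_imset inj); apply: eq_card => -[f u].
apply/idP/imsetP => [|[B]]; rewrite [_ \in X]inE /=; last first.
  rewrite [B \in _]inE => UB [-> ->]; rewrite fB_hom //= inE.
  apply/(indep_inj (homactDl (fB_hom _ UB)) (uB B)) => y z; rewrite !lincB //.
  by move/(can_inj (mulmxK UB))/kap_inj.
move=> /andP[hf]; rewrite inE => hu.
have /(indep_inj (homactDl hf) u) uinj := hu.
pose T := lincomb (homact f) u.
have TD y z : T (y + z) = T y + T z by apply: lincombD; exact: homactDl.
have TS x y : T (scal x y) = homact f x (T y).
  by apply: lincombZ; [exact: homactDr | exact: homactM].
have TZ c y : T (actF c y) = c *: T y.
  rewrite /actF TS /homact cprojE (homMe hf) -[iota c]mulr1 (homZ hf).
  by rewrite -scalemxAr -(homeM hf 1) mulr1 (home hf) mulmx1.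
have TB := mxofP T TD TZ; set B := mxof T in TB.
have UB : B \in unitmx.
  rewrite -row_free_unit; apply: inj_row_free => v hv.
  have ev : v = kap (lc [ffun i => v 0 i]).
    by rewrite kap_lc; apply/rowP => i; rewrite mxE ffunE.
  have : T (lc [ffun i => v 0 i]) = T 0.
    rewrite -!TB -ev hv; by rewrite kap0 mul0mx.
  by move=> /uinj e0; rewrite ev e0 kap0.
exists B; first by rewrite inE.
congr (_, _).
  apply/ffunP => x; rewrite ffunE; apply/esym.
  apply: (can_inj (mulKmx UB)); rewrite -!mulmxA mulKVmx //.
  apply: mx_ext => y; rewrite !mulmxA RP !TB TS /homact cprojE (homMe hf) //.
apply/ffunP => t; rewrite ffunE TB /T /lincomb (bigD1 t) //= big1 ?addr0.
  by rewrite ffunE eqxx (homact1 hf).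
move=> i ne; rewrite ffunE (negPf ne) /homact cval_zero (hom0 hf) mulmx0 //.
Qed.

End Leaf.

(** * Fixed points of powers of Frobenius *)

Section FrobeniusFixed.
Variables (L : finFieldType) (q k : nat).
Hypotheses (q1 : (1 < q)%N) (cL : #|L| = (q ^ k)%N) (k0 : (0 < k)%N).

Lemma frob_iter (x : L) a j : x ^+ (q ^ a) = x -> x ^+ (q ^ (a * j)) = x.
Proof.
by move=> h; elim: j => [|j IH]; rewrite ?muln0 ?expr1 // mulnS expnD exprM h.
Qed.

(** By Bezout, some multiple of m is gcd(k, m) plus a multiple of k, and x^(q^k) = x. *)
Lemma frob_gcd (x : L) m : (0 < m)%N ->
  (x ^+ (q ^ m) == x) = (x ^+ (q ^ gcdn k m) == x).
Proof.
move=> m0; apply/eqP/eqP => h; last first.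
  by have /dvdnP[j ->] := dvdn_gcdr k m; rewrite mulnC frob_iter.
case: (egcdnP k m0) => u v e _.
have hk : x ^+ (q ^ k) = x by rewrite -cL expf_card.
have := frob_iter u h; rewrite mulnC e expnD exprM.
by rewrite mulnC frob_iter // gcdnC.
Qed.

(** X^(q^g) - X divides X^(q^k) - X, the product of all X - x, so it has as many roots in L as its
    degree. *)
Lemma card_frob_dvd g : (0 < g)%N -> (g %| k)%N ->
  #|[set x : L | x ^+ (q ^ g) == x]| = (q ^ g)%N.
Proof.
move=> g0 /dvdnP[j ej]; pose p : {poly L} := 'X^(q ^ g) - 'X.
have qg1 : (1 < q ^ g)%N by rewrite -(expn0 q) ltn_exp2l.
have sp : size p = (q ^ g).+1.
  by rewrite size_polyDl size_polyXn // size_polyN size_polyX ltnS.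
have dvX n (M : nat) : 'X^n - 1 %| ('X^(n * M) - 1 : {poly L}).
  by rewrite exprM (subrX1 'X^n M) dvdp_mulr.
have dv : p %| \prod_(x <- enum L) ('X - x%:P).
  rewrite big_enum /= -finField_genPoly cL.
  have e1 n : (0 < n)%N -> 'X^n - 'X = 'X * ('X^(n.-1) - 1) :> {poly L}.
    by move=> n0; rewrite mulrBr mulr1 -exprS prednK.
  rewrite /p !e1 ?expn_gt0 ?(ltnW q1) // dvdp_mul2l ?polyX_eq0 //.
  have -> : (q ^ k).-1 = ((q ^ g).-1 * \sum_(i < j) (q ^ g) ^ i)%N.
    by rewrite -predn_exp -expnM ej mulnC.
  exact: dvX.
have [m pm] := dvdp_prod_XsubC dv.
set rs := mask m _ in pm.
have urs : uniq rs by rewrite mask_uniq // enum_uniq.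
have srs : size rs = (q ^ g)%N.
  by have := eqp_size pm; rewrite sp size_prod_XsubC => -[].
rewrite -[RHS]srs -(card_uniqP urs); apply: eq_card => x; rewrite inE.
by rewrite -root_prod_XsubC -(eqp_root pm) /root /p hornerD hornerN hornerXn hornerX subr_eq0.
Qed.

Lemma card_frob m : (0 < m)%N ->
  #|[set x : L | x ^+ (q ^ m) == x]| = (q ^ gcdn k m)%N.
Proof.
move=> m0; rewrite -[RHS]card_frob_dvd ?gcdn_gt0 ?k0 ?dvdn_gcdl //.
by apply: eq_card => x; rewrite !inE frob_gcd.
Qed.

End FrobeniusFixed.

Lemma gam_nat (q n : nat) : (0 < q)%N ->
  (\prod_(t < n) (q ^ n - q ^ t))%N%:R = gam q%:R n.
Proof.
move=> q0; rewrite natr_prod; apply: eq_bigr => t _.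
by rewrite natrB ?natrX // leq_pexp2l // ltnW.
Qed.

Lemma card_gl_gam (F : finFieldType) n : #|gl F n|%:R = gam #|F|%:R n :> rat.
Proof. by rewrite card_gl gam_nat // ltnW // finNzRing_gt1. Qed.

(** * Decomposition along orthogonal idempotents *)

Section Decomposition.
Variables (F : finFieldType) (A : finComNzRingType) (iota : {rmorphism F -> A}).
Local Notation q := #|F|.
Variable P : nat.
Hypotheses (P1 : (1 < P)%N) (expP : forall x : A, x ^+ P = x).

Let q1 : (1 < q)%N. Proof. exact: finNzRing_gt1. Qed.
Let gam_neq n : gam q%:R n != 0. Proof. by rewrite gam_neq0 // ltr1n. Qed.

Definition fixpts (e : A) M := [set x : A | (x * e == x) && (x ^+ (q ^ M) == x)].

Definition fprod s N : {poly rat} := \prod_(k <- s) (fser (q%:R ^+ k) N \Po 'X^k).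

(** s lists the degrees over F of the fields whose product is eA. The second clause is a count from
    which these degrees can be recovered, the third the factorisation of the generating series. Both
    are multiplicative for orthogonal idempotents, so no ring isomorphism has to be constructed. *)
Definition decomposes (e : A) (s : seq nat) :=
  [/\ all (leq 1) s,
      forall M, (0 < M)%N -> #|fixpts e M| = (q ^ \sum_(k <- s) gcdn k M)%N &
      forall n N, (n < N)%N -> #|homs iota e n|%:R / gam q%:R n = (fprod s N)`_n].

Lemma decomposes0 : decomposes 0 [::].
Proof.
split=> // [M M0|n N lt_nN].
  rewrite big_nil expn0 -(cards1 (0 : A)); apply: eq_card => x; rewrite !inE mulr0 eq_sym.
  by case: eqVneq => //= ->; rewrite expr0n expn_eq0 gtn_eqF ?eqxx // ltnW.
rewrite /fprod big_nil coef1; case: n lt_nN => [|n] _ /=.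
  rewrite gam0 divr1; suff -> : #|homs iota 0 0| = 1%N by [].
  have -> : homs iota 0 0 = setT.
    apply/setP=> f; rewrite [RHS]inE; apply/homsP; split=> [x y|x y|c];
    by rewrite [LHS]flatmx0 [RHS]flatmx0.
  by rewrite cardsT card_ffun card_mx muln0 expn0 exp1n.
suff -> : homs iota 0 n.+1 = set0 by rewrite cards0 mul0r.
apply/setP=> f; rewrite [RHS]inE; apply/negP => hf.
have := home hf; rewrite (hom0 hf) => /matrixP/(_ 0 0) /eqP.
by rewrite !mxE eqxx eq_sym oner_eq0.
Qed.

Lemma decomposes_primitive e : primitive_idempotent e P ->
  exists k, decomposes e [:: k].
Proof.
move=> h; have [k k0 cK] := card_corner iota h; exists k.
split; first by rewrite /= k0.
  move=> M M0; rewrite big_seq1 -(card_frob q1 cK k0 M0).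
  rewrite -(card_imset _ (@cval_inj _ _ _ h)); apply: eq_card => x.
  have cvX (y : corner h) n : (0 < n)%N -> cval (y ^+ n) = cval y ^+ n.
    by case: n => // n _; elim: n => // n IH; rewrite exprS cval_mul IH -exprS.
  have qM : (0 < q ^ M)%N by rewrite expn_gt0 ltnW.
  apply/idP/imsetP => [|[y]]; rewrite inE.
    move=> /andP[/eqP xe /eqP xq]; exists (cproj h x); last by rewrite cprojE.
    by rewrite inE; apply/eqP/cval_inj; rewrite cvX // cprojE xe.
  by move=> /eqP yq ->; rewrite inE cvalP eqxx -cvX // yq eqxx.
move=> n N lt_nN; rewrite /fprod big_seq1 coef_comp_poly_Xn //.
case: ifP => [/dvdnP[m em]|ndv]; last first.
  suff -> : homs iota e n = set0 by rewrite cards0 mul0r.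
  apply/setP=> f; rewrite [RHS]inE; apply/negP => hf.
  have [m] := homs_card h hf; rewrite cK -expnM => /eqP.
  by rewrite eqn_exp2l // => /eqP em; rewrite em dvdn_mulr in ndv.
have enm : (q ^ n = #|{: corner h}| ^ m)%N by rewrite cK -expnM em mulnC.
have mN : (m < N)%N by rewrite (leq_ltn_trans _ lt_nN) // em leq_pmulr.
rewrite coef_poly em mulnK // mN -em.
have := card_homs_leaf iota enm => /(congr1 (fun x => x%:R : rat)).
rewrite natrM card_gl_gam gam_nat cK ?expn_gt0 ?(ltnW q1) // natrX => eg.
have h0 : #|homs iota e n|%:R != 0 :> rat.
  by apply: contraNneq (gam_neq n) => h0; rewrite -eg h0 mul0r.
by rewrite -eg invfM mulVKf.
Qed.

Lemma card_homs_rank_eq e e1 e2 n a b : n = (a + b)%N ->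
  e = e1 + e2 -> e1 * e1 = e1 -> e1 * e2 = 0 ->
  (#|[set f in homs iota e n | \rank (f e1) == a]| * (#|gl F a| * #|gl F b|) =
   #|homs iota e1 a| * #|homs iota e2 b| * #|gl F n|)%N.
Proof. by move=> ->; exact: card_homs_rank. Qed.

Lemma decomposes_cat e e1 e2 s1 s2 :
  e = e1 + e2 -> e1 * e1 = e1 -> e2 * e2 = e2 -> e1 * e2 = 0 ->
  decomposes e1 s1 -> decomposes e2 s2 -> decomposes e (s1 ++ s2).
Proof.
move=> ee e11 e22 e12 [p1 fx1 h1] [p2 fx2 h2]; split.
- by rewrite all_cat p1.
- move=> M M0; rewrite big_cat /= expnD -fx1 // -fx2 // -cardsX.
  have qM : (0 < q ^ M)%N by rewrite expn_gt0 ltnW.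
  have e1e : e1 * e = e1 by rewrite ee mulrDr e11 e12 addr0.
  have e2e : e2 * e = e2 by rewrite ee mulrDr e22 mulrC e12 add0r.
  have powM (x d : A) : d * d = d -> (x * d) ^+ (q ^ M) = x ^+ (q ^ M) * d.
    move=> dd; rewrite exprMn; congr (_ * _).
    by case: (q ^ M)%N qM => // j _; elim: j => // j IH; rewrite exprS IH.
  pose Psi (x : A) := (x * e1, x * e2).
  have inj : {in fixpts e M &, injective Psi}.
    move=> x y; rewrite !inE => /andP[/eqP xe _] /andP[/eqP ye _] [h1' h2'].
    by rewrite -xe -ye ee !mulrDr h1' h2'.
  rewrite -(card_in_imset inj); apply: eq_card => -[x y].
  apply/imsetP/idP => [[z]|].
    rewrite !inE => /andP[/eqP ze /eqP zq] [-> ->] /=.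
    by rewrite -!mulrA e11 e22 !powM // zq !eqxx.
  rewrite !inE /= => /andP[/andP[/eqP xe /eqP xq] /andP[/eqP ye /eqP yq]].
  have xe2 : x * e2 = 0 by rewrite -xe -mulrA e12 mulr0.
  have ye1 : y * e1 = 0 by rewrite -ye -mulrA [e2 * _]mulrC e12 mulr0.
  exists (x + y); last by rewrite /Psi !mulrDl xe2 ye1 xe ye addr0 add0r.
  have xye : (x + y) * e = x + y by rewrite ee mulrDr !mulrDl xe ye xe2 ye1 addr0 add0r.
  have h : (x + y) ^+ (q ^ M) * e = (x + y) ^+ (q ^ M).
    by case: (q ^ M)%N qM => // j _; rewrite exprSr -mulrA xye.
  rewrite inE xye eqxx -h ee mulrDr -!powM // !mulrDl xe ye xe2 ye1 addr0 add0r.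
  by rewrite xq yq eqxx.
move=> n N lt_nN; rewrite /fprod big_cat /= -/(fprod s1 N) -/(fprod s2 N) coefM.
(* Morphisms are sorted by the rank a of f(e1); [card_homs_rank] then yields a Cauchy product. *)
have -> : #|homs iota e n| =
   (\sum_(a < n.+1) #|[set f in homs iota e n | \rank (f e1) == a :> nat]|)%N.
  rewrite -sum1_card (partition_big
    (fun f : {ffun A -> 'M[F]_n} => inord (\rank (f e1)) : 'I_n.+1) xpredT) //=.
  apply: eq_bigr => a _; rewrite -sum1_card; apply: eq_bigl => f; rewrite [RHS]inE.
  by congr (_ && _); rewrite -val_eqE /= inordK // ltnS rank_leq_row.
rewrite natr_sum mulr_suml; apply: eq_bigr => a _.
have la : (a <= n)%N by rewrite -ltnS ltn_ord.
rewrite -h1; last exact: leq_ltn_trans la lt_nN.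
rewrite -h2; last exact: leq_ltn_trans (leq_subr _ _) lt_nN.
have en : n = (a + (n - a))%N by rewrite subnKC.
have := card_homs_rank_eq en ee e11 e12 => /(congr1 (fun x => x%:R : rat)).
rewrite !natrM !card_gl_gam.
have ga := gam_neq a; have gb := gam_neq (n - a)%N; have gn := gam_neq n.
move: (gam q%:R n) (gam q%:R a) (gam q%:R (n - a)%N) gn ga gb => x y z x0 y0 z0 eq.
apply: (mulIf (mulf_neq0 y0 z0)); rewrite mulrAC eq.
by field; rewrite x0 y0 z0.
Qed.

Lemma decomposes_exists e : e * e = e -> exists s, decomposes e s.
Proof.
move: {2}_.+1 (ltnSn #|[set x : A | x * e == x]|) => B.
elim: B e => // B IH e le_B ee.
have [->|e0] := eqVneq e 0; first by exists [::]; apply: decomposes0.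
have [/existsP[x /and4P[/eqP xx /eqP xe x0 nxe]]|no] :=
  boolP [exists x : A, [&& x * x == x, x * e == x, x != 0 & x != e]]; last first.
  have h : primitive_idempotent e P.
    split=> // x xx xe; have := no; rewrite negb_exists => /forallP/(_ x).
    rewrite xx xe !eqxx /= negb_and !negbK => /orP[]/eqP; by [left | right].
  by have [k hk] := decomposes_primitive h; exists [:: k].
have yy : (e - x) * (e - x) = e - x.
  by rewrite mulrBl !mulrBr ee xx xe [e * x]mulrC xe subrr subr0.
have xy : x * (e - x) = 0 by rewrite mulrBr xe xx subrr.
have ye : (e - x) * e = e - x by rewrite mulrBl ee xe.
have small (d : A) : d * e = d -> e * d != e -> (#|[set x : A | (x * d)%R == x]| < B)%N.
  move=> de ne; apply: leq_trans _ (_ : (#|[set x : A | (x * e)%R == x]| <= B)%N) => //.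
  apply: proper_card; apply/properP; split.
    by apply/subsetP => z; rewrite !inE => /eqP zd; rewrite -zd -mulrA de.
  by exists e; rewrite !inE ?ee.
have [s1 h1] : exists s, decomposes x s.
  by apply: IH => //; apply: small => //; rewrite mulrC xe.
have [s2 h2] : exists s, decomposes (e - x) s.
  apply: IH => //; apply: small => //; rewrite mulrC ye.
  by apply: contra x0 => /eqP h; rewrite -[x]opprK -(addKr e (- x)) h addNr oppr0.
exists (s1 ++ s2); apply: decomposes_cat xx yy xy h1 h2.
by rewrite addrC subrK.
Qed.

End Decomposition.

(** * Orbits of powers of a permutation *)

Section GcdInversion.
Variables (B : nat) (delta : nat -> rat).
Hypothesis gcd_sum : forall m, (0 < m)%N ->
  \sum_(1 <= e < B) delta e * (gcdn e m)%:R = 0.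

Let D t := \sum_(1 <= e < B | (t %| e)%N) delta e.

Let gcd_totient e m : (0 < m)%N ->
  (gcdn e m = \sum_(1 <= t < m.+1 | (t %| m)%N && (t %| e)%N) totient t)%N.
Proof.
move=> m0; have g0 : (0 < gcdn e m)%N by rewrite gcdn_gt0 m0 orbT.
have gm : (gcdn e m <= m)%N by rewrite dvdn_leq // dvdn_gcdr.
rewrite -{1}[gcdn e m]sum_totient_dvd -(big_mkord (fun t => t %| gcdn e m)%N totient).
rewrite big_ltn_cond // dvd0n gtn_eqF //.
rewrite [RHS](big_cat_nat _ (n := (gcdn e m).+1)) //= [X in (_ + X)%N]big1_seq ?addn0.
  by apply: eq_bigl => t; rewrite dvdn_gcd andbC.
move=> t; rewrite mem_index_iota -andbA => /and4P[h1 h2 h3 _].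
by have := dvdn_leq g0 (_ : t %| gcdn e m)%N; rewrite dvdn_gcd h1 h2 leqNgt h3 => /(_ isT).
Qed.

Let D0 t : (0 < t)%N -> D t = 0.
Proof.
elim/ltn_ind: t => m IH m0.
have := gcd_sum m0.
under eq_bigr => e _ do rewrite gcd_totient // natr_sum mulr_sumr big_mkcondr /=.
rewrite exchange_big /= big_mkcond /= big_nat_recr //= dvdnn.
rewrite big1_seq ?add0r => [|t]; last first.
  rewrite mem_index_iota => /andP[_ /andP[t0 tm]]; case: ifP => // _.
  rewrite -big_mkcond /= -mulr_suml [X in X * _](_ : _ = D t) //.
  by rewrite IH ?mul0r.
rewrite -big_mkcond /= -mulr_suml => /eqP; rewrite mulf_eq0 pnatr_eq0.
by rewrite [totient m == _]gtn_eqF ?totient_gt0 // orbF => /eqP.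
Qed.

(** As gcd(e, m) is the sum of totient(t) over the common divisors t, the hypothesis reads sum_{t |
    m} totient(t) D_t = 0 for all m, and D_t = 0 follows by induction on t. Descending induction on
    e then isolates delta_e in D_e. *)
Lemma gcd_inversion e : (0 < e < B)%N -> delta e = 0.
Proof.
move: {2}(B - e)%N (leqnn (B - e)) => n; elim: n e => [|n IH] e le_n /andP[e0 eB].
  by move: le_n; rewrite leqn0 subn_eq0 leqNgt eB.
have := D0 e0; rewrite /D (big_cat_nat _ (n := e)) //=; last exact: ltnW.
rewrite big1_seq ?add0r => [|t]; last first.
  rewrite mem_index_iota => /and3P[/dvdn_leq h t0 te].
  by have := h t0; rewrite leqNgt te.
rewrite big_ltn_cond // dvdnn big1_seq ?addr0 // => t.
rewrite mem_index_iota => /and3P[_ et tB]; apply: IH; last by rewrite tB (ltn_trans e0).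
by rewrite -ltnS (leq_trans _ le_n) // ltn_sub2l.
Qed.

End GcdInversion.

Lemma sum_count (B : nat) (s : seq nat) (P : pred nat) (f : nat -> rat) :
  (forall k, k \in s -> (0 < k < B)%N) ->
  \sum_(k <- s | P k) f k = \sum_(1 <= e < B | P e) (count_mem e s)%:R * f e.
Proof.
elim: s => [|k s IH] hs.
  by rewrite big_nil big1 // => e _; rewrite mul0r.
have hk : (0 < k < B)%N by apply: hs; rewrite mem_head.
rewrite big_cons IH => [|j js]; last by apply: hs; rewrite inE js orbT.
under [RHS]eq_bigr => e _ do rewrite /= natrD mulrDl.
rewrite big_split /= [X in _ = X + _](_ : _ = if P k then f k else 0); last first.
  rewrite big_mkcond (bigD1_seq k) ?iota_uniq ?mem_index_iota //= eqxx mul1r.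
  rewrite big1 ?addr0 // => e ne; rewrite eq_sym (negPf ne) mul0r; by case: ifP.
by case: ifP => _; rewrite ?add0r.
Qed.

Section Orbits.
Variable T : finType.
Implicit Types (s : {perm T}) (x : T).

Lemma permX_fix s x i : ((s ^+ i)%g x == x) = (#|porbit s x| %| i)%N.
Proof.
set r := #|porbit s x|.
have r0 : (0 < r)%N by apply/card_gt0P; exists x; exact: porbit_id.
have per j : (s ^+ (j * r))%g x = x.
  elim: j => [|j IH]; first by rewrite mul0n expg0 perm1.
  by rewrite mulSn addnC expgD permM IH permX iter_porbit.
rewrite {1}(divn_eq i r) expgD permM per /dvdn permX.
have hb : (i %% r < r)%N by rewrite ltn_mod.
have := @nth_uniq _ x (traject s x r) (i %% r)%N 0%N.
by rewrite !nth_traject // => -> //; rewrite ?size_traject ?uniq_traject_porbit.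
Qed.

Lemma card_porbitX s x m : (0 < m)%N ->
  #|porbit (s ^+ m)%g x| = (#|porbit s x| %/ gcdn #|porbit s x| m)%N.
Proof.
move=> m0; set r := #|porbit s x|.
have r0 : (0 < r)%N by apply/card_gt0P; exists x; exact: porbit_id.
have g0 : (0 < gcdn r m)%N by rewrite gcdn_gt0 r0.
have key i : (#|porbit (s ^+ m)%g x| %| i)%N = (r %/ gcdn r m %| i)%N.
  rewrite -permX_fix -expgM permX_fix -/r.
  have [u ru] : exists u, r = (u * gcdn r m)%N.
    by exists (r %/ gcdn r m)%N; rewrite divnK // dvdn_gcdl.
  have [w mw] : exists w, m = (w * gcdn r m)%N.
    by exists (m %/ gcdn r m)%N; rewrite divnK // dvdn_gcdr.
  have cop : coprime u w.
    by rewrite /coprime -(eqn_pmul2r g0) muln_gcdl -ru -mw mul1n.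
  move: (gcdn r m) ru mw g0 => g ru mw g0.
  by rewrite ru mulnK // mw mulnAC dvdn_pmul2r // Gauss_dvdr.
by apply/eqP; rewrite eqn_dvd key dvdnn -key dvdnn.
Qed.

Lemma card_porbits s : #|porbits s|%:R = \sum_x (#|porbit s x|%:R)^-1 :> rat.
Proof.
rewrite (partition_big (porbit s) (mem (porbits s))) /=; last first.
  by move=> x _; apply: imset_f.
rewrite -sum1_card natr_sum; apply: eq_bigr => o /imsetP[y _ ->].
rewrite (eq_bigr (fun=> (#|porbit s y|%:R)^-1)) => [|x /eqP -> //].
rewrite sumr_const [X in _ = _ *+ X](_ : _ = #|porbit s y|); last first.
  by apply: eq_card => x; rewrite -[RHS]eq_porbit_mem.
rewrite -[RHS]mulr_natl divff // pnatr_eq0 -lt0n; apply/card_gt0P.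
by exists y; exact: porbit_id.
Qed.

Lemma card_invariant_ffun (F : finType) s (x0 : T) :
  #|[set f : {ffun T -> F} | [forall x, f (s x) == f x]]| = (#|F| ^ #|porbits s|)%N.
Proof.
have ins x : porbit s x \in porbits s by apply: imset_f.
pose idx x := enum_rank_in (ins x0) (porbit s x).
pose Phi (y : {ffun 'I_#|porbits s| -> F}) := [ffun x => y (idx x)].
have surj i : exists x, idx x = i.
  have /imsetP[x _ e] := enum_valP i; exists x.
  by rewrite /idx -e enum_valK_in.
have inj : injective Phi.
  move=> y z /ffunP e; apply/ffunP => i; have [x <-] := surj i.
  by have := e x; rewrite !ffunE.
have -> : (#|F| ^ #|porbits s| = #|{ffun 'I_#|porbits s| -> F}|)%N.
  by rewrite card_ffun card_ord.
rewrite -(card_imset _ inj); apply: eq_card => f; apply/idP/imsetP => [|[y _ ->]].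
  rewrite inE => /forallP hf.
  have orb x x' : x' \in porbit s x -> f x' = f x.
    move=> /porbitP[j ->]; elim: j => [|j IH]; first by rewrite expg0 perm1.
    by rewrite expgSr permM (eqP (hf _)).
  pose rep i := odflt x0 [pick x | idx x == i].
  exists [ffun i => f (rep i)] => //; apply/ffunP => x; rewrite !ffunE.
  rewrite /rep; case: pickP => [x' /eqP e|/(_ x)]; last by rewrite eqxx.
  apply: orb; rewrite -eq_porbit_mem.
  have := congr1 (fun i => enum_val i) e; rewrite !enum_rankK_in ?ins // => ->.
  by rewrite eqxx.
rewrite inE; apply/forallP => x; rewrite !ffunE; apply/eqP; congr (y _); rewrite /idx.
congr (enum_rank_in _ _); apply/eqP.
by rewrite eq_porbit_mem -[s x]/(aperm x s) -[s]expg1 mem_porbit.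
Qed.

End Orbits.

(** * The group algebra *)

Section GroupAlgebra.
Variables (gT : finGroupType) (F : finFieldType).
Hypothesis gC : forall x y : gT, (x * y = y * x)%g.

(** F[G] with convolution. The proof of commutativity is a parameter of the type so that the
    commutative ring structure can be attached. *)
Definition galg of (forall x y : gT, (x * y = y * x)%g) := {ffun gT -> F}.
Local Notation A := (galg gC).

HB.instance Definition _ := Finite.copy A {ffun gT -> F}.
HB.instance Definition _ := GRing.Zmodule.copy A {ffun gT -> F}.

Definition gcoef (x : A) (g : gT) : F := (x : {ffun gT -> F}) g.
Definition gmk (f : gT -> F) : A := [ffun g => f g].

Lemma gcoefE f g : gcoef (gmk f) g = f g. Proof. by rewrite /gcoef ffunE. Qed.
Lemma galgP (x y : A) : (forall g, gcoef x g = gcoef y g) -> x = y.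
Proof. by move=> e; apply/ffunP. Qed.
Lemma gcoefD x y g : gcoef (x + y) g = gcoef x g + gcoef y g.
Proof. by rewrite /gcoef ffunE. Qed.
Lemma gcoef0 g : gcoef 0 g = 0. Proof. by rewrite /gcoef ffunE. Qed.

Let one := gmk (fun g => (g == 1%g)%:R).
Let mul x y := gmk (fun g => \sum_h gcoef x h * gcoef y (h^-1 * g)%g).

Let mulA : associative mul.
Proof.
move=> x y z; apply: galgP => g; rewrite !gcoefE.
under eq_bigr => h _ do rewrite gcoefE mulr_sumr.
under [RHS]eq_bigr => k _ do rewrite gcoefE mulr_suml.
rewrite [RHS]exchange_big /=; apply: eq_bigr => h _.
rewrite [RHS](reindex_inj (mulgI h)) /=; apply: eq_bigr => k _.
by rewrite mulrA mulKg invMg mulgA.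
Qed.

Let mulC : commutative mul.
Proof.
move=> x y; apply: galgP => g; rewrite !gcoefE.
rewrite (reindex_inj (h := fun h => (h^-1 * g)%g)) /=; last by move=> h k /mulIg /invg_inj.
by apply: eq_bigr => h _; rewrite mulrC invMg invgK gC mulgA mulgV mul1g.
Qed.

Let mul1 : left_id one mul.
Proof.
move=> x; apply: galgP => g; rewrite gcoefE (bigD1 1%g) //= gcoefE eqxx mul1r.
rewrite invg1 mul1g big1 ?addr0 // => h ne; by rewrite gcoefE (negPf ne) mul0r.
Qed.

Let mulD : left_distributive mul +%R.
Proof.
move=> x y z; apply: galgP => g; rewrite gcoefD !gcoefE -big_split /=.
by apply: eq_bigr => h _; rewrite gcoefD mulrDl.
Qed.

Let one_neq0 : one != 0.
Proof.
apply/eqP => /(congr1 (fun x => gcoef x 1%g)); rewrite gcoefE gcoef0 eqxx.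
by apply/eqP; rewrite oner_eq0.
Qed.

HB.instance Definition _ := GRing.Zmodule_isComNzRing.Build A mulA mulC mul1 mulD one_neq0.

Lemma gcoefM (x y : A) g : gcoef (x * y) g = \sum_h gcoef x h * gcoef y (h^-1 * g)%g.
Proof. by rewrite gcoefE. Qed.

Lemma gcoef1 g : gcoef (1 : A) g = (g == 1%g)%:R. Proof. by rewrite gcoefE. Qed.

Definition gelt (g : gT) : A := gmk (fun h => (h == g)%:R).
Definition gscal (c : F) : A := gmk (fun g => c * (g == 1%g)%:R).

Lemma gcoef_scalM c x g : gcoef (gscal c * x) g = c * gcoef x g.
Proof.
rewrite gcoefM (bigD1 1%g) //= gcoefE eqxx mulr1 invg1 mul1g big1 ?addr0 // => h ne.
by rewrite gcoefE (negPf ne) mulr0 mul0r.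
Qed.

Lemma gscal_is_zmod_morphism : {morph gscal : c d / c - d}.
Proof.
move=> c d; apply: galgP => g; apply: (addIr (gcoef (gscal d) g)).
by rewrite -!gcoefD subrK gcoefD !gcoefE -mulrDl subrK.
Qed.

Lemma gscal_is_monoid_morphism : (gscal 1 = 1) * {morph gscal : c d / c * d}.
Proof.
split; first by apply: galgP => g; rewrite gcoef1 gcoefE mul1r.
by move=> c d; apply: galgP => g; rewrite gcoef_scalM !gcoefE mulrA.
Qed.

HB.instance Definition _ := GRing.isZmodMorphism.Build F A gscal gscal_is_zmod_morphism.
HB.instance Definition _ := GRing.isMonoidMorphism.Build F A gscal gscal_is_monoid_morphism.

Lemma gelt1 : gelt 1%g = 1. Proof. by apply: galgP => g; rewrite [RHS]gcoef1 [LHS]gcoefE. Qed.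

Lemma geltM g h : gelt (g * h)%g = gelt g * gelt h.
Proof.
apply: galgP => k; rewrite gcoefM (bigD1 g) //= !gcoefE eqxx mul1r big1 ?addr0.
  by congr (_%:R); congr nat_of_bool; apply/eqP/eqP => [->|<-]; rewrite ?mulKg ?mulKVg.
by move=> i ne; rewrite gcoefE (negPf ne) mul0r.
Qed.

Lemma geltX g n : gelt g ^+ n = gelt (g ^+ n)%g.
Proof.
by elim: n => [|n IH]; rewrite ?expr0 ?expg0 ?gelt1 // exprS expgS IH geltM.
Qed.

Lemma gcoef_sum (I : Type) (r : seq I) (P : pred I) (f : I -> A) g :
  gcoef (\sum_(i <- r | P i) f i) g = \sum_(i <- r | P i) gcoef (f i) g.
Proof. exact: (big_morph (fun x => gcoef x g) (fun x y => gcoefD x y g) (gcoef0 g)). Qed.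

Lemma galg_basis (x : A) : x = \sum_g gscal (gcoef x g) * gelt g.
Proof.
apply: galgP => g; rewrite gcoef_sum (bigD1 g) //= gcoef_scalM gcoefE eqxx mulr1.
rewrite big1 ?addr0 // => h ne.
by rewrite gcoef_scalM gcoefE eq_sym (negPf ne) mulr0.
Qed.

Local Notation q := #|F|.

Lemma expf_cardX (c : F) M : c ^+ (q ^ M) = c.
Proof. by elim: M => [|M IH]; rewrite ?expr1 // expnSr exprM IH expf_card. Qed.

Lemma frob_sum (I : Type) (r : seq I) (f : I -> A) M :
  (\sum_(i <- r) f i) ^+ (q ^ M) = \sum_(i <- r) f i ^+ (q ^ M).
Proof.
have [l pl lF] := finPcharP F.
have qn : [pchar A].-nat (q ^ M)%N.
  rewrite pnatX; apply/orP; left; rewrite (card_pprimeChar lF) pnatX; apply/orP; left.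
  by rewrite pnatE //; apply: (rmorph_pchar gscal).
apply: (big_morph (fun x : A => x ^+ (q ^ M))).
  by move=> x y; exact: exprDn_pchar.
by rewrite expr0n expn_eq0 gtn_eqF ?eqxx // ltnW // finNzRing_gt1.
Qed.

Lemma galg_frob (x : A) M :
  x ^+ (q ^ M) = \sum_g gscal (gcoef x g) * gelt (g ^+ (q ^ M))%g.
Proof.
rewrite {1}(galg_basis x) frob_sum; apply: eq_bigr => g _.
by rewrite exprMn -rmorphXn expf_cardX geltX.
Qed.

Variable T : nat.
(** Such a T exists for a p-group if p does not divide q. It makes g -> g^q bijective and gives
    x^(q^T) = x on F[G], which stands in for semisimplicity. *)
Hypotheses (T0 : (0 < T)%N) (gX : forall g : gT, (g ^+ (q ^ T) = g)%g).

Lemma galg_exp (x : A) : x ^+ (q ^ T) = x.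
Proof.
rewrite galg_frob [RHS]galg_basis; apply: eq_bigr => g _; by rewrite gX.
Qed.

Lemma powq_inj : injective (fun g : gT => (g ^+ q)%g).
Proof.
apply: (can_inj (g := fun g => (g ^+ (q ^ T.-1))%g)) => g /=.
by rewrite -expgM -expnS prednK // gX.
Qed.

Definition frobperm : {perm gT} := perm powq_inj.

Lemma frobpermX M g : (frobperm ^+ M)%g g = (g ^+ (q ^ M))%g.
Proof.
elim: M => [|M IH]; first by rewrite expg0 perm1.
by rewrite expgSr permM IH permE -expgM -expnSr.
Qed.

(** The M-th power of Frobenius is F-linear and permutes the basis G, so its fixed points are the
    functions constant on orbits. *)
Lemma card_fixpts M : (#|fixpts F (1%R : A) M| = q ^ #|porbits (frobperm ^+ M)%g|)%N.
Proof.
rewrite -(card_invariant_ffun F _ 1%g); apply: eq_card => x.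
rewrite [LHS]inE [RHS]inE mulr1 eqxx /=.
have gcoefX (g : gT) : gcoef (x ^+ (q ^ M)) ((frobperm ^+ M)%g g) = gcoef x g.
  rewrite galg_frob gcoef_sum (bigD1 g) //= gcoef_scalM gcoefE frobpermX eqxx mulr1.
  rewrite big1 ?addr0 // => h ne; rewrite gcoef_scalM gcoefE -!frobpermX.
  by rewrite (inj_eq perm_inj) eq_sym (negPf ne) mulr0.
apply/eqP/forallP => [e g|e].
  by apply/eqP; rewrite -[RHS](gcoefX g) e.
apply: galgP => g; rewrite -[g](permKV (frobperm ^+ M)%g) gcoefX.
by rewrite -[LHS](eqP (e _)).
Qed.

Lemma card_Hom_GL n : #|Hom_GL gT F n| = #|homs gscal 1 n|.
Proof.
pose ext (f : {ffun gT -> 'M[F]_n}) : {ffun A -> 'M[F]_n} :=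
  [ffun x => \sum_g gcoef x g *: f g].
have ext_delta f g : ext f (gelt g) = f g.
  rewrite ffunE (bigD1 g) //= gcoefE eqxx scale1r big1 ?addr0 // => h ne.
  by rewrite gcoefE (negPf ne) scale0r.
have inj : injective ext.
  by move=> f f' e; apply/ffunP => g; rewrite -!ext_delta e.
rewrite -(card_imset _ inj); apply: eq_card => f; apply/imsetP/idP => [[h]|hf].
  rewrite inE => /andP[/forallP hu /forallP hM] ->.
  have {}hM x y : h (x * y)%g = h x *m h y by have /forallP/(_ y)/eqP := hM x.
  have h1 : h 1%g = 1%:M.
    by rewrite -[LHS](mulKmx (hu 1%g)) -hM mulg1 mulVmx.
  have extD x y : ext h (x + y) = ext h x + ext h y.
    rewrite !ffunE -big_split; apply: eq_bigr => g _ /=.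
    by rewrite gcoefD scalerDl.
  have ext0 : ext h 0 = 0 by apply: (addIr (ext h 0)); rewrite -extD !add0r.
  have extZ c x : ext h (gscal c * x) = c *: ext h x.
    rewrite !ffunE scaler_sumr; apply: eq_bigr => g _.
    by rewrite gcoef_scalM scalerA.
  apply/homsP; split=> [//|x y|c]; last first.
    by rewrite extZ -gelt1 ext_delta h1 scalemx1.
  rewrite [x in LHS]galg_basis [y in LHS]galg_basis mulr_suml (big_morph _ extD ext0).
  rewrite [ext h x]ffunE mulmx_suml; apply: eq_bigr => g _.
  rewrite mulr_sumr (big_morph _ extD ext0) [ext h y]ffunE mulmx_sumr.
  apply: eq_bigr => k _; rewrite mulrACA -rmorphM -geltM extZ ext_delta hM.
  by rewrite -scalemxAl -scalemxAr scalerA.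
exists [ffun g => f (gelt g)]; last first.
  apply/ffunP => x; rewrite ffunE [x in LHS]galg_basis (hom_sum hf).
  by apply: eq_bigr => g _; rewrite (homZ hf) ffunE.
rewrite inE; apply/andP; split; apply/forallP => g.
  rewrite ffunE; have : f (gelt g) *m f (gelt g^-1%g) = 1%:M.
    by rewrite -(homM hf) -geltM mulgV gelt1 (home hf).
  by case/mulmx1_unit.
by apply/forallP => k; rewrite !ffunE geltM (homM hf).
Qed.

(* The degrees of the simple components of [F[G]] are distributed like the
   sizes of the orbits of [g |-> g^q] on [G]: both satisfy the same identities
   [sum_k gcd(k, M) = log_q #{x in F[G] | x^(q^M) = x}]. *)
Lemma galg_decomposition : exists s : seq nat,
  [/\ all (leq 1) s,
      forall M, (0 < M)%N ->
        (\sum_(k <- s | k %| M) k = #|[set g : gT | (g ^+ (q ^ M))%g == g]|)%N &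
      forall n N, (n < N)%N ->
        #|Hom_GL gT F n|%:R / gam q%:R n = (fprod F s N)`_n].
Proof.
have P1 : (1 < q ^ T)%N by rewrite -(expn0 q) ltn_exp2l // finNzRing_gt1.
have [s [s1 hs hn]] := decomposes_exists gscal P1 galg_exp (mulr1 1).
exists s; split=> // [M M0|n N lt_nN]; last by rewrite card_Hom_GL; apply: hn.
pose s' := [seq #|porbit frobperm g| | g <- enum gT].
pose B := (\max_(k <- s ++ s') k).+1.
have leB k : k \in s ++ s' -> (k < B)%N.
  by move=> hk; rewrite ltnS; exact: (@leq_bigmax_seq _ _ xpredT (fun i => i) k hk isT).
have sB k : k \in s -> (0 < k < B)%N.
  by move=> hk; rewrite (allP s1 _ hk) leB // mem_cat hk.
have sB' k : k \in s' -> (0 < k < B)%N.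
  move=> hk; rewrite leB ?mem_cat ?hk ?orbT // andbT.
  by move/mapP: hk => [g _ ->]; apply/card_gt0P; exists g; exact: porbit_id.
have s'E (f : nat -> rat) (Q : pred nat) : \sum_(k <- s' | Q k) f k =
    \sum_(g | Q #|porbit frobperm g|) f #|porbit frobperm g|.
  by rewrite big_map big_enum_cond.
(* An orbit of size e is listed e times in s', hence the division by e. *)
pose d e : rat := (count_mem e s)%:R - (count_mem e s')%:R / e%:R.
have hd e : (0 < e < B)%N -> d e = 0.
  apply: gcd_inversion => m m0.
  under eq_bigr => e' _ do rewrite mulrBl -mulrA.
  rewrite sumrB -(sum_count xpredT _ sB) -(sum_count xpredT _ sB').
  apply/eqP; rewrite subr_eq0; apply/eqP.
  have := card_fixpts m; rewrite hs // => /eqP.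
  rewrite eqn_exp2l ?finNzRing_gt1 // => /eqP /(congr1 (fun x => x%:R : rat)).
  rewrite natr_sum => ->; rewrite card_porbits s'E; apply: eq_bigr => g _.
  rewrite card_porbitX // mulrC.
  set r := #|porbit frobperm g|; have r0 : (0 < r)%N.
    by apply/card_gt0P; exists g; exact: porbit_id.
  have g0 : (gcdn r m)%:R != 0 :> rat by rewrite pnatr_eq0 gtn_eqF // gcdn_gt0 r0.
  have e1 : r%:R = (r %/ gcdn r m)%:R * (gcdn r m)%:R :> rat.
    by rewrite -natrM divnK // dvdn_gcdl.
  by rewrite e1 invfM mulrCA mulfV // mulr1.
apply/eqP; rewrite -(eqr_nat rat) natr_sum; apply/eqP.
rewrite (sum_count _ (fun k => k%:R) sB).
transitivity (\sum_(k <- s' | (k %| M)%N) (1 : rat)).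
  rewrite (sum_count _ (fun=> 1) sB') big_nat_cond [RHS]big_nat_cond.
  apply: eq_bigr => e /andP[he _]; rewrite mulr1.
  have e0 : e%:R != 0 :> rat by rewrite pnatr_eq0 gtn_eqF //; case/andP: he.
  by have /eqP := hd e he; rewrite subr_eq0 => /eqP ->; rewrite divfK.
rewrite s'E sumr_const; congr (_%:R); apply: eq_card => g.
by rewrite [RHS]inE -frobpermX permX_fix.
Qed.

End GroupAlgebra.

(** * The coefficients of F(G, q; z) *)

Section LogDerivativeOfProduct.
Variables (F : finFieldType) (N : nat) (A : nat -> {poly int}).
Hypothesis N0 : (0 < N)%N.
Local Notation q := (#|F|%:R : rat).
Let a e m : rat := ev (q^-1 ^+ m) (A e) / (1 - q^-1 ^+ m).
Hypothesis hA : forall Q, 1 < Q ->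
  LD N (fser Q N) (dsum N (fun e m => ev (Q^-1 ^+ m) (A e) / (1 - Q^-1 ^+ m))).

Lemma coef0_dsum (R : comNzRingType) (f : nat -> nat -> R) : (dsum N f)`_0 = 0.
Proof.
rewrite coef_dsum big1_seq // => e; rewrite mem_index_iota => /and3P[_ e0 _].
rewrite big1_seq // => m; rewrite mem_index_iota => /and3P[_ m0 _].
by rewrite ltn_eqF ?muln_gt0 ?e0 // mulr0.
Qed.

Lemma dsum_compXn (f : nat -> nat -> rat) k : (0 < k)%N ->
  eqmod N ((dsum N (fun e m => f e (k * m)%N) \Po 'X^k) *+ k)
    (dsum N (fun e M => if (k %| M)%N then f e M *+ k else 0)).
Proof.
move=> k0; apply/eqmodP => n lt_nN; rewrite coefMn coef_comp_poly_Xn //.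
have [->|n0] := posnP n.
  by rewrite dvdn0 div0n !coef0_dsum mul0rn.
rewrite [RHS]coef_dsum_divisors ?n0 //.
case: ifP => [/dvdnP[m em]|ndv]; last first.
  rewrite mul0rn big1 // => e en; case: ifP => h; rewrite ?mul0rn //.
  by rewrite -(divnK en) dvdn_mulr in ndv.
have m0 : (0 < m)%N by move: n0; rewrite em; case: (m).
have mN : (m < N)%N by rewrite (leq_ltn_trans _ lt_nN) // em leq_pmulr.
rewrite em mulnK // coef_dsum_divisors ?m0 // -sumrMnl.
rewrite big_mkcond [RHS]big_mkcond; apply: eq_big_nat => e /andP[e0 _].
have [/dvdnP[j ej]|nem] := boolP (e %| m)%N.
  rewrite ej mulnK // -mulnA [(e * k)%N]mulnC mulnA dvdn_mull // mulnK //.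
  by rewrite mulnC dvdn_mull // mulrnAC.
case: ifP => // h; rewrite ifN ?mul0rn //; apply: contra nem => h'.
have [j ej] := dvdnP h'; have := divnK h; rewrite ej mulnAC => /eqP.
by rewrite eqn_pmul2r // => /eqP <-; rewrite dvdn_mull.
Qed.

(** The logarithm of f_{q^k}(z^k) has the terms A_e(q^(-km)) / (m (1 - q^(-km))) z^(ekm); setting M
    = km replaces 1/m by k/M. *)
Lemma LD_fprod s : all (leq 1) s ->
  LD N (fprod F s N)
    (dsum N (fun e M => a e M * (\sum_(k <- s | k %| M) k)%N%:R)).
Proof.
have q1 : 1 < q by rewrite ltr1n finNzRing_gt1.
elim: s => [|k s IH] /=.
  move=> _; rewrite /fprod big_nil (eq_dsum (b := fun _ _ => 0)) ?dsum0; first exact: LD1.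
  by move=> e m _ _; rewrite big_nil mulr0.
move=> /andP[k0 /IH {}IH]; rewrite /fprod big_cons.
have Q1 : 1 < q ^+ k by rewrite exprn_egt1 // gtn_eqF.
apply: (LD_eqmodr (LDM (LD_compXn k0 (hA Q1)) IH)).
rewrite [X in X \Po _](_ : _ = dsum N (fun e m => a e (k * m)%N)); last first.
  by apply: eq_dsum => e m _ _; rewrite /a exprM (exprVn _ k).
apply: (eqmod_trans _ (eqmodD (dsum_compXn a k0) (eqmod_refl _ _))).
rewrite -dsumD; apply/eqmodP => n _; congr (polyseq _)`_n.
apply: eq_dsum => e M _ _; rewrite big_cons; case: ifP => _; last by rewrite add0r.
by rewrite -[_ *+ k]mulr_natr natrD mulrDr.
Qed.

End LogDerivativeOfProduct.

Lemma gam_qpoch (Q : rat) n : gam Q n = (-1) ^+ n * (Q ^+ 'C(n, 2) * qpoch Q n).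
Proof.
elim: n => [|n IH].
  by rewrite gam0 /qpoch big_geq // bin0n !expr0 !mulr1.
rewrite gamS IH binS bin1 /qpoch (big_nat_recr n.+1) //= exprD !exprS; ring.
Qed.

Section AbelianGroup.
Variables (p r : nat) (k : nat -> nat).
Hypothesis pp : prime p.
Local Notation G := (abelian_pgroup p r k).

Lemma abelian_pgroupC (x y : G) : (x * y = y * x)%g.
Proof. by apply/ffunP => i; rewrite !ffunE !FinRing.zmodMgE addrC. Qed.

Lemma abelian_pgroupX (x : G) n i : (x ^+ n)%g i = x i *+ n.
Proof.
elim: n => [|n IH]; first by rewrite expg0 ffunE FinRing.zmod1gE.
by rewrite expgS ffunE FinRing.zmodMgE IH mulrS.
Qed.

Lemma card_Zp_torsion j n : (0 < n)%N ->
  #|[set x : 'Z_(p ^ j.+1) | x *+ n == 0]| = (p ^ minn (logn p n) j.+1)%N.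
Proof.
move=> n0; set m := (p ^ j.+1)%N.
have m1 : (1 < m)%N by rewrite -(expn0 p) ltn_exp2l ?prime_gt1.
have m0 : (0 < m)%N by apply: ltnW.
set t := minn _ _.
have tj : (t <= j.+1)%N by apply: geq_minr.
have dvP (x : 'Z_m) : (x *+ n == 0) = (p ^ (j.+1 - t) %| x)%N.
  rewrite -[x in LHS]natr_Zp -mulrnA -[_ == 0]val_eqE /= val_Zp_nat // -/(dvdn _ _).
  have [s ps ->] := pfactor_coprime pp n0.
  rewrite mulnCA Gauss_dvdr; last by rewrite /m coprimeXl.
  have [lt|vge] := leqP (logn p n) j.+1; rewrite /t.
    rewrite (minn_idPl lt) /m -{1}(subnK lt) expnD dvdn_pmul2r // expn_gt0 prime_gt0 //.
  rewrite (minn_idPr (ltnW vge)) subnn expn0 dvd1n dvdn_mull // /m dvdn_exp2l //.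
  exact: ltnW.
pose f (y : 'I_(p ^ t)) : 'Z_m := inZp (y * p ^ (j.+1 - t))%N.
have fE (y : 'I_(p ^ t)) : f y = (y * p ^ (j.+1 - t))%N :> nat.
  rewrite /= modn_small // (Zp_cast m1) /m -{2}(subnK tj) expnD mulnC ltn_pmul2l //.
  by rewrite expn_gt0 prime_gt0.
have pp0 : (0 < p ^ (j.+1 - t))%N by rewrite expn_gt0 prime_gt0.
have finj : injective f.
  move=> y z /(congr1 (@nat_of_ord _)); rewrite !fE => /eqP.
  by rewrite eqn_pmul2r // => /eqP e; apply: val_inj.
rewrite -[RHS]card_ord -(card_imset _ finj); apply: eq_card => x.
rewrite inE dvP; apply/idP/imsetP => [/dvdnP[y ey]|[y _ ->]]; last by rewrite fE dvdn_mull.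
have hy : (y < p ^ t)%N.
  rewrite -(ltn_pmul2r pp0) -ey -expnD subnKC // -/m.
  by apply: leq_trans (ltn_ord x) _; rewrite (Zp_cast m1).
by exists (Ordinal hy) => //; apply: ord_inj; rewrite fE.
Qed.

Lemma sum_factor_index n :
  (\sum_(i : factor_index r k) minn n (tag i).+1 = c r k n)%N.
Proof.
rewrite -(sig_big_dep (J := fun j : 'I_r => 'I_(k j.+1)) (fun=> true)
  (fun _ _ => true) (fun j _ => minn n j.+1)) /=.
rewrite /c big_add1 /= big_mkord; apply: eq_bigr => j _.
by rewrite sum_nat_const card_ord mulnC.
Qed.

(** The condition says that g is killed by n - 1, and C_(p^j) has p^min(v, j) such elements for v =
    v_p(n - 1): this is the origin of c_i. *)
Lemma card_fix_abelian n : (1 < n)%N ->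
  #|[set g : G | (g ^+ n)%g == g]| = (p ^ c r k (logn p (n - 1)))%N.
Proof.
move=> n1; have n0 : (0 < n - 1)%N by rewrite subn_gt0.
pose Fam (i : factor_index r k) := [set x : 'Z_(p ^ (tag i).+1) | x *+ (n - 1) == 0].
have -> : #|[set g : G | (g ^+ n)%g == g]| =
  #|(family Fam : simpl_pred {dffun forall i : factor_index r k, 'Z_(p ^ (tag i).+1)})|.
  apply: eq_card => g; rewrite inE; apply/eqP/familyP => [e i|e].
    rewrite inE; have := congr1 (fun h : G => h i) e.
    rewrite /= abelian_pgroupX -{1}(subnK (ltnW n1)) addn1 mulrS => /eqP.
    by rewrite -subr_eq0 addrAC subrr add0r.
  apply/ffunP => i; rewrite abelian_pgroupX -(subnK (ltnW n1)) addn1 mulrS.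
  by have := e i; rewrite inE => /eqP ->; rewrite addr0.
rewrite card_family -sum_factor_index expn_sum foldrE big_image.
by apply: eq_bigr => i _; apply: card_Zp_torsion.
Qed.

Lemma abelian_pgroup_exp (g : G) n : (n = 1 %[mod p ^ r])%N -> (g ^+ n = g)%g.
Proof.
move=> h; apply/ffunP => i; rewrite abelian_pgroupX.
have lt_ir : ((tag i).+1 <= r)%N := ltn_ord (tag i).
have m1 : (1 < p ^ (tag i).+1)%N by rewrite -(expn0 p) ltn_exp2l ?prime_gt1.
have h' : (n = 1 %[mod p ^ (tag i).+1])%N.
  have dv : (p ^ (tag i).+1 %| p ^ r)%N by apply: dvdn_exp2l.
  by rewrite -(modn_dvdm n dv) h modn_dvdm.
have e1 : n%:R = 1 :> 'Z_(p ^ (tag i).+1).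
  by rewrite -[1]/(1%:R); apply: ord_inj; rewrite !val_Zp_nat.
by rewrite -mulr_natr e1 mulr1.
Qed.

End AbelianGroup.

Theorem theorem2p11 (p q : nat) (F : finFieldType) (d r : nat)
    (k : nat -> nat) (l : nat)
    (hp : prime p) (hq : #|F| = q) (hpq : ~~ (p %| q)%N)
    (hd : d = mult_order p q)
    (hr : (0 < r)%N) (hkr : (0 < k r)%N)
    (hl : least_minimizer (slope p q d r k) l) (n : nat) :
  let m := (n %/ (d * p ^ l))%N in
  ((b p q d r k l * m%:Z - (logn p m`!)%:Z)%:E
     <= vp p (coefz n (Fseries (abelian_pgroup p r k) F)))%E.
Proof.
cbv zeta; subst d q; set q := #|F| in hpq hl *; set d := mult_order p q in hl *.
have q1 : (1 < q)%N by apply: finNzRing_gt1.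
have d0 : (0 < d)%N by apply: mult_order_gt0.
pose W n : int := wbd p q r k l (n %/ (d * p ^ l))%N.
rewrite -[_ - _]/(W n); apply: vge_vp => //.
have D0 : (0 < d * p ^ l)%N by rewrite muln_gt0 d0 expn_gt0 prime_gt0.
have W_le0 n' : W n' <= 0 by apply: (wbd_le0 hp hpq q1 hr hkr hl).
have W_add m1 m2 : W (m1 + m2)%N <= W m1 + W m2.
  apply: le_trans (wbd_superadd l hp hpq q1 hr hkr _ _).
  by apply: (wbd_anti hp hpq q1 hr hkr hl); rewrite leq_divRL // mulnDl leq_add // leq_divM.
(* By Euler, q^T = 1 modulo p^r, and p^r kills G. *)
pose T := totient (p ^ r).
have T0 : (0 < T)%N by rewrite totient_gt0 expn_gt0 prime_gt0.
have gX (g : abelian_pgroup p r k) : (g ^+ (q ^ T) = g)%g.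
  apply: abelian_pgroup_exp => //; apply: Euler_exp_totient.
  by rewrite coprime_sym coprimeXl // prime_coprime.
have [s [s1 hs hn]] := galg_decomposition (@abelian_pgroupC p r k) T0 gX.
have N0 : (0 < n.+1)%N by [].
have [A hA] := fser_LD N0.
have hF := LD_fprod F hA s1.
have eF : coefz n (Fseries (abelian_pgroup p r k) F) = (fprod F s n.+1)`_n.
  rewrite -hn // /coefz /Fseries -/q gam_qpoch.
  have sgn : ((-1) ^+ n)^-1 = (-1) ^+ n :> rat by rewrite -exprVn invrN1.
  by rewrite [in RHS]invfM sgn mulrCA !mulrA.
rewrite eF; apply: (@weighted_good p q n.+1 W A _ hp hpq q1 N0 W_le0 W_add _ _ hF n) => //.
move=> M /andP[M0 _].
have -> : (\sum_(j <- s | j %| M) j = p ^ c r k (logn p (q ^ M - 1)))%N.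
  by rewrite hs // card_fix_abelian // -(expn0 q) ltn_exp2l.
have qM : (0 < q ^ M - 1)%N by rewrite subn_gt0 -(expn0 q) ltn_exp2l.
have [dM|ndM] := boolP (d %| M)%N; [right | left]; last first.
  (* Here v_p(q^M - 1) = 0, and the weight is p^(c_0) = 1. *)
  have pM : ~~ (p %| q ^ M - 1)%N by rewrite dvdn_mult_order.
  split=> //; have -> : logn p (q ^ M - 1) = 0%N.
    by apply/eqP; rewrite -leqn0 leqNgt logn_gt0 mem_primes hp qM.
  by rewrite /c big1 ?expn0 // => j _; rewrite min0n.
split; first by rewrite dvdn_mult_order.
have [M1 eM] := dvdnP dM.
have M10 : (0 < M1)%N by move: M0; rewrite eM muln_gt0 => /andP[].
have [M' pM' eM1] := pfactor_coprime hp M10.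
set i := logn p M1 in eM1.
have {eM1}eM : M = (d * p ^ i * M')%N by rewrite eM eM1; lia.
have npM' : ~~ (p %| M')%N by rewrite -prime_coprime // coprime_sym.
have M'0 : (0 < M')%N by case: (M') npM' => //; rewrite dvdn0.
have lamM : logn p (q ^ M - 1) = lambda p q d i by rewrite eM lambda_mulr.
have nd : logn p d = 0%N.
  apply/eqP; rewrite -leqn0 leqNgt logn_gt0 mem_primes hp d0 /=.
  exact: ndvd_mult_order.
have lM : logn p M = i.
  have nM' : logn p M' = 0%N.
    by apply/eqP; rewrite -leqn0 leqNgt logn_gt0 mem_primes hp M'0.
  rewrite eM !lognM ?muln_gt0 ?expn_gt0 ?d0 ?(prime_gt0 hp) //.
  by rewrite nd nM' pfactorK // addn0.
(* As d and M' are prime to p, the weight p^c divided by M (q^M - 1) has valuation c_(lambda_i) - i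
   - lambda_i = b_i. *)
exists (b p q d r k i).
  rewrite /b -lamM -addrA; apply: vgeM => //.
    by have := vge_nat hp (p ^ c r k (logn p (q ^ M - 1))); rewrite pfactorK.
  have := vge_natV hp (n := M * (q ^ M - 1)); rewrite muln_gt0 M0 qM => /(_ isT).
  by rewrite lognM // lM PoszD opprD addrC.
(* The degree e M j is at least d p^i j, and the bound decreases with the degree. *)
move=> e j e0; apply: le_trans (wbd_leq hp hpq q1 hr hkr hl i j).
apply: (wbd_anti hp hpq q1 hr hkr hl).
have -> : (e * M * j = d * (p ^ i * (e * M' * j)))%N by rewrite eM; lia.
rewrite divnMl // leq_div2r // leq_mul2l leq_pmull ?orbT //.
by rewrite muln_gt0 e0.
Qed.
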